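(* Assume that $f,a,B$ are uniformly Lipschitz continuous on the torus $\mathcal X$; that there exists $\alpha\in L^\infty(\mathcal X;\mathbb R^m)$ with $a(x)=B(x)\alpha(x)$ for all $x\in\mathcal X$; and that the optimal occupation measure $\mu^*$ is absolutely continuous with respect to Lebesgue measure and there exists $M>0$ such that $\mu^*(x)\le M$ for all $x\in\mathcal X$. Let $c_\Omega>0$ be a constant, depending only on the control problem and the reproducing kernel Hilbert space $\mathcal H$, such that, for all $r_V,r_w\ge0$, all $V\in\mathcal H$ with $\|V\|_{\mathcal H}\le r_V$, all $w\in\mathcal H^m$ with $\|w\|_{\mathcal H^m}\le r_w$ and all $x\in\mathcal X$, both $\|\Pi(V,w,x)\|_{\mathcal H^m}$ and $\|\Delta(V,w,x)\|_{\mathcal H}$ are at most $c_\Omega(1+r_V+r_w)$ (such a constant exists). Let $n\ge1$, $r\ge1$, $\gamma=\frac{r}{14c_\Omega\sqrt n}$, let $\zeta_0\in\mathcal H^m\times\mathcal H$, let $x_1,x_1',x_2,x_2',\dots$ be sampled uniformly and independently on $\mathcal X$ and, for $k\ge1$, define $$z_k=\mathrm{Prox}^{Z_r}_{\zeta_{k-1}}\big(\gamma\,\Omega(\zeta_{k-1},x_k)\big),\qquad \zeta_k=\mathrm{Prox}^{Z_r}_{\zeta_{k-1}}\big(\gamma\,\Omega(z_k,x_k')\big).$$ Write $z_k=(w_k,V_k)$ and set $\bar w_n=\frac1n\sum_{k=1}^nw_k$, $\bar V_n=\frac1n\sum_{k=1}^nV_k$. Then $$\mathbb E[\mathcal E_r(\bar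 V_n,\bar w_n)]\le110\,c_\Omega\frac{r^3}{\sqrt n}.$$ In particular, if one sets $r_n\propto n^{\alpha}$ for some exponent $\alpha\in(0,1/6)$, then $\lim_{n\to+\infty}\mathbb E[\mathcal E_{r_n}(\bar V_n,\bar w_n)]=0$.
   Context: Setting. $d,m\ge1$ are integers, $\rho>0$, $q\in(1,2]$, $1/q+1/q'=1$; $\mathcal X=[0,1]^d$ is the $d$-dimensional torus (functions on $\mathcal X$ are 1-periodic in each coordinate). $f:\mathcal X\to\mathbb R_+$, $a:\mathcal X\to\mathbb R^d$, $B:\mathcal X\to\mathbb R^{d\times m}$, $R(u)=\|u\|^q/q$, $R^*(v)=\|v\|^{q'}/q'$, with $\|\cdot\|$ the Euclidean norm. $V^*(x)=\inf_{u}\rho\int_0^\infty e^{-\rho t}(f(x_t)+R(u_t))\,\mathrm dt$ subject to $\dot x_t=a(x_t)+B(x_t)u_t$, $x_0=x$, over controllers $u:\mathbb R_+\to\mathbb R^m$. $\mu_0$ is a probability measure on $\mathcal X$ with full support and bounded density with respect to Lebesgue measure, also denoted $\mu_0$. $u^*(x)=\nabla R^*(-\rho^{-1}B(x)^\top\nabla V^*(x))$ for a.e. $x$ is the optimal controller. The optimal occupation measure is $\mu^*(A)=\int_{\mathcal X}\rho\int_0^\infty e^{-\rho t}\mathbf 1_A(x(t\mid x_0))\,\mathrm dt\,\mathrm d\mu_0(x_0)$ for Borel $A$, where $x(\cdot\mid x_0)$ is the trajectory of $\dot x=a(x)+B(x)u^*(x)$ with $x(0)=x_0$. RKHS. $\mathcal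 H\subset L^2(\mathcal X)$ is a reproducing kernel Hilbert space of functions on the torus, dense in $L^2(\mathcal X)$, with Mercer kernel $K\in C^2(\mathcal X\times\mathcal X)$; $\|w\|_{\mathcal H^m}^2=\sum_{i=1}^m\|w_i\|^2_{\mathcal H}$. Objective. For $(\alpha,\beta)\in\mathbb R^m\times\mathbb R$, $S_M(\alpha,\beta)=\inf_{\mu\in[0,M]}\{\beta\mu+R(\alpha/\mu)\mu\}$ (at $\mu=0$ the term $R(\alpha/\mu)\mu$ is $0$ if $\alpha=0$ and $+\infty$ otherwise). For $V\in\mathcal H$, $w\in\mathcal H^m$, $x\in\mathcal X$, $$\Psi(V,w,x)=V(x)\mu_0(x)+\tfrac1\rho\nabla V(x)^\top B(x)w(x)+S_M\Big(w(x),\,f(x)-V(x)+\tfrac1\rho\nabla V(x)^\top a(x)\Big).$$ $\Psi$ is convex in $w$ and concave in $V$. $\Pi(V,w,x)=\frac{\partial\Psi}{\partial w}(V,w,x)\in\mathcal H^m$ and $\Delta(V,w,x)=-\frac{\partial\Psi}{\partial V}(V,w,x)\in\mathcal H$ (sub-/supergradients if $w(x)=0$), computed by the chain rule from the partial derivatives of $S_M$: for $\alpha\ne0$, $\nabla_\alpha S_M(\alpha,\beta)=\|\alpha\|^{q-2}\alpha\,\mu^*(\alpha,\beta)^{1-q}$ and $\partial_\beta S_M(\alpha,\beta)=\mu^*(\alpha,\beta)$, with $\mu^*(\alpha,\beta)=M$ if $\beta\le0$ and $\mu^*(\alpha,\beta)=\min\{(\frac{q-1}q)^{1/q}\beta^{-1/q}\|\alpha\|,M\}$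 if $\beta>0$; for $\alpha=0$, the selection made, for every $\beta$, is the subgradient $0\in\partial_\alpha S_M(\alpha,\beta)$ and the supergradient $M\in\partial_\beta^+S_M(\alpha,\beta)$. Algorithm (stochastic mirror-prox). $Z=\mathcal H^m\times\mathcal H$ with the natural product inner product, $z=(w,V)\in Z$, $\Omega(z,x)=(\Pi(V,w,x),\Delta(V,w,x))$, $Z_r=\{(w,V)\in Z:\|w\|_{\mathcal H^m}\le r,\ \|V\|_{\mathcal H}\le r\}$, and $\mathrm{Prox}^{Z_r}_{z_0}(z)=\arg\min_{\zeta\in Z_r}\{\frac12\|\zeta\|^2+\langle z-z_0,\zeta\rangle\}$, i.e. the componentwise projection of $z_0-z$ onto the balls of radius $r$ centered at the origin of $\mathcal H^m$ and $\mathcal H$. Duality gap. $\overline\Psi_r(w)=\max_{\|V\|_{\mathcal H}\le r}\mathbb E_{x\sim\mathcal U(\mathcal X)}[\Psi(V,w,x)]$, $\underline\Psi_r(V)=\min_{\|w\|_{\mathcal H^m}\le r}\mathbb E_{x\sim\mathcal U(\mathcal X)}[\Psi(V,w,x)]$ and $\mathcal E_r(V,w)=\overline\Psi_r(w)-\underline\Psi_r(V)$, where $\mathcal U(\mathcal X)$ is the uniform distribution on $\mathcal X$.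
   Formalization: At α=0 the selected element of ∂_β⁺S_M(0,β) is M only for β≤0; for β>0 it is 0, the only supergradient, since S_M(0,β)=min(0,βM). With M for every β the bound fails (e.g. a=B=f=0, μ_0=1, M=2, ζ_0=0). *)

(* Defs.v *)
(* Points of R^n are row vectors.  The torus [0,1]^d is the
   quotient R^d / Z^d: a function on it is a function on R^d that is 1-periodic
   in each coordinate, and a set is handled through its 1-periodic indicator. *)
From HB Require Import structures.
From mathcomp Require Import all_boot all_order all_algebra.
From mathcomp Require Import all_classical all_reals all_analysis.

Set Implicit Arguments.
Unset Strict Implicit.
Unset Printing Implicit Defensive.
Import Order.TTheory GRing.Theory Num.Theory.
Import numFieldNormedType.Exports.
Local Open Scope classical_set_scope.
Local Open Scope ring_scope.

Section euclidean.
Context {R : realType}.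

Definition dotv n (u v : 'rV[R]_n) : R := \sum_(i < n) u 0 i * v 0 i.

(* [`|u|] is the sup norm in the library. *)
Definition enorm n (u : 'rV[R]_n) : R := Num.sqrt (dotv u u).

Definition partial n (i : 'I_n) (g : 'rV[R]_n -> R) : 'rV[R]_n -> R :=
  'D_(delta_mx 0 i) g.

Definition grad n (g : 'rV[R]_n -> R) (x : 'rV[R]_n) : 'rV[R]_n :=
  \row_i partial i g x.

Definition C2 n (g : 'rV[R]_n -> R) : Prop :=
  [/\ continuous g,
      forall i x, derivable g x (delta_mx 0 i),
      forall i, continuous (partial i g),
      forall i j x, derivable (partial i g) x (delta_mx 0 j) &
      forall i j, continuous (partial j (partial i g))].

End euclidean.

Section torus.
Context {R : realType}.

Definition torus_fun d (T : Type) (g : 'rV[R]_d -> T) : Prop :=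
  forall x i, g (x + delta_mx 0 i) = g x.

Definition cons_pair n (p : measurableTypeR R * n.-tuple R) : n.+1.-tuple R :=
  [the n.+1.-tuple R of (p.1 : R) :: p.2].

Lemma measurable_cons_pair n :
  measurable_fun [set: measurableTypeR R * n.-tuple R] (@cons_pair n).
Proof.
apply: (@measurable_cons _ _ _ R (fun p : measurableTypeR R * n.-tuple R =>
  p.1 : R) n snd); last exact: measurable_snd.
exact: (@measurable_fst _ _ (measurableTypeR R) (n.-tuple R)).
Qed.

HB.instance Definition _ n :=
  isMeasurableFun.Build _ _ _ _ (@cons_pair n) (@measurable_cons_pair n).

(* The uniform distribution on [0,1]^d, which is also the Lebesgue measure of
   the torus.  It lives on d-tuples, which carry the Borel (product)
   sigma-algebra in the library, whereas row vectors carry the topology. *)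
Fixpoint unif_cube (d : nat) : probability (d.-tuple R) R :=
  match d return probability (d.-tuple R) R with
  | 0 => dirac [tuple]
  | n.+1 => distribution (uniform_prob (@ltr01 R) \x unif_cube n)%E (@cons_pair n)
  end.

Definition pt {d} (s : d.-tuple R) : 'rV[R]_d := \row_i tnth s i.

Definition torus_borel d (A : set 'rV[R]_d) : Prop :=
  torus_fun A /\ measurable (pt @^-1` A).

(* Open subsets of the torus are the 1-periodic open subsets of R^d. *)
Definition full_support_bounded_density d (mu0 : 'rV[R]_d -> R) : Prop :=
  [/\ torus_fun mu0,
      measurable_fun [set: d.-tuple R] (mu0 \o pt),
      (forall x, 0 <= mu0 x) /\ (exists C, forall x, mu0 x <= C),
      (\int[unif_cube d]_s (mu0 (pt s))%:E = 1)%E &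
      forall O : set 'rV[R]_d, torus_fun O -> open O -> O !=set0 ->
        (0 < \int[unif_cube d]_(s in pt @^-1` O) (mu0 (pt s))%:E)%E].

Definition in_range_Linfty d m (a : 'rV[R]_d -> 'rV[R]_d)
    (B : 'rV[R]_d -> 'M[R]_(d, m)) : Prop :=
  exists alpha : 'rV[R]_d -> 'rV[R]_m,
    [/\ torus_fun alpha,
        forall j, measurable_fun [set: d.-tuple R] (fun s => alpha (pt s) 0 j),
        exists C : R, {ae unif_cube d, forall s, enorm (alpha (pt s)) <= C} &
        forall x, a x = alpha x *m (B x)^T].

End torus.

Record control_problem (R : realType) (d m : nat) := ControlProblem {
  cp_rho : R;
  cp_q : R;
  cp_q' : R;
  cp_f : 'rV[R]_d -> R;
  cp_a : 'rV[R]_d -> 'rV[R]_d;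
  cp_B : 'rV[R]_d -> 'M[R]_(d, m);
  cp_mu0 : 'rV[R]_d -> R }.

Section control.
Context {R : realType} {d m : nat} (cp : control_problem R d m).
Local Notation rho := (cp_rho cp).
Local Notation q := (cp_q cp).
Local Notation q' := (cp_q' cp).
Local Notation f := (cp_f cp).
Local Notation a := (cp_a cp).
Local Notation B := (cp_B cp).
Local Notation mu0 := (cp_mu0 cp).
Local Notation leb := (@lebesgue_measure R).

Definition Rcost (u : 'rV[R]_m) : R := enorm u `^ q / q.
Definition Rstar (v : 'rV[R]_m) : R := enorm v `^ q' / q'.

(* x_t = x0 + int_0^t (a(x_s) + B(x_s) u_s) ds (Caratheodory solution),
   lifted to R^d. *)
Definition trajectory (u : R -> 'rV[R]_m) (x0 : 'rV[R]_d) (x : R -> 'rV[R]_d) :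
    Prop :=
  let v s := a (x s) + u s *m (B (x s))^T in
  (forall j, measurable_fun (`[0, +oo[ : set R) (fun s => u s 0 j)) /\
  forall t i, 0 <= t ->
    leb.-integrable `[0, t] (fun s => (v s 0 i)%:E) /\
    x t 0 i = x0 0 i + \int[leb]_(s in `[0, t]) v s 0 i.

Definition cost (u : R -> 'rV[R]_m) (x : R -> 'rV[R]_d) : \bar R :=
  (rho%:E * \int[leb]_(t in `[0%R, +oo[)
     (expR (- rho * t) * (f (x t) + Rcost (u t)))%:E)%E.

(* The infimum is finite when f is bounded: take u = 0. *)
Definition Vstar (x0 : 'rV[R]_d) : R :=
  fine (ereal_inf [set c | exists u x, trajectory u x0 x /\ c = cost u x]).

(* Row convention: grad V *m B is the transpose of B^T grad V. *)
Definition feedback (ustar : 'rV[R]_d -> 'rV[R]_m) : Prop :=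
  torus_fun ustar /\
  {ae unif_cube d, forall s : d.-tuple R, differentiable Vstar (pt s) /\
     ustar (pt s) = grad Rstar (- rho^-1 *: (grad Vstar (pt s) *m B (pt s)))}.

(* ustar is only prescribed almost everywhere, so the optimality of the
   closed loop is part of the definition. *)
Definition optimal_flow (ustar : 'rV[R]_d -> 'rV[R]_m)
    (X : 'rV[R]_d -> R -> 'rV[R]_d) : Prop :=
  {ae unif_cube d, forall s : d.-tuple R, let x := X (pt s) in
     trajectory (ustar \o x) (pt s) x /\
     cost (ustar \o x) x = (Vstar (pt s))%:E}.

Definition occupation (X : 'rV[R]_d -> R -> 'rV[R]_d) (A : set 'rV[R]_d) :
    \bar R :=
  (\int[unif_cube d]_s
     ((rho%:E * \int[leb]_(t in `[0%R, +oo[)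
         (expR (- rho * t) * \1_A (X (pt s) t))%:E) * (mu0 (pt s))%:E))%E.

(* nu is absolutely continuous with respect to the Lebesgue measure of the
   torus, with a density bounded by M. *)
Definition density_le (nu : set 'rV[R]_d -> \bar R) (M : R) : Prop :=
  exists p : 'rV[R]_d -> R,
    [/\ torus_fun p,
        measurable_fun [set: d.-tuple R] (p \o pt),
        forall x, 0 <= p x <= M &
        forall A, torus_borel A ->
          nu A = (\int[unif_cube d]_(s in pt @^-1` A) (p (pt s))%:E)%E].

Definition optimal_occupation_bounded (M : R) : Prop :=
  exists ustar X,
    [/\ feedback ustar, optimal_flow ustar X & density_le (occupation X) M].

End control.

(* A Hilbert space of functions on the torus with a reproducing kernel; rk_sec x
   is the element K_x of the space. *)
Record rkhs (R : realType) (d : nat) := Rkhs {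
  rk_space :> completeNormedModType R;
  rk_dot : {dot rk_space for (idfun : R -> R)};
  rk_norm : forall V : rk_space, rk_dot V V = `|V| ^+ 2;
  rk_ev : rk_space -> 'rV[R]_d -> R;
  rk_ev_inj : injective rk_ev;
  rk_ev_torus : forall V, torus_fun (rk_ev V);
  rk_sec : 'rV[R]_d -> rk_space;
  rk_reproducing : forall V x, rk_dot V (rk_sec x) = rk_ev V x }.

Section rkhs_theory.
Context {R : realType} {d : nat} (H : rkhs R d).

Definition rk_kernel (x y : 'rV[R]_d) : R := rk_ev (rk_sec H x) y.

Definition kernel_C2 : Prop :=
  C2 (fun z : 'rV[R]_(d + d) => rk_kernel (lsubmx z) (rsubmx z)).

Definition sub_L2 : Prop := forall V : H,
  measurable_fun [set: d.-tuple R] (fun s => rk_ev V (pt s)) /\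
  (\int[unif_cube d]_s (rk_ev V (pt s) ^+ 2)%:E < +oo)%E.

Definition dense_L2 : Prop := forall g : d.-tuple R -> R,
  measurable_fun [set: d.-tuple R] g ->
  (\int[unif_cube d]_s (g s ^+ 2)%:E < +oo)%E ->
  forall e : R, 0 < e ->
  exists V : H, (\int[unif_cube d]_s ((g s - rk_ev V (pt s)) ^+ 2)%:E < e%:E)%E.

Definition hm_dot m (w w' : {ffun 'I_m -> H}) : R :=
  \sum_(i < m) rk_dot H (w i) (w' i).

Definition hm_norm m (w : {ffun 'I_m -> H}) : R := Num.sqrt (hm_dot w w).

Definition hm_ev m (w : {ffun 'I_m -> H}) (x : 'rV[R]_d) : 'rV[R]_m :=
  \row_i rk_ev (w i) x.

Definition z_dot m (z z' : {ffun 'I_m -> H} * H) : R :=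
  hm_dot z.1 z'.1 + rk_dot H z.2 z'.2.

End rkhs_theory.

(* The element of E that represents the linear form l for the inner product
   dot, i.e. the gradient of a function whose differential is l. *)
Definition riesz (R : realType) (E : lmodType R) (dot : E -> E -> R)
    (l : E -> R) : E :=
  xget 0 [set g | forall h, dot g h = l h].

Section saddle.
Context {R : realType} {d m : nat} (cp : control_problem R d m) (H : rkhs R d).
Variable M : R.
Local Notation rho := (cp_rho cp).
Local Notation q := (cp_q cp).
Local Notation f := (cp_f cp).
Local Notation a := (cp_a cp).
Local Notation B := (cp_B cp).
Local Notation mu0 := (cp_mu0 cp).
Local Notation Hm := {ffun 'I_m -> H}.
Local Notation Z := (Hm * H)%type.

(* mu * R(alpha / mu) *)
Definition persp (alpha : 'rV[R]_m) (mu : R) : \bar R :=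
  if mu == 0 then (if alpha == 0 then 0%E else +oo%E)
  else (Rcost cp (mu^-1 *: alpha) * mu)%:E.

Definition S_M (alpha : 'rV[R]_m) (beta : R) : \bar R :=
  ereal_inf [set ((beta * mu)%:E + persp alpha mu)%E | mu in `[0, M]].

Definition mu_opt (alpha : 'rV[R]_m) (beta : R) : R :=
  if beta <= 0 then M
  else Num.min (((q - 1) / q) `^ q^-1 * beta `^ (- q^-1) * enorm alpha) M.

Definition dS_alpha (alpha : 'rV[R]_m) (beta : R) : 'rV[R]_m :=
  if alpha == 0 then 0
  else (enorm alpha `^ (q - 2) * mu_opt alpha beta `^ (1 - q)) *: alpha.

(* S_M(0,beta) = min(0, beta M).  At alpha = 0 the selected supergradient in
   beta is M wherever M is one, i.e. for beta <= 0; for beta > 0 the only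
   supergradient is 0. *)
Definition dS_beta (alpha : 'rV[R]_m) (beta : R) : R :=
  if alpha == 0 then (if beta <= 0 then M else 0) else mu_opt alpha beta.

Definition beta_of (V : H) (x : 'rV[R]_d) : R :=
  f x - rk_ev V x + rho^-1 * dotv (grad (rk_ev V) x) (a x).

Definition Psi (V : H) (w : Hm) (x : 'rV[R]_d) : \bar R :=
  ((rk_ev V x * mu0 x
     + rho^-1 * dotv (grad (rk_ev V) x *m B x) (hm_ev w x))%:E
   + S_M (hm_ev w x) (beta_of V x))%E.

(* Pi is the (sub)gradient of Psi(V, ., x) at w and Delta the opposite of the
   (super)gradient of Psi(., w, x) at V; phi is the direction of
   differentiation in the chain rule. *)
Definition Pi (V : H) (w : Hm) (x : 'rV[R]_d) : Hm :=
  riesz (@hm_dot R d H m) (fun phi : Hm =>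
    rho^-1 * dotv (grad (rk_ev V) x *m B x) (hm_ev phi x)
    + dotv (dS_alpha (hm_ev w x) (beta_of V x)) (hm_ev phi x)).

Definition Delta (V : H) (w : Hm) (x : 'rV[R]_d) : H :=
  riesz (rk_dot H) (fun phi : H =>
    - (rk_ev phi x * mu0 x
       + rho^-1 * dotv (grad (rk_ev phi) x *m B x) (hm_ev w x)
       + dS_beta (hm_ev w x) (beta_of V x)
         * (- rk_ev phi x + rho^-1 * dotv (grad (rk_ev phi) x) (a x)))).

Definition Omega (z : Z) (x : 'rV[R]_d) : Z := (Pi z.2 z.1 x, Delta z.2 z.1 x).

Definition bounds_Omega (c : R) : Prop :=
  forall (rV rw : R) (V : H) (w : Hm) (x : 'rV[R]_d),
    0 <= rV -> 0 <= rw -> `|V| <= rV -> hm_norm w <= rw ->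
    hm_norm (Pi V w x) <= c * (1 + rV + rw) /\
    `|Delta V w x| <= c * (1 + rV + rw).

Definition Zball (r : R) : set Z := [set z | hm_norm z.1 <= r /\ `|z.2| <= r].

Definition prox_obj (z0 z zeta : Z) : R :=
  z_dot zeta zeta / 2 + z_dot (z - z0) zeta.

Definition Prox (r : R) (z0 z : Z) : Z :=
  xget 0 [set zeta | Zball r zeta /\
    forall zeta', Zball r zeta' -> prox_obj z0 z zeta <= prox_obj z0 z zeta'].

Section iterates.
Variables (gamma r : R) (zeta0 : Z) (x x' : nat -> 'rV[R]_d).

Definition extrapolate (zeta : Z) (k : nat) : Z :=
  Prox r zeta (gamma *: Omega zeta (x k)).

(* The samples are indexed from 0: the k-th iteration, k >= 1, uses x k.-1 and
   x' k.-1. *)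
Fixpoint zeta_iter (k : nat) : Z :=
  if k is j.+1 then
    Prox r (zeta_iter j) (gamma *: Omega (extrapolate (zeta_iter j) j) (x' j))
  else zeta0.

(* z_{k+1} *)
Definition z_iter (k : nat) : Z := extrapolate (zeta_iter k) k.

Definition z_mean (n : nat) : Z := n%:R^-1 *: \sum_(k < n) z_iter k.

End iterates.

Definition mean_Psi (V : H) (w : Hm) : \bar R :=
  (\int[unif_cube d]_s Psi V w (pt s))%E.

Definition Psi_upper (r : R) (w : Hm) : \bar R :=
  ereal_sup [set mean_Psi V w | V in [set V : H | `|V| <= r]].

Definition Psi_lower (r : R) (V : H) : \bar R :=
  ereal_inf [set mean_Psi V w | w in [set w : Hm | hm_norm w <= r]].

Definition duality_gap (r : R) (V : H) (w : Hm) : \bar R :=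
  (Psi_upper r w - Psi_lower r V)%E.

(* E_r(V_n, w_n) after n iterations with step r / (14 c sqrt n). *)
Definition mirror_prox_gap (c : R) (zeta0 : Z) (x x' : nat -> 'rV[R]_d)
    (n : nat) (r : R) : \bar R :=
  let z := z_mean (r / (14 * c * Num.sqrt n%:R)) r zeta0 x x' n in
  duality_gap r z.2 z.1.

End saddle.

Section independence.
Context {R : realType} d d' {T : measurableType d} {E : measurableType d'}
  (P : probability T R).

Definition mutually_independent (I : eqType) (X : I -> {RV P >-> E}) : Prop :=
  forall (s : seq I) (A : I -> set E), uniq s -> (forall i, measurable (A i)) ->
    P (\bigcap_(i in [set` s]) (X i @^-1` A i))
    = (\prod_(i <- s) P (X i @^-1` A i))%E.

End independence.

(* Main.v *)
Require Import Defs.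
From HB Require Import structures.
From mathcomp Require Import all_boot all_order all_algebra.
From mathcomp Require Import all_classical all_reals all_analysis.
From mathcomp Require Import measurable_realfun ring lra zify.
Import Order.TTheory GRing.Theory Num.Theory.
Import numFieldNormedType.Exports.
Local Open Scope classical_set_scope.
Local Open Scope ring_scope.

Set Implicit Arguments.
Unset Strict Implicit.
Unset Printing Implicit Defensive.

(** The proof runs the usual analysis of stochastic mirror-prox for an oracle that
   is bounded, but not Lipschitz continuous, on the balls of radius r.

   The oracle.  Since the kernel is of class C^2, difference quotients of kernel
   sections converge in the Hilbert space ([sec_quot_cvg]), hence partial
   derivatives at a point are represented by elements depending continuously and
   periodically on the point ([dsec], [partial_rk_ev]), and the two subgradients
   have closed forms ([PiE], [DeltaE]).  Young's inequality gives the minimiser of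
   the problem defining S_M and the inequalities satisfied by its partial
   derivatives ([S_ME], [S_val_convex], [S_val_concave]); the derivatives grow at
   most linearly because q <= 2 ([enorm_dS_alpha_le]).  This proves that a constant
   c exists ([bounds_Omega_exist]) and that, at every x, the gap of the mean of the
   iterates is at most the mean of the inner products of the oracle with z_k - u
   ([Psi_gap_mean]).

   Regret.  On the ball the oracle has squared norm at most 18 c^2 r^2.  The point
   zeta_0 is arbitrary, but z_1 and zeta_1 are already in the ball: the first
   iteration is bounded by 12 c r^2 and the telescoping argument is used for the
   other ones ([extragradient_regret]).  The increments at zeta_{k-1} and z_k are
   not compared with each other, their size is simply paid for.

   Noise.  Let F be the expectation of the oracle over the torus, and N_k the
   difference between F(z_k) and the oracle sampled at z_k.  The gap involves a
   supremum over u of sums of <N_k, z_k - u>, where u may depend on the samples.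
   For S_k the sum of the N_j with j < k, Young's inequality bounds - <S_n, u> by
   the squared norms of u and S_n, and the squared norm of S_n is at most the sum
   of the |N_k|^2 and of the 2 <S_k, N_k> ([noise_le]).  The gap is thus bounded,
   for every realisation of the samples, by a constant plus a sum of terms
   <N_k, y_k> where y_k depends on the samples drawn before x'_k
   ([mirror_prox_gap_le]).  Each of these terms is the difference between the
   expectation over x'_k given the past and the sampled value, so that its mean
   vanishes ([mean_history], [expected_gap_le]).  With the prescribed step the
   constant is 82 c r^3 / sqrt n.

   Measurability.  The samples enter the iterates through kernel sections, their
   derivatives, and Borel functions of inner products.  All these operations
   preserve the class of pointwise limits of countably valued measurable maps
   ([strongly_measurable]), in which inner products are measurable.  The gap itself
   is only dominated by a bounded measurable function ([integral_le_mean]). *)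

(** * Inner products on real vector spaces *)

Definition inner_form {R : realType} {E : lmodType R} (b : E -> E -> R) : Prop :=
  [/\ forall u v, b u v = b v u,
      forall a u v w, b (a *: u + v) w = a * b u w + b v w &
      forall u, u != 0 -> 0 < b u u].

Section inner_form.
Context {R : realType} {E : lmodType R} (b : E -> E -> R).
Hypothesis bP : inner_form b.
Implicit Types u v w : E.

Definition inorm u : R := Num.sqrt (b u u).

Lemma innerC u v : b u v = b v u. Proof. by have [] := bP. Qed.

Lemma inner0l v : b 0 v = 0.
Proof.
have [_ bl _] := bP; have := bl 1 0 0 v.
by rewrite scaler0 addr0; lra.
Qed.

Lemma innerDl u v w : b (u + v) w = b u w + b v w.
Proof. by have [_ bl _] := bP; rewrite -[u]scale1r bl mul1r scale1r. Qed.

Lemma innerZl a u w : b (a *: u) w = a * b u w.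
Proof. by have [_ bl _] := bP; rewrite -[a *: u]addr0 bl inner0l addr0. Qed.

Lemma innerNl u w : b (- u) w = - b u w.
Proof. by rewrite -scaleN1r innerZl mulN1r. Qed.

Lemma innerBl u v w : b (u - v) w = b u w - b v w.
Proof. by rewrite innerDl innerNl. Qed.

Lemma inner0r v : b v 0 = 0. Proof. by rewrite innerC inner0l. Qed.

Lemma innerDr u v w : b u (v + w) = b u v + b u w.
Proof. by rewrite innerC innerDl !(innerC u). Qed.

Lemma innerZr a u w : b u (a *: w) = a * b u w.
Proof. by rewrite innerC innerZl (innerC u). Qed.

Lemma innerNr u w : b u (- w) = - b u w.
Proof. by rewrite innerC innerNl (innerC u). Qed.

Lemma innerBr u v w : b u (v - w) = b u v - b u w.
Proof. by rewrite innerDr innerNr. Qed.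

Lemma inner_suml I (s : seq I) (F : I -> E) w :
  b (\sum_(i <- s) F i) w = \sum_(i <- s) b (F i) w.
Proof.
elim: s => [|i s IH]; first by rewrite !big_nil inner0l.
by rewrite !big_cons innerDl IH.
Qed.

Lemma inner_ge0 u : 0 <= b u u.
Proof.
by have [_ _ bp] := bP; have [->|/bp/ltW//] := eqVneq u 0; rewrite inner0l.
Qed.

Lemma inner_eq0 u : b u u <= 0 -> u = 0.
Proof.
have [_ _ bp] := bP => bu; apply/eqP; apply: contraTT bu => /bp.
by rewrite -ltNge.
Qed.

Lemma inner_sqrB u v : b (u - v) (u - v) = b u u - 2 * b u v + b v v.
Proof. by rewrite !innerBl !innerBr (innerC v u); ring. Qed.

Lemma inner_sqrD u v : b (u + v) (u + v) = b u u + 2 * b u v + b v v.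
Proof. by rewrite !innerDl !innerDr (innerC v u); ring. Qed.

(** Expand the square of [s *: u - v]. *)
Lemma inner_young s u v : 0 < s -> b u v <= s / 2 * b u u + (2 * s)^-1 * b v v.
Proof.
move=> s0; have := inner_ge0 (s *: u - v).
rewrite inner_sqrB !innerZl !innerZr => h.
have -> : s / 2 * b u u + (2 * s)^-1 * b v v =
  (2 * s)^-1 * (s * (s * b u u) - 2 * (s * b u v) + b v v) + b u v.
  by field; rewrite gt_eqF.
by rewrite lerDr mulr_ge0// invr_ge0; lra.
Qed.

Lemma inorm_ge0 u : 0 <= inorm u. Proof. exact: sqrtr_ge0. Qed.

Lemma inorm_sqr u : inorm u ^+ 2 = b u u.
Proof. by rewrite sqr_sqrtr// inner_ge0. Qed.

Lemma inorm_eq0 u : inorm u = 0 -> u = 0.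
Proof. by move=> u0; apply: inner_eq0; rewrite -inorm_sqr u0 expr0n. Qed.

Lemma inorm0 : inorm 0 = 0. Proof. by rewrite /inorm inner0l sqrtr0. Qed.

Lemma inormZ a u : inorm (a *: u) = `|a| * inorm u.
Proof.
by rewrite /inorm innerZl innerZr mulrA -expr2 sqrtrM ?sqr_ge0// sqrtr_sqr.
Qed.

Lemma inorm_le r u : 0 <= r -> (inorm u <= r) = (b u u <= r ^+ 2).
Proof. by move=> r0; rewrite -inorm_sqr ler_sqr// nnegrE inorm_ge0. Qed.

Lemma inner_le_inorm u v : b u v <= inorm u * inorm v.
Proof.
have [/inorm_eq0 ->|u0] := eqVneq (inorm u) 0.
  by rewrite inner0l inorm0 mul0r.
have [/inorm_eq0 ->|v0] := eqVneq (inorm v) 0.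
  by rewrite inner0r inorm0 mulr0.
have up : 0 < inorm u by rewrite lt_neqAle eq_sym u0 inorm_ge0.
have vp : 0 < inorm v by rewrite lt_neqAle eq_sym v0 inorm_ge0.
have s0 : 0 < inorm v / inorm u by rewrite divr_gt0.
apply: (le_trans (inner_young u v s0)).
rewrite -!inorm_sqr le_eqVlt; apply/orP; left; apply/eqP.
by field; rewrite u0 v0.
Qed.

Lemma normr_inner_le u v : `|b u v| <= inorm u * inorm v.
Proof.
rewrite ler_norml inner_le_inorm andbT -lerNl -innerNr.
have -> : inorm v = inorm (- v) by rewrite -scaleN1r inormZ normrN1 mul1r.
exact: inner_le_inorm.
Qed.

Lemma inormD u v : inorm (u + v) <= inorm u + inorm v.
Proof.
rewrite inorm_le ?addr_ge0 ?inorm_ge0// inner_sqrD sqrrD !inorm_sqr.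
by have := inner_le_inorm u v; lra.
Qed.

Lemma inormN u : inorm (- u) = inorm u.
Proof. by rewrite -scaleN1r inormZ normrN1 mul1r. Qed.

Lemma inorm_sum I (s : seq I) (F : I -> E) :
  inorm (\sum_(i <- s) F i) <= \sum_(i <- s) inorm (F i).
Proof.
elim: s => [|i s IH]; first by rewrite !big_nil inorm0.
by rewrite !big_cons; apply: (le_trans (inormD _ _)); rewrite lerD2l.
Qed.

Lemma inner_extr u v : (forall h, b u h = b v h) -> u = v.
Proof.
move=> uv; apply/eqP; rewrite -subr_eq0; apply/eqP/inner_eq0.
by rewrite innerBl uv subrr.
Qed.

Lemma riesz_eq (l : E -> R) u : (forall h, b u h = l h) -> riesz b l = u.
Proof.
move=> ul; rewrite /riesz; case: xgetP => [g _ gl|/(_ u)]; last by case.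
by apply: inner_extr => h; rewrite gl ul.
Qed.

(** The projection on the ball of radius [r]; the test avoids the division by the
   norm at the origin. *)
Definition ball_proj (r : R) u := (if inorm u <= r then 1 else r / inorm u) *: u.

Lemma ball_proj_in r u : 0 <= r -> inorm (ball_proj r u) <= r.
Proof.
move=> r0; rewrite /ball_proj; case: ifPn => [|]; first by rewrite scale1r.
rewrite -ltNge => ru; have u0 : 0 < inorm u by exact: le_lt_trans ru.
by rewrite inormZ ger0_norm ?divr_ge0 ?inorm_ge0// divfK// gt_eqF.
Qed.

Lemma ball_projP r u v : 0 <= r -> inorm v <= r ->
  b (u - ball_proj r u) (v - ball_proj r u) <= 0.
Proof.
move=> r0 vr; rewrite /ball_proj; case: ifPn => [|].
  by rewrite scale1r subrr inner0l.
rewrite -ltNge => ru; have u0 : 0 < inorm u by exact: le_lt_trans ru.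
set k := r / _; have k1 : k <= 1 by rewrite ler_pdivrMr// mul1r ltW.
have -> : u - k *: u = (1 - k) *: u by rewrite scalerBl scale1r.
rewrite innerZl innerBr innerZr -inorm_sqr.
have -> : k * inorm u ^+ 2 = inorm u * r.
  by rewrite /k; field; rewrite gt_eqF.
rewrite mulr_ge0_le0 ?subr_ge0// subr_le0.
by apply: (le_trans (inner_le_inorm _ _)); rewrite ler_wpM2l// ltW.
Qed.

End inner_form.

Section proximal_step.
Context {R : realType} {E : lmodType R} (b : E -> E -> R).
Hypothesis bP : inner_form b.
Implicit Types u v w y p : E.

(** The hypothesis is the characterisation of the projection [p] of [y] on a convex
   set containing [u]: the angle at [p] is obtuse. *)
Lemma proj_nonexpansive y p u : b (y - p) (u - p) <= 0 ->
  b (p - u) (p - u) <= b (y - u) (y - u).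
Proof.
move=> h; have -> : y - u = (y - p) + (p - u) by rewrite addrA subrK.
have e : b (y - p) (p - u) = - b (y - p) (u - p).
  by rewrite -(innerNr bP) opprB.
rewrite [leRHS](inner_sqrD bP) e.
by have := inner_ge0 bP (y - p); lra.
Qed.

Lemma prox_step z g p u : b (z - g - p) (u - p) <= 0 ->
  b (p - u) (p - u) <= b (z - u) (z - u) - 2 * b g (z - u) + b g g.
Proof.
move=> /proj_nonexpansive h; apply: (le_trans h).
have -> : z - g - u = (z - u) - g by rewrite addrAC.
by rewrite (inner_sqrB bP) (innerC bP g).
Qed.

(** One extragradient step with increments [h] then [g].  The gain in distance
   to [u] is compared with the increment at the intermediate point [z]; the
   price is the size of the increments, since [h] and [g] are not assumed to be
   close to each other. *)
Lemma extragradient_step y z p h g u :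
  b (y - h - z) (y - z) <= 0 -> b (y - g - p) (u - p) <= 0 ->
  2 * b g (z - u) <= b (y - u) (y - u) - b (p - u) (p - u) + (2 * b g g + b h h).
Proof.
move=> /prox_step; rewrite subrr !(inner0r bP) mulr0 subr0 add0r => zy.
move=> /prox_step pu.
have := inner_young bP g (z - y) (ltr01 : 0 < 1 :> R); rewrite mulr1 mul1r.
have -> : z - u = (z - y) + (y - u) by rewrite addrA subrK.
rewrite (innerDr bP g (z - y) (y - u)); lra.
Qed.

(** Completing the square, the objective is half the squared distance to [y], up
   to a constant. *)
Lemma prox_unique (C : E -> Prop) y p p' :
  C p -> (forall u, C u -> b (y - p) (u - p) <= 0) ->
  C p' -> b p' p' / 2 - b y p' <= b p p / 2 - b y p ->
  p' = p.
Proof.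
move=> Cp vi Cp' le_p; apply/eqP; rewrite -subr_eq0; apply/eqP/(inner_eq0 bP).
rewrite (inner_sqrB bP) (innerC bP p' p).
by have := vi _ Cp'; rewrite (innerBl bP) !(innerBr bP); lra.
Qed.

Lemma prox_minimal y p u : b (y - p) (u - p) <= 0 ->
  b p p / 2 - b y p <= b u u / 2 - b y u.
Proof.
rewrite (innerBl bP) !(innerBr bP) => h.
by have := inner_ge0 bP (u - p); rewrite (inner_sqrB bP) (innerC bP u p); lra.
Qed.

End proximal_step.

(** * Hilbert spaces: continuity of the inner product, Riesz representation *)

Section hilbert.
Context {R : realType} {E : completeNormedModType R} (b : E -> E -> R).
Hypotheses (bP : inner_form b) (bn : forall u, b u u = `|u| ^+ 2).
Implicit Types u v w : E.

Lemma inner_normE u : inorm b u = `|u|.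
Proof. by rewrite /inorm bn sqrtr_sqr normr_id. Qed.

(** By polarization. *)
Lemma inner_cvg T (F : set_system T) (f g : T -> E) u v : Filter F ->
  f @ F --> u -> g @ F --> v -> b (f x) (g x) @[x --> F] --> b u v.
Proof.
move=> FF fu gv.
have pol x y : b x y = 4^-1 * (`|x + y| * `|x + y| - `|x - y| * `|x - y|).
  by rewrite -!expr2 -!bn (inner_sqrD bP) (inner_sqrB bP); lra.
under eq_fun do rewrite pol.
rewrite pol; apply: cvgMr => //.
by apply: cvgB; apply: cvgM; apply: cvg_norm;
  (exact: cvgD || exact: cvgB).
Qed.

(** The energy [h |-> |h|^2 / 2 - l h] is bounded below; by the parallelogram
   identity a minimising sequence is Cauchy, and its limit represents [l]. *)
Lemma riesz_representation (l : E -> R) (C : R) :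
  (forall a u v, l (a *: u + v) = a * l u + l v) ->
  (forall u, l u <= C * `|u|) ->
  exists g, forall h, b g h = l h.
Proof.
move=> ll lC; pose J u := b u u / 2 - l u.
have l0 : l 0 = 0 by have := ll 1 0 0; rewrite scaler0 addr0; lra.
have lZ a u : l (a *: u) = a * l u by rewrite -[a *: u]addr0 ll l0 addr0.
have lD u v : l (u + v) = l u + l v by rewrite -[u]scale1r ll mul1r scale1r.
have JC u : - (C ^+ 2 / 2) <= J u.
  have := lC u; rewrite /J bn => h.
  have : 0 <= (`|u| - C) ^+ 2 by exact: sqr_ge0.
  rewrite sqrrB; lra.
have Jinf : has_inf (range J).
  split; first by exists (J 0), 0.
  by exists (- (C ^+ 2 / 2)) => _ [u _ <-].
pose j := inf (range J).
have jJ u : j <= J u by apply: ge_inf; [exact: Jinf.2|exists u].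
have /choice[h hP] n : exists h, J h < j + n.+1%:R^-1.
  have [_ [h _ <-] hj] : exists2 x, range J x & x < j + n.+1%:R^-1.
    by apply: inf_adherent Jinf; rewrite invr_gt0 ltr0n.
  by exists h.
have par u v e : J u < j + e -> J v < j + e -> `|u - v| ^+ 2 <= 8 * e.
  move=> Ju Jv; have := jJ (2^-1 *: (u + v)).
  rewrite /J lZ lD (innerZl bP) (innerZr bP) (inner_sqrD bP) => k.
  by rewrite -bn (inner_sqrB bP); rewrite /J in Ju Jv; lra.
have hc : cvg (h @ \oo).
  suff hcauchy : cauchy_ex (h @ \oo).
    by apply: cauchy_cvg; exact: cauchy_exP.
  move=> e e0.
  have [N _ HN] : \forall n \near \oo, n.+1%:R^-1 < e ^+ 2 / 8 :> R.
    have e8 : 0 < e ^+ 2 / 8 by rewrite divr_gt0// exprn_gt0.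
    exact: (near_infty_natSinv_lt (PosNum e8)).
  exists (h N), N => // n /= Nn; rewrite /= -ball_normE /=.
  have eN := HN N (leqnn N).
  have : `|h N - h n| ^+ 2 <= 8 * (N.+1%:R^-1).
    apply: par => //; apply: (lt_le_trans (hP n)).
    by rewrite lerD2l lef_pV2 ?posrE ?ltr0n// ler_nat.
  move=> k; rewrite -ltr_sqr ?nnegrE//; last exact: ltW.
  by apply: (le_lt_trans k); rewrite -ltr_pdivlMl// mulrC.
pose g := lim (h @ \oo); have hg : h @ \oo --> g by [].
exists g => v.
have c1 : b (h n) v @[n --> \oo] --> b g v by apply: inner_cvg => //; exact: cvg_cst.
suff c2 : b (h n) v @[n --> \oo] --> l v by exact: cvg_unique c1 c2.
pose N := `|v| ^+ 2; have N0 : 0 <= N by exact: sqr_ge0.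
have bnd n : (b (h n) v - l v) ^+ 2 <= 2 * (N + 1) * n.+1%:R^-1.
  set e := b (h n) v - l v; set k := n.+1%:R^-1.
  pose t := - e / (N + 1).
  have := jJ (h n + t *: v); have := hP n; rewrite -/k.
  rewrite /J lD lZ (inner_sqrD bP) (innerZr bP) (innerZl bP) (innerZr bP).
  rewrite (bn v) -/N => h1 h2.
  have : - k <= t * e + t * (t * N) / 2 by rewrite /e; lra.
  have -> : t * e + t * (t * N) / 2 = - (e ^+ 2 * ((N + 2) / (2 * (N + 1) ^+ 2))).
    by rewrite /t; field; rewrite gt_eqF//; lra.
  rewrite lerN2 => h3.
  have h4 : (2 * (N + 1))^-1 <= (N + 2) / (2 * (N + 1) ^+ 2).
    have N1 : 0 < N + 1 by lra.
    rewrite ler_pdivlMr; last by rewrite mulr_gt0 ?exprn_gt0.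
    have -> : (2 * (N + 1))^-1 * (2 * (N + 1) ^+ 2) = N + 1.
      by field; rewrite gt_eqF.
    lra.
  rewrite -ler_pdivrMl; last lra.
  by apply: le_trans h3; rewrite mulrC ler_wpM2l// sqr_ge0.
apply/cvgrPdist_lt => e e0.
have e8 : 0 < (2 * (N + 1))^-1 * e ^+ 2.
  by rewrite mulr_gt0 ?exprn_gt0// invr_gt0; lra.
near=> n; rewrite distrC -ltr_sqr ?nnegrE//; last exact: ltW.
rewrite real_normK ?num_real//; apply: (le_lt_trans (bnd n)).
rewrite -ltr_pdivlMl; last lra.
by near: n; exact: (near_infty_natSinv_lt (PosNum e8)).
Unshelve. all: by end_near. Qed.

End hilbert.

(** * Strong measurability *)

Section strong_measurability.
Context {R : realType}.

(** A function with countably many values, taken on measurable sets; the values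
   are indexed by natural numbers, so that no sigma-algebra is needed on the
   codomain. *)
Definition countable_step d (T : measurableType d) (E : Type) (f : T -> E) :=
  exists (N : T -> nat) (h : nat -> E),
    (forall k, measurable (N @^-1` [set k])) /\ forall t, f t = h (N t).

(** Pointwise limits of such functions.  Unlike weak measurability, this notion
   makes the inner product of two random elements measurable without any
   separability argument. *)
Definition strongly_measurable d (T : measurableType d) (E : topologicalType)
    (f : T -> E) :=
  exists g : nat -> T -> E,
    (forall n, countable_step (g n)) /\ forall t, g n t @[n --> \oo] --> f t.

Lemma countable_stepP d (T : measurableType d) (E : Type) (K : countType)
    (N : T -> K) (h : K -> E) :
  (forall k, measurable (N @^-1` [set k])) -> countable_step (h \o N).
Proof.
move=> mN; have [t0|noT] := pselect (exists t : T, True); last first.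
  exists (fun=> 0%N), (fun=> match noT (ex_intro _ point I) with end).
  by split=> [k|t]; case: (noT); exists point.
have [t _] := t0.
(* [h (N t)] is a default value for the integers that encode nothing. *)
exists (pickle \o N), (fun k => if unpickle k is Some v then h v else h (N t)).
split=> [k|s /=]; last by rewrite pickleK.
case e : (@pickle_inv K k) => [v|].
  have -> : (pickle \o N) @^-1` [set k] = N @^-1` [set v].
    apply/seteqP; split=> s /= => [sk|->].
      by apply: Some_inj; rewrite -e -sk pickleK_inv.
    by have := @pickle_invK K k; rewrite /= /oapp /= e.
  exact: mN.
have -> : (pickle \o N) @^-1` [set k] = set0; last exact: measurable0.
by apply/seteqP; split=> s //= sk; have := @pickleK_inv K (N s); rewrite sk e.
Qed.

Section operations.
Context d (T : measurableType d).

Lemma countable_step_measurable (f : T -> R) :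
  countable_step f -> measurable_fun setT f.
Proof.
move=> [N [h [mN fE]]] _ B mB; rewrite setTI.
have -> : f @^-1` B = \bigcup_(k in [set k | B (h k)]) (N @^-1` [set k]).
  apply/seteqP; split=> t /=; first by rewrite fE => Bt; exists (N t).
  by rewrite fE => -[k /= Bk ->].
by apply: bigcup_measurable => k _; exact: mN.
Qed.

Lemma countable_step2 (E1 E2 E : Type) (g : E1 -> E2 -> E) (f1 : T -> E1)
    (f2 : T -> E2) :
  countable_step f1 -> countable_step f2 ->
  countable_step (fun t => g (f1 t) (f2 t)).
Proof.
move=> [N1 [h1 [mN1 f1E]]] [N2 [h2 [mN2 f2E]]].
have -> : (fun t => g (f1 t) (f2 t)) =
    (fun k : nat * nat => g (h1 k.1) (h2 k.2)) \o (fun t => (N1 t, N2 t)).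
  by apply/funext => t; rewrite /= f1E f2E.
apply: countable_stepP => -[k1 k2].
have -> : (fun t => (N1 t, N2 t)) @^-1` [set (k1, k2)] =
    (N1 @^-1` [set k1]) `&` (N2 @^-1` [set k2]).
  by apply/seteqP; split=> t /= [-> ->].
exact: measurableI.
Qed.

Lemma strongly_measurable_measurable (f : T -> R) :
  strongly_measurable f -> measurable_fun setT f.
Proof.
move=> [g [gs gf]]; apply: (measurable_fun_cvg (h := g)) => // n.
exact: countable_step_measurable.
Qed.

Lemma strongly_measurable_cst (E : topologicalType) (a : E) :
  strongly_measurable (fun _ : T => a).
Proof.
exists (fun _ _ => a); split=> [_|t]; last exact: cvg_cst.
apply: (@countable_stepP _ _ _ unit (fun=> tt) (fun=> a)) => -[].
by rewrite [X in measurable X](_ : _ = setT) ?predeqE.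
Qed.

Lemma strongly_measurable2 (E1 E2 E : topologicalType) (g : E1 -> E2 -> E)
    (f1 : T -> E1) (f2 : T -> E2) :
  (forall u v (u_ : nat -> E1) (v_ : nat -> E2), u_ @ \oo --> u ->
     v_ @ \oo --> v -> g (u_ n) (v_ n) @[n --> \oo] --> g u v) ->
  strongly_measurable f1 -> strongly_measurable f2 ->
  strongly_measurable (fun t => g (f1 t) (f2 t)).
Proof.
move=> gc [g1 [gs1 gf1]] [g2 [gs2 gf2]].
exists (fun n t => g (g1 n t) (g2 n t)); split=> [n|t]; last exact: gc.
exact: countable_step2.
Qed.

(** Round the coordinates of [X] down to multiples of [1/(n+1)]. *)
Lemma strongly_measurable_continuous (E : topologicalType) n
    (e : 'rV[R]_n -> E) (X : T -> 'rV[R]_n) :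
  continuous e -> (forall i, measurable_fun setT (fun t => X t 0 i)) ->
  strongly_measurable (e \o X).
Proof.
move=> ce mX.
pose N k t : 'rV[int]_n := \row_i Num.floor (k.+1%:R * X t 0 i).
pose h k (v : 'rV[int]_n) : 'rV[R]_n := \row_i ((v 0 i)%:~R / k.+1%:R).
exists (fun k => (e \o h k) \o N k); split=> [k|t].
  apply: countable_stepP => v.
  have -> : N k @^-1` [set v] = \bigcap_(i : 'I_n)
      ((fun t => X t 0 i) @^-1` `[(v 0 i)%:~R / k.+1%:R, (v 0 i + 1)%:~R / k.+1%:R[).
    apply/seteqP; split=> s /=.
      move=> Ns i _ /=.
      rewrite in_itv/= -Ns mxE ler_pdivrMr ?ltr0n// ltr_pdivlMr ?ltr0n// mulrC.
      by rewrite floor_le floorD1_gt.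
    move=> Xs; apply/rowP => i; rewrite mxE; apply: floor_def.
    have /= := Xs i I; rewrite in_itv/= ler_pdivrMr ?ltr0n//.
    by rewrite ltr_pdivlMr ?ltr0n// mulrC.
  apply: fin_bigcap_measurable; first exact: finite_finset.
  move=> i _; rewrite -[X in measurable X]setTI; exact: mX.
apply: (continuous_cvg _ (ce (X t))); apply/cvg_ballP => eps eps0.
near=> k; split=> // i j; rewrite ord1 !mxE -ball_normE/=.
have k0 : 0 < k.+1%:R :> R by rewrite ltr0n.
have /andP[h1 h2] := floor_itv (k.+1%:R * X t 0 j).
set y := (_%:~R) in h1 *; rewrite intrD1 -/y in h2.
have -> : X t 0 j - y / k.+1%:R = (k.+1%:R * X t 0 j - y) / k.+1%:R.
  by field; rewrite gt_eqF.
rewrite ger0_norm ?divr_ge0 ?subr_ge0// ltr_pdivrMr//.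
have : k.+1%:R^-1 < eps.
  by near: k; exact: (near_infty_natSinv_lt (PosNum eps0)).
rewrite -[_^-1]mul1r ltr_pdivrMr// => h3.
by apply: lt_trans h3; rewrite ltrBlDl.
Unshelve. all: by end_near. Qed.

Lemma measurable_strongly (f : T -> R) :
  measurable_fun setT f -> strongly_measurable f.
Proof.
move=> mf; have -> : f = (fun v : 'rV[R]_1 => v 0 0) \o (fun t => const_mx (f t)).
  by apply/funext => t; rewrite /= mxE.
apply: strongly_measurable_continuous; first exact: coord_continuous.
by move=> i; under eq_fun do rewrite mxE.
Qed.

Lemma measurable_continuous n (e : 'rV[R]_n -> R) (X : T -> 'rV[R]_n) :
  continuous e -> (forall i, measurable_fun setT (fun t => X t 0 i)) ->
  measurable_fun setT (e \o X).
Proof.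
move=> ce mX; apply: strongly_measurable_measurable.
exact: strongly_measurable_continuous.
Qed.

Section normed.
Context {E : normedModType R}.
Implicit Types f g : T -> E.

Lemma strongly_measurableD f g : strongly_measurable f ->
  strongly_measurable g -> strongly_measurable (fun t => f t + g t).
Proof.
by apply: strongly_measurable2 => u v u_ v_; exact: cvgD.
Qed.

Lemma strongly_measurableZ (c : T -> R) f : measurable_fun setT c ->
  strongly_measurable f -> strongly_measurable (fun t => c t *: f t).
Proof.
move=> /measurable_strongly.
by apply: strongly_measurable2 => u v u_ v_; exact: cvgZ.
Qed.

Lemma strongly_measurableN f :
  strongly_measurable f -> strongly_measurable (fun t => - f t).
Proof.
move=> mf; under eq_fun do rewrite -scaleN1r.
by apply: strongly_measurableZ mf; exact: measurable_cst.
Qed.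

Lemma strongly_measurable_sum I (s : seq I) (f : I -> T -> E) :
  (forall i, strongly_measurable (f i)) ->
  strongly_measurable (fun t => \sum_(i <- s) f i t).
Proof.
move=> mf; elim: s => [|i s IH].
  by under eq_fun do rewrite big_nil; exact: strongly_measurable_cst.
by under eq_fun do rewrite big_cons; exact: strongly_measurableD.
Qed.

End normed.

Lemma measurable_inner (E : completeNormedModType R) (b : E -> E -> R)
    (f g : T -> E) :
  inner_form b -> (forall u, b u u = `|u| ^+ 2) ->
  strongly_measurable f -> strongly_measurable g ->
  measurable_fun setT (fun t => b (f t) (g t)).
Proof.
move=> bP bn mf mg; apply: strongly_measurable_measurable.
by apply: strongly_measurable2 mf mg => u v u_ v_; exact: inner_cvg.
Qed.

End operations.

Lemma strongly_measurable_comp d1 (T1 : measurableType d1) d2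
    (T2 : measurableType d2) (E : topologicalType) (f : T2 -> E) (X : T1 -> T2) :
  measurable_fun setT X -> strongly_measurable f -> strongly_measurable (f \o X).
Proof.
move=> mX [g [gs gf]]; exists (fun n => g n \o X); split=> [n|t]; last exact: gf.
have [N [h [mN gE]]] := gs n.
exists (N \o X), h; split=> [k|t]; last exact: gE.
by rewrite comp_preimage -[X in measurable X]setTI; apply: mX => //; exact: mN.
Qed.

End strong_measurability.

(** * Differentiation inside the reproducing kernel Hilbert space *)

Section mean_value.
Context {R : realType}.

Lemma is_derive_line n (F : 'rV[R]_n -> R) (v z : 'rV[R]_n) (t : R) :
  derivable F (t *: v + z) v ->
  is_derive t 1 (fun s : R => F (s *: v + z)) ('D_v F (t *: v + z)).
Proof.
have e : (fun h : R => h^-1 *: (((fun s : R => F (s *: v + z)) \o shift t) (h *: 1)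
      - F (t *: v + z))) =
    (fun h => h^-1 *: ((F \o shift (t *: v + z)) (h *: v) - F (t *: v + z))).
  by apply/funext => h; rewrite /= scalerDl addrA -[h *: 1]/(h * 1) mulr1.
by move=> dF; apply: DeriveDef; rewrite /derivable /derive e.
Qed.

Lemma mean_value0 (f df : R -> R) (a : R) :
  (forall t : R, is_derive t 1 f (df t)) ->
  exists2 c, `|c| <= `|a| & f a - f 0 = a * df c.
Proof.
move=> fd; have cf A : {within A, continuous f}.
  apply: continuous_subspaceT => t; apply: differentiable_continuous.
  exact/derivable1_diffP/(@ex_derive _ _ _ _ _ _ _ (fd t)).
have [a0|a0] := leP 0 a.
  have [c] := MVT_segment a0 (fun t _ => fd t) (cf _).
  rewrite in_itv/= => /andP[c0 ca] e; exists c; last by rewrite e subr0 mulrC.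
  by rewrite !ger0_norm.
have [c] := MVT_segment (ltW a0) (fun t _ => fd t) (cf _).
rewrite in_itv/= => /andP[ac c0] e; exists c; last by lra.
by rewrite !ler0_norm ?lerN2// ltW.
Qed.

(** The mean value theorem, used once in each direction. *)
Lemma second_difference n (F : 'rV[R]_n -> R) (i j : 'I_n) z (a b : R) :
  C2 F ->
  exists xi eta, [/\ `|xi| <= `|a|, `|eta| <= `|b| &
    F (a *: delta_mx 0 i + (b *: delta_mx 0 j + z)) - F (a *: delta_mx 0 i + z)
      - F (b *: delta_mx 0 j + z) + F z =
    a * b * partial j (partial i F)
      (xi *: delta_mx 0 i + (eta *: delta_mx 0 j + z))].
Proof.
move=> [_ dF _ ddF _]; set u := delta_mx 0 i; set v := delta_mx 0 j.
have [xi xia e1] := @mean_value0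
  (fun t => F (t *: u + (b *: v + z)) - F (t *: u + z))
  (fun t => 'D_u F (t *: u + (b *: v + z)) - 'D_u F (t *: u + z)) a
  (fun t => is_deriveB (is_derive_line (dF i _)) (is_derive_line (dF i _))).
have [eta etab e2] := @mean_value0
  (fun t => partial i F (t *: v + (xi *: u + z)))
  (fun t => 'D_v (partial i F) (t *: v + (xi *: u + z))) b
  (fun t => is_derive_line (ddF i j _)).
exists xi, eta; split; [exact: xia|exact: etab|].
rewrite !scale0r !add0r in e1 e2; rewrite /partial in e2.
rewrite (addrCA (xi *: u)) -mulrA -e2 (addrCA (b *: v)) -e1.
by rewrite opprB addrA; lra.
Qed.

Lemma cvg_row_mx T (F : set_system T) m n (f : T -> 'rV[R]_m) (g : T -> 'rV[R]_n)
    (a : 'rV[R]_m) (c : 'rV[R]_n) : Filter F -> f @ F --> a -> g @ F --> c ->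
  row_mx (f t) (g t) @[t --> F] --> row_mx a c.
Proof.
move=> FF fa gc; apply/cvg_ballP => e e0.
have [/cvg_ballP fe /cvg_ballP ge] := (fa, gc).
near=> t; split=> // i j; rewrite !mxE; case: splitP => k _.
  by have [_ ] : ball a e (f t) by near: t; exact: fe.
by have [_ ] : ball c e (g t) by near: t; exact: ge.
Unshelve. all: by end_near. Qed.

End mean_value.

Section rkhs_derivatives.
Context {R : realType} {d : nat} (H : rkhs R d).
Hypothesis kC2 : kernel_C2 H.
Local Notation dot := (rk_dot H).
Local Notation K := (rk_sec H).
Implicit Types (x y : 'rV[R]_d) (V : H) (i j : 'I_d).

Lemma rk_inner : inner_form dot.
Proof.
split=> [u v|a u v w|u u0].
- by have := @hermC _ _ _ _ dot u v; rewrite expr0 mul1r.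
- by rewrite linearDl linearZl.
- by rewrite neq0_dnorm_gt0.
Qed.

Let dotP := rk_inner.
Let dotn V : dot V V = `|V| ^+ 2 := rk_norm V.

Lemma rk_evE V x : rk_ev V x = dot V (K x).
Proof. by rewrite rk_reproducing. Qed.

(** The squared distance between [e x] and [e y] is a combination of three values
   of [g], which tends to zero on the diagonal. *)
Lemma gram_continuous (e : 'rV[R]_d -> H) (g : 'rV[R]_(d + d) -> R) :
  continuous g -> (forall x y, dot (e x) (e y) = g (row_mx x y)) -> continuous e.
Proof.
move=> cg eg x; suff gen T (F : set_system T) (f : T -> 'rV[R]_d) : Filter F ->
    f @ F --> x -> e (f t) @[t --> F] --> e x.
  exact: (gen _ (nbhs x) id (nbhs_filter x) cvg_id).
move=> FF fx; apply/cvgrPdist_lt => eps eps0.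
have cgx (a c : T -> 'rV[R]_d) : a @ F --> x -> c @ F --> x ->
    g (row_mx (a t) (c t)) @[t --> F] --> g (row_mx x x).
  by move=> ax cx; apply: (cvg_comp _ _ (cvg_row_mx _ ax cx) (cg _)).
have : g (row_mx x x) - 2 * g (row_mx x (f t)) + g (row_mx (f t) (f t)) @[t --> F]
    --> g (row_mx x x) - 2 * g (row_mx x x) + g (row_mx x x).
  apply: cvgD; last exact: cgx.
  apply: cvgB; first exact: cvg_cst.
  by apply: cvgMr; apply: (cgx (fun=> x)) => //; exact: cvg_cst.
have -> : g (row_mx x x) - 2 * g (row_mx x x) + g (row_mx x x) = 0 by ring.
move=> /cvgrPdist_lt /(_ (eps ^+ 2)) h; near=> t.
rewrite -ltr_sqr ?nnegrE//; last exact: ltW.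
rewrite -dotn (inner_sqrB dotP) !eg.
have := ler_norm (g (row_mx x x) - 2 * g (row_mx x (f t)) + g (row_mx (f t) (f t))).
move=> h1; apply: (le_lt_trans h1); rewrite -normrN -sub0r.
by near: t; apply: h; rewrite exprn_gt0.
Unshelve. all: by end_near. Qed.

Let k : 'rV[R]_(d + d) -> R := fun z => rk_kernel H (lsubmx z) (rsubmx z).

Lemma kernel_gram x y : dot (K x) (K y) = k (row_mx x y).
Proof. by rewrite /k row_mxKl row_mxKr /rk_kernel rk_evE. Qed.

Lemma rk_sec_continuous : continuous K.
Proof. by apply: (gram_continuous _ kernel_gram); have [] := kC2. Qed.

Definition dkernel i j : 'rV[R]_(d + d) -> R :=
  partial (rshift d j) (partial (lshift d i) k).

Definition sec_quot i x (h : R) : H := h^-1 *: (K (h *: delta_mx 0 i + x) - K x).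

(** The inner product of two difference quotients of the kernel sections is a
   second difference of the kernel. *)
Lemma sec_quot_gram i j x y (h s : R) : h != 0 -> s != 0 ->
  exists xi eta, [/\ `|xi| <= `|h|, `|eta| <= `|s| &
    dot (sec_quot i x h) (sec_quot j y s) =
    dkernel i j (row_mx (xi *: delta_mx 0 i + x) (eta *: delta_mx 0 j + y))].
Proof.
move=> h0 s0.
have rowE (a c : R) : row_mx (a *: delta_mx 0 i + x) (c *: delta_mx 0 j + y) =
    a *: delta_mx 0 (lshift d i) + (c *: delta_mx 0 (rshift d j) + row_mx x y)
    :> 'rV_(d + d).
  rewrite delta_mx_lshift delta_mx_rshift !scale_row_mx !add_row_mx !scaler0.
  by rewrite !add0r.
have [xi [eta [xih etas e]]] := @second_difference _ _ k
  (lshift d i) (rshift d j) (row_mx x y) h s kC2.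
exists xi, eta; split; [exact: xih|exact: etas|]; rewrite rowE /dkernel.
rewrite /sec_quot (innerZl dotP) (innerZr dotP) (innerBl dotP) !(innerBr dotP).
rewrite !kernel_gram.
have rowl : row_mx (h *: delta_mx 0 i + x) y =
    h *: delta_mx 0 (lshift d i) + row_mx x y :> 'rV_(d + d).
  by have := rowE h 0; rewrite !scale0r !add0r.
have rowr : row_mx x (s *: delta_mx 0 j + y) =
    s *: delta_mx 0 (rshift d j) + row_mx x y :> 'rV_(d + d).
  by have := rowE 0 s; rewrite !scale0r !add0r.
rewrite rowE rowl rowr.
have -> (a b c e' : R) : a - b - (c - e') = a - b - c + e' by ring.
rewrite e.
by field; rewrite h0 s0.
Qed.

Lemma sec_quot_gram_near i j x y (e : R) : 0 < e ->
  exists2 del : R, 0 < del & forall h s, h != 0 -> s != 0 -> `|h| < del ->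
    `|s| < del ->
    `|dot (sec_quot i x h) (sec_quot j y s) - dkernel i j (row_mx x y)| < e.
Proof.
move=> e0; have [_ _ _ _ /(_ (lshift d i) (rshift d j))] := kC2.
rewrite -/k -/(dkernel i j) => /(_ (row_mx x y)) /cvgrPdist_lt /(_ _ e0).
move=> /nbhs_ballP[del /= del0 ball_del]; exists del => // h s h0 s0 hd sd.
have [xi [eta [xih etas ->]]] := sec_quot_gram i j x y h0 s0.
rewrite distrC; apply: ball_del; split=> // a c.
have small (t u : R) (l l' : 'I_d) : `|t| <= `|u| -> `|u| < del ->
    `|t * (delta_mx 0 l : 'rV[R]_d) 0 l'| < del.
  move=> tu ud; rewrite mxE eqxx/= normrM; apply: le_lt_trans ud.
  apply: le_trans tu; rewrite ler_piMr//; case: eqP => _ /=.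
    by rewrite normr1.
  by rewrite normr0.
rewrite ord1 -ball_normE/= !mxE; case: splitP => l _; rewrite !mxE.
  rewrite opprD addrCA subrr addr0 normrN.
  by have := small xi h i l xih hd; rewrite mxE.
rewrite opprD addrCA subrr addr0 normrN.
by have := small eta s j l etas sd; rewrite mxE.
Qed.

(** The quotients form a Cauchy family, because all their mutual inner products
   approach the same mixed derivative of the kernel. *)
Lemma sec_quot_cvg i x : cvg (sec_quot i x h @[h --> 0^']).
Proof.
suff hc : cauchy_ex (sec_quot i x h @[h --> 0^']).
  by apply: cauchy_cvg; exact: cauchy_exP.
move=> e e0; have e4 : 0 < e ^+ 2 / 4 by rewrite divr_gt0// exprn_gt0.
have [del del0 hdel] := sec_quot_gram_near i i x x e4.
have d20 : del / 2 != 0 by rewrite gt_eqF// divr_gt0.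
have d2d : `|del / 2| < del.
  by rewrite gtr0_norm ?divr_gt0// ltr_pdivrMr// ltr_pMr// ltr1n.
exists (sec_quot i x (del / 2)).
suff : \forall h \near (0 : R)^', ball (sec_quot i x (del / 2)) e (sec_quot i x h).
  by [].
near=> h; rewrite -ball_normE/=.
have h0 : h != 0 by near: h; exact: nbhs_dnbhs_neq.
have hd : `|h| < del by near: h; exact: dnbhs0_lt.
rewrite -ltr_sqr ?nnegrE//; last exact: ltW.
rewrite -dotn (inner_sqrB dotP).
have := hdel _ _ d20 d20 d2d d2d.
have := hdel _ _ d20 h0 d2d hd; have := hdel _ _ h0 h0 hd hd.
rewrite !ltr_norml => /andP[_ a1] /andP[a2 _] /andP[_ a3].
set E := e ^+ 2 in a1 a2 a3 *; lra.
Unshelve. all: by end_near. Qed.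

(** The element representing the evaluation of the [i]-th partial derivative at
   [x]. *)
Definition dsec i x : H := lim (sec_quot i x h @[h --> 0^']).

Lemma dsec_gram i j x y : dot (dsec i x) (dsec j y) = dkernel i j (row_mx x y).
Proof.
have c1 : dot (sec_quot i x h) (sec_quot j y h) @[h --> 0^'] -->
    dot (dsec i x) (dsec j y).
  by apply: inner_cvg => //; exact: sec_quot_cvg.
suff c2 : dot (sec_quot i x h) (sec_quot j y h) @[h --> 0^'] -->
    dkernel i j (row_mx x y) by exact: cvg_unique c1 c2.
apply/cvgrPdist_lt => e e0.
have [del del0 hdel] := sec_quot_gram_near i j x y e0.
near=> h; rewrite distrC.
have h0 : h != 0 by near: h; exact: nbhs_dnbhs_neq.
by apply: hdel => //; near: h; exact: dnbhs0_lt.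
Unshelve. all: by end_near. Qed.

Lemma dsec_continuous i : continuous (dsec i).
Proof.
apply: (gram_continuous _ (dsec_gram i i)).
by have [_ _ _ _ c] := kC2; exact: c.
Qed.

(** Difference quotients of [V] are inner products of [V] with those of the kernel
   sections, which converge in norm. *)
Lemma partial_rk_ev i V x : partial i (rk_ev V) x = dot V (dsec i x).
Proof.
rewrite /partial /derive; apply: cvg_lim => //.
have -> : (fun h => h^-1 *: ((rk_ev V \o shift x) (h *: delta_mx 0 i) -
    rk_ev V x)) = (fun h => dot V (sec_quot i x h)).
  apply/funext => h; rewrite /sec_quot (innerZr dotP) (innerBr dotP) /=.
  by rewrite !rk_evE.
by apply: (inner_cvg dotP dotn); [exact: (@cvg_cst H)|exact: sec_quot_cvg].
Qed.

Lemma rk_sec_torus : torus_fun K.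
Proof.
move=> x i; apply: (inner_extr dotP) => V.
by rewrite !(innerC dotP _ V) -!rk_evE rk_ev_torus.
Qed.

Lemma dsec_torus i : torus_fun (dsec i).
Proof.
move=> x j; rewrite /dsec; suff -> : sec_quot i (x + delta_mx 0 j) = sec_quot i x.
  by [].
by apply/funext => h; rewrite /sec_quot addrA !rk_sec_torus.
Qed.

End rkhs_derivatives.

(** * Functions on the torus *)

Section torus_functions.
Context {R : realType} {d : nat}.

Lemma torus_shift T (g : 'rV[R]_d -> T) (z : 'I_d -> int) x : torus_fun g ->
  g (x + \sum_i (z i)%:~R *: delta_mx 0 i) = g x.
Proof.
move=> gt; have shift1 i (n : nat) y : g (y + n%:R *: delta_mx 0 i) = g y.
  elim: n y => [|n IH] y; first by rewrite scale0r addr0.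
  by rewrite -natr1 scalerDl scale1r addrA gt IH.
have shiftz i (k : int) y : g (y + k%:~R *: delta_mx 0 i) = g y.
  case: k => n; first exact: shift1.
  rewrite NegzE mulrNz scaleNr -(shift1 i n.+1 (y - _)).
  by rewrite pmulrn subrK.
elim: (index_enum _) x => [|i s IH] x; first by rewrite big_nil addr0.
by rewrite big_cons addrA IH shiftz.
Qed.

(** Every point is congruent to a point of the compact cube. *)
Lemma torus_bounded (g : 'rV[R]_d -> R) : continuous g -> torus_fun g ->
  exists2 C, 0 <= C & forall x, `|g x| <= C.
Proof.
move=> cg gt; pose A := [set v : 'rV[R]_d | forall i, `[0%R, 1%R]%classic (v ord0 i)].
have : compact (g @` A).
  apply: continuous_compact; first exact: continuous_subspaceT.
  exact: (rV_compact (fun i : 'I_d => @segment_compact R 0 1)).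
move=> /compact_bounded[C [_ /(_ (`|C| + 1))]].
have C1 : C < `|C| + 1 by rewrite (le_lt_trans (ler_norm _))// ltrDl.
move=> /(_ C1) bd; exists (`|C| + 1) => [|x]; first by rewrite addr_ge0.
rewrite -(torus_shift (fun i => - Num.floor (x 0 i)) x gt); apply: bd => /=.
eexists; last by []; move=> i /=; rewrite in_itv/=.
rewrite mxE summxE (bigD1 i)//= !mxE !eqxx mulr1.
rewrite big1 ?addr0 => [|j ji]; last first.
  by rewrite !mxE (eq_sym i) (negbTE ji) andbF mulr0.
have /andP[h1 h2] := floor_itv (x 0 i).
by rewrite rmorphN/= subr_ge0 h1/= lerBlDl -intrD1 ltW.
Qed.

Lemma torus_comp (T U : Type) (g : 'rV[R]_d -> T) (h : T -> U) :
  torus_fun g -> torus_fun (h \o g).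
Proof. by move=> gt x i; rewrite /= gt. Qed.

Lemma torus_norm_bounded (E : normedModType R) (g : 'rV[R]_d -> E) :
  continuous g -> torus_fun g -> exists2 C, 0 <= C & forall x, `|g x| <= C.
Proof.
move=> cg gt; have [C C0 hC] : exists2 C, 0 <= C &
    forall x, `|(fun y => `|g y|) x| <= C.
  apply: torus_bounded; last exact: torus_comp gt.
  by move=> x; apply: continuous_comp; [exact: cg|exact: norm_continuous].
by exists C => // x; have := hC x; rewrite normr_id.
Qed.

Lemma lipschitz_continuous (V W : normedModType R) (f : V -> W) :
  lipschitz f -> continuous f.
Proof.
rewrite /lipschitz_on; move=> [k [_ /(_ (`|k| + 1))]].
have k1 : k < `|k| + 1 by rewrite (le_lt_trans (ler_norm _))// ltrDl.
move=> /(_ k1) kl x; set L := `|k| + 1 in kl.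
have L0 : 0 < L by rewrite ltr_wpDl.
apply/(@cvgrPdist_lt _ _ _ (nbhs x) (nbhs_filter x)) => e e0.
apply/nbhs_ballP; exists (e / L); first by rewrite /= divr_gt0.
move=> y; rewrite -ball_normE/= ltr_pdivlMr// => xy.
by have := kl (x, y) (conj I I); rewrite /= => h; apply: (le_lt_trans h); rewrite mulrC.
Qed.

Lemma measurable_pt (i : 'I_d) :
  measurable_fun [set: d.-tuple R] (fun s => pt s 0 i).
Proof. by under eq_fun do rewrite mxE; exact: measurable_tnth. Qed.

End torus_functions.

(** * The value function of the inner minimisation *)

Section powers.
Context {R : realType}.

Lemma powR_le1D (x p : R) : 0 <= x -> 0 <= p <= 1 -> x `^ p <= 1 + x.
Proof.
move=> x0 /andP[p0 p1]; have [x1|x1] := leP x 1.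
  apply: (@le_trans _ _ 1); last by rewrite lerDl.
  have <- : 1 `^ p = 1 :> R by rewrite powR1.
  by apply: ge0_ler_powR; rewrite ?nnegrE.
by apply: (le_trans (ler1_powR (ltW x1) p1)); rewrite lerDr.
Qed.

Lemma powR_young (q x y : R) : 1 < q -> 0 <= x -> 0 <= y ->
  y `^ (q - 1) * x <= (q - 1) / q * y `^ q + x `^ q / q.
Proof.
move=> q1 x0 y0; have q0 : 0 < q by lra.
have k0 : 0 < ((q - 1) / q)^-1 by rewrite invr_gt0 divr_gt0// subr_gt0.
have cj : q^-1 + ((q - 1) / q)^-1^-1 = 1 by rewrite invrK; field; lra.
have := conjugate_powR x0 (powR_ge0 y (q - 1)) q0 k0 cj.
rewrite invrK -powRrM.
have -> : (q - 1) * ((q - 1) / q)^-1 = q by field; rewrite !gt_eqF//; lra.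
by lra.
Qed.

End powers.

Section dotv.
Context {R : realType} {n : nat}.

Lemma dotv_inner : inner_form (@dotv R n).
Proof.
split=> [u v|a u v w|u u0].
- by apply: eq_bigr => i _; rewrite mulrC.
- rewrite /dotv mulr_sumr -big_split/=; apply: eq_bigr => i _.
  by rewrite !mxE; ring.
have /existsP[i ui] : [exists i, u 0 i != 0].
  apply: contraR u0 => /existsPn h; apply/eqP/rowP => i.
  by rewrite mxE; apply/eqP; rewrite -[_ == _]negbK h.
rewrite /dotv (bigD1 i)//= ltr_wpDr//; last by rewrite -expr2 exprn_even_gt0.
by apply: sumr_ge0 => j _; rewrite -expr2 sqr_ge0.
Qed.

Lemma enormE (u : 'rV[R]_n) : enorm u = inorm (@dotv R n) u.
Proof. by []. Qed.

Lemma enorm_ge0 (u : 'rV[R]_n) : 0 <= enorm u. Proof. exact: sqrtr_ge0. Qed.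

Lemma enorm0 : enorm (0 : 'rV[R]_n) = 0.
Proof. exact: (inorm0 dotv_inner). Qed.

Lemma enorm_eq0 (u : 'rV[R]_n) : (enorm u == 0) = (u == 0).
Proof.
apply/eqP/eqP => [|->]; last exact: enorm0.
exact: (inorm_eq0 dotv_inner).
Qed.

Lemma enorm_gt0 (u : 'rV[R]_n) : u != 0 -> 0 < enorm u.
Proof. by move=> u0; rewrite lt_neqAle eq_sym enorm_eq0 u0 enorm_ge0. Qed.

End dotv.

Section inner_minimisation.
Context {R : realType} {d m : nat} (cp : control_problem R d m) (M : R).
Local Notation q := (cp_q cp).
Hypotheses (q1 : 1 < q) (q2 : q <= 2) (M0 : 0 < M).
Implicit Types (al : 'rV[R]_m) (be mu : R).

Let kap : R := (q - 1) / q.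
Let q0 : 0 < q. Proof. exact: lt_trans q1. Qed.
Let kap0 : 0 < kap. Proof. by rewrite divr_gt0// subr_gt0. Qed.
Local Notation mu_ := (mu_opt cp M).

(** The speed at the optimal mass. *)
Let y_ al be : R := enorm al / mu_ al be.

Lemma mu_opt_le al be : mu_ al be <= M.
Proof. by rewrite /mu_opt; case: ifP => // _; rewrite ge_min lexx orbT. Qed.

Lemma mu_opt_gt0 al be : al != 0 -> 0 < mu_ al be.
Proof.
move=> al0; rewrite /mu_opt; have [//|be0] := leP be 0.
by rewrite lt_min M0 andbT !mulr_gt0 ?powR_gt0 ?enorm_gt0.
Qed.

Let y_gt0 al be : al != 0 -> 0 < y_ al be.
Proof. by move=> al0; rewrite divr_gt0 ?enorm_gt0 ?mu_opt_gt0. Qed.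

(** The derivative in [mu] of the inner objective at the optimal mass vanishes
   inside [0, M] and is nonpositive at the endpoint [M]. *)
Lemma mu_opt_first_order al be : al != 0 ->
  be <= kap * y_ al be `^ q /\ (mu_ al be < M -> be = kap * y_ al be `^ q).
Proof.
move=> al0; have t0 := enorm_gt0 al0; have m0 := mu_opt_gt0 be al0.
have [be0|be0] := leP be 0.
  split; last by rewrite /mu_opt be0 ltxx.
  by apply: (le_trans be0); rewrite mulr_ge0 ?powR_ge0// ltW.
pose s := kap `^ q^-1 * be `^ (- q^-1) * enorm al.
have s0 : 0 < s by rewrite !mulr_gt0 ?powR_gt0.
have sq : (enorm al / s) `^ q = be / kap.
  have -> : enorm al / s = (be / kap) `^ q^-1.
    rewrite powRM ?invr_ge0 ?(ltW be0) ?(ltW kap0)// -[kap^-1]powR_inv1 ?(ltW kap0)//.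
    rewrite -powRrM mulN1r /s !powRN.
    by field; rewrite !gt_eqF// ?powR_gt0.
  by rewrite -powRrM mulVf ?gt_eqF// powRr1// divr_ge0 ?ltW.
have mE : mu_ al be = Num.min s M by rewrite /mu_opt leNgt be0.
have bE : be = kap * (enorm al / s) `^ q by rewrite sq mulrC divfK// gt_eqF.
split.
  rewrite {1}bE ler_pM2l//.
  apply: ge0_ler_powR; rewrite ?nnegrE ?divr_ge0 ?(ltW q0) ?(ltW t0) ?(ltW m0) ?(ltW s0)//.
  by rewrite /y_ ler_pM2l// lef_pV2 ?posrE// mE ge_min lexx.
by rewrite /y_ mE gt_min ltxx orbF => sM; rewrite min_l ?(ltW sM).
Qed.

Lemma dS_alphaE al be : al != 0 ->
  dS_alpha cp M al be = (y_ al be `^ (q - 1) / enorm al) *: al.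
Proof.
move=> al0; rewrite /dS_alpha (negbTE al0); congr (_ *: _).
have t0 := enorm_gt0 al0; have m0 := mu_opt_gt0 be al0.
rewrite /y_ powRM ?invr_ge0 ?(ltW t0) ?(ltW m0)// -[_^-1]powR_inv1 ?(ltW m0)//.
rewrite -powRrM mulN1r opprB (_ : q - 2 = (q - 1) - 1); last by ring.
rewrite powRB; last by rewrite (gt_eqF t0) implybT.
by rewrite powRr1 ?(ltW t0)// mulrAC.
Qed.

(** Closed form of the infimum defining [S_M]: at speed [y] a unit of mass costs
   [be + y^q / q]. *)
Definition S_val al be : R :=
  if al == 0 then Num.min 0 (be * M) else mu_ al be * (be + y_ al be `^ q / q).

Let dot_dS al be : al != 0 ->
  dotv (dS_alpha cp M al be) al = mu_ al be * y_ al be `^ q.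
Proof.
move=> al0; rewrite dS_alphaE// (innerZl dotv_inner) -(inorm_sqr dotv_inner).
have t0 := enorm_gt0 al0; have m0 := mu_opt_gt0 be al0; have y0 := y_gt0 be al0.
rewrite -(mulr_powRB1 (ltW y0) q0) -enormE /y_; field.
by rewrite !gt_eqF.
Qed.

Let enorm_dS al be : al != 0 ->
  enorm (dS_alpha cp M al be) = y_ al be `^ (q - 1).
Proof.
move=> al0; have t0 := enorm_gt0 al0.
rewrite dS_alphaE// enormE (inormZ dotv_inner) ger0_norm.
  by rewrite -enormE divfK// gt_eqF.
by rewrite divr_ge0 ?powR_ge0 ?ltW.
Qed.

Let Rcost_speed al mu : 0 < mu ->
  persp cp al mu = (mu * ((enorm al / mu) `^ q / q))%:E.
Proof.
move=> m0; rewrite /persp gt_eqF// /Rcost enormE (inormZ dotv_inner).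
by rewrite gtr0_norm ?invr_gt0// -enormE mulrC [_ * mu^-1]mulrC mulrC.
Qed.

Lemma persp_ge0 al mu : 0 <= mu -> (0 <= persp cp al mu)%E.
Proof.
move=> mu0; rewrite /persp; case: eqP => [_|_].
  by case: ifP => _; rewrite ?lexx ?leey.
by rewrite lee_fin mulr_ge0// divr_ge0 ?powR_ge0 ?ltW.
Qed.

(** The affine minorant of the perspective [(al, mu) |-> mu R(al / mu)] at the
   optimum, which is Young's inequality; taking the infimum over the mass gives
   both the value of [S_M] and its subgradient. *)
Lemma S_val_minorant al be al' mu : 0 <= mu <= M ->
  ((S_val al be + dotv (dS_alpha cp M al be) (al' - al))%:E <=
   (be * mu)%:E + persp cp al' mu)%E.
Proof.
move=> /andP[mu0 muM]; have [al0|al0] := eqVneq al 0.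
  rewrite /S_val /dS_alpha al0 eqxx (inner0l dotv_inner) addr0.
  have h : ((be * mu)%:E <= (be * mu)%:E + persp cp al' mu)%E.
    by rewrite leeDl// persp_ge0.
  apply: le_trans h; rewrite lee_fin ge_min.
  have [be0|be0] := leP 0 be; first by rewrite mulr_ge0.
  by rewrite ler_wnM2l ?orbT// ltW.
have t0 := enorm_gt0 al0; have m0 := mu_opt_gt0 be al0; have y0 := y_gt0 be al0.
have [f1 f2] := mu_opt_first_order be al0.
rewrite (innerBr dotv_inner) dot_dS// /S_val (negbTE al0).
set y := y_ al be in f1 f2 y0 *; set m' := mu_ al be in f2 m0 *.
have yq : 0 <= y `^ q by exact: powR_ge0.
have opt : m' * (be - kap * y `^ q) <= mu * (be - kap * y `^ q).
  have := mu_opt_le al be; rewrite -/m' le_eqVlt => /predU1P[->|/f2 ->].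
    by rewrite ler_wnM2r// subr_le0.
  by rewrite subrr !mulr0.
have val : m' * (be + y `^ q / q) - m' * y `^ q = m' * (be - kap * y `^ q).
  by rewrite /kap; field; rewrite gt_eqF.
rewrite addrCA val addrC.
have := mu0; rewrite le_eqVlt => /predU1P[<-|mup].
  rewrite /persp eqxx; case: ifPn => [/eqP ->|_]; last first.
    by rewrite addey ?leey// -ltNye ltNyr.
  rewrite (inner0r dotv_inner) addr0 mulr0 adde0 lee_fin.
  by rewrite mulr_ge0_le0 ?subr_le0// ltW.
rewrite Rcost_speed// -EFinD lee_fin.
have x0 : 0 <= enorm al' / mu by rewrite divr_ge0 ?enorm_ge0.
have := powR_young q1 x0 (ltW y0); rewrite -/kap => yg.
have cs := inner_le_inorm dotv_inner (dS_alpha cp M al be) al'.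
rewrite -!enormE enorm_dS// -/y in cs.
have yg2 : y `^ (q - 1) * enorm al' <=
    mu * (kap * y `^ q + (enorm al' / mu) `^ q / q).
  have -> : y `^ (q - 1) * enorm al' = mu * (y `^ (q - 1) * (enorm al' / mu)).
    by field; rewrite gt_eqF.
  by rewrite ler_pM2l.
rewrite mulrBr in opt; rewrite mulrBr; rewrite mulrDr in yg2.
rewrite mulrBr in opt; lra.
Qed.

Lemma S_val_attained al be : exists2 mu, 0 <= mu <= M &
  (S_val al be)%:E = ((be * mu)%:E + persp cp al mu)%E.
Proof.
have [->|al0] := eqVneq al 0.
  exists (if be <= 0 then M else 0); first by case: ifP; rewrite lexx (ltW M0).
  rewrite /S_val /persp eqxx; case: ifPn => [be0|].
    rewrite gt_eqF// /Rcost scaler0 enorm0 powR0 ?gt_eqF// !mul0r adde0.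
    by congr (_%:E); rewrite min_r// mulr_le0_ge0 ?(ltW M0).
  rewrite -ltNge => be0; rewrite eqxx mulr0 adde0; congr (_%:E).
  by rewrite min_l// mulr_ge0 ?ltW.
have m0 := mu_opt_gt0 be al0.
exists (mu_ al be); first by rewrite mu_opt_le ltW.
by rewrite /S_val (negbTE al0) Rcost_speed// -EFinD -/(y_ al be) mulrDr mulrC.
Qed.

Lemma S_ME al be : S_M cp M al be = (S_val al be)%:E.
Proof.
apply/eqP; rewrite eq_le; apply/andP; split.
  have [mu muM ->] := S_val_attained al be.
  by apply: ereal_inf_lbound; exists mu => //=; rewrite in_itv.
apply: le_ereal_inf_tmp => _ [mu muM <-]; rewrite /= in_itv/= in muM.
by have := S_val_minorant al be al muM; rewrite subrr (inner0r dotv_inner) addr0.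
Qed.

Lemma S_val_convex al be al' :
  S_val al be + dotv (dS_alpha cp M al be) (al' - al) <= S_val al' be.
Proof.
have [mu muM e] := S_val_attained al' be.
by rewrite -lee_fin e; exact: S_val_minorant.
Qed.

Lemma S_val_le al be mu : 0 <= mu <= M ->
  ((S_val al be)%:E <= (be * mu)%:E + persp cp al mu)%E.
Proof.
by move/(S_val_minorant al be al); rewrite subrr (inner0r dotv_inner) addr0.
Qed.

(** [S_M] is an infimum of functions that are affine in [be]. *)
Lemma S_val_concave al be be' :
  S_val al be' <= S_val al be + dS_beta cp M al be * (be' - be).
Proof.
have [al0|al0] := eqVneq al 0.
  rewrite /S_val /dS_beta al0 eqxx; case: ifPn => [be0|].
    have -> : Num.min 0 (be * M) = be * M by rewrite min_r// mulr_le0_ge0 ?(ltW M0).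
    have -> : be * M + M * (be' - be) = be' * M by ring.
    by rewrite ge_min lexx orbT.
  rewrite -ltNge => be0; rewrite mul0r addr0 [leRHS]min_l; last first.
    by rewrite mulr_ge0 ?ltW.
  by rewrite ge_min lexx.
have m0 := mu_opt_gt0 be al0.
have mM : 0 <= mu_ al be <= M by rewrite mu_opt_le ltW.
have := S_val_le al be' mM; rewrite Rcost_speed// -EFinD lee_fin => h.
apply: (le_trans h); rewrite /S_val /dS_beta (negbTE al0) -/(y_ al be).
rewrite le_eqVlt; apply/orP; left; apply/eqP; ring.
Qed.

Lemma dS_beta_bound al be : 0 <= dS_beta cp M al be <= M.
Proof.
rewrite /dS_beta; case: ifPn => [_|al0].
  by case: ifP; rewrite lexx (ltW M0).
by rewrite mu_opt_le ltW ?mu_opt_gt0.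
Qed.

(** The norm of the subgradient is a power [q - 1 <= 1] of the optimal speed, and
   that speed is either [|al| / M] or [(be / kap)^(1/q)]; both powers grow at most
   linearly because [1 <= q <= 2]. *)
Lemma enorm_dS_alpha_le al be :
  enorm (dS_alpha cp M al be) <= 2 + enorm al / M + `|be| / kap.
Proof.
have T0 : 0 <= enorm al / M by rewrite divr_ge0 ?enorm_ge0 ?(ltW M0).
have B0 : 0 <= `|be| / kap by rewrite divr_ge0 ?(ltW kap0).
have [->|al0] := eqVneq al 0.
  rewrite /dS_alpha eqxx !enorm0 mul0r addr0; lra.
have t0 := enorm_gt0 al0; have m0 := mu_opt_gt0 be al0; have y0 := y_gt0 be al0.
rewrite enorm_dS//; apply: (@le_trans _ _ (1 + y_ al be)).
  by apply: powR_le1D; [exact: ltW|rewrite subr_ge0 (ltW q1) lerBlDr].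
have := mu_opt_le al be; rewrite le_eqVlt => /predU1P[mE|mM].
  by rewrite /y_ mE; lra.
have [_ /(_ mM) bE] := mu_opt_first_order be al0.
have bk : be / kap = y_ al be `^ q.
  by rewrite [X in X / _]bE [kap * _]mulrC mulfK ?gt_eqF.
have : y_ al be = (be / kap) `^ q^-1.
  by rewrite bk -powRrM mulfV ?gt_eqF// powRr1// ltW.
have bk0 : 0 <= be / kap by rewrite bk powR_ge0.
have be0 : 0 <= be by rewrite bE mulr_ge0 ?powR_ge0// ltW.
have := @powR_le1D _ (be / kap) q^-1 bk0.
rewrite invr_ge0 (ltW q0) invf_le1// (ltW q1) => /(_ isT) h ->.
by rewrite (ger0_norm be0); lra.
Qed.

End inner_minimisation.

Section inner_minimisation_measurable.
Context {R : realType} {d m : nat} (cp : control_problem R d m) (M : R).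
Local Notation q := (cp_q cp).
Hypotheses (q1 : 1 < q) (M0 : 0 < M).

Lemma S_val_bound (al : 'rV[R]_m) (be : R) :
  `|S_val cp M al be| <= `|be| * M + M * ((enorm al / M) `^ q / q).
Proof.
have q0 : 0 < q by exact: lt_trans q1.
have pos : 0 <= M * ((enorm al / M) `^ q / q).
  by rewrite mulr_ge0 ?(ltW M0)// divr_ge0 ?powR_ge0 ?(ltW q0).
rewrite ler_norml; apply/andP; split.
  have [mu /andP[mu0 muM] e] := S_val_attained q1 M0 al be.
  apply: (@le_trans _ _ (be * mu)).
    have : `|be * mu| <= `|be| * M.
      by rewrite normrM (ger0_norm mu0) ler_wpM2l.
    by rewrite ler_norml => /andP[h _]; lra.
  by rewrite -lee_fin e leeDl// persp_ge0.
have M1 : 0 <= M <= M by rewrite lexx (ltW M0).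
have := S_val_le q1 M0 al be M1.
rewrite /persp gt_eqF// /Rcost enormE (inormZ dotv_inner) gtr0_norm ?invr_gt0//.
rewrite -enormE -EFinD lee_fin => h; apply: (le_trans h).
rewrite [M^-1 * _]mulrC [X in _ + X]mulrC lerD2r ler_wpM2r ?(ltW M0)//.
exact: ler_norm.
Qed.

Context dT (T : measurableType dT) (al : T -> 'rV[R]_m) (be : T -> R).
Hypotheses (mal : forall j, measurable_fun setT (fun t => al t 0 j))
  (mbe : measurable_fun setT be).

Lemma measurable_enorm : measurable_fun setT (fun t => enorm (al t)).
Proof.
apply: (@measurableT_comp _ _ _ _ _ _ (@Num.sqrt R)).
  by apply: continuous_measurable_fun; exact: sqrt_continuous.
by apply: measurable_sum => i; exact: measurable_funM.
Qed.

Let meq0 : measurable_fun setT (fun t => al t == 0).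
Proof.
under eq_fun do rewrite -enorm_eq0.
by apply: measurable_fun_eqr; [exact: measurable_enorm|exact: measurable_cst].
Qed.

Let mle0 : measurable_fun setT (fun t => be t <= 0).
Proof. exact: (measurable_fun_ler mbe (@measurable_cst _ _ T R setT 0)). Qed.

Lemma measurable_mu_opt : measurable_fun setT (fun t => mu_opt cp M (al t) (be t)).
Proof.
rewrite /mu_opt; apply: (measurable_fun_ifT mle0); first exact: measurable_cst.
apply: measurable_minr; last exact: measurable_cst.
apply: measurable_funM; last exact: measurable_enorm.
apply: measurable_funM; first exact: measurable_cst.
exact: (measurableT_comp (measurable_powR _) mbe).
Qed.

Lemma measurable_dS_beta : measurable_fun setT (fun t => dS_beta cp M (al t) (be t)).
Proof.
rewrite /dS_beta; apply: (measurable_fun_ifT meq0); last exact: measurable_mu_opt.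
by apply: (measurable_fun_ifT mle0); exact: measurable_cst.
Qed.

Lemma measurable_dS_alpha j :
  measurable_fun setT (fun t => dS_alpha cp M (al t) (be t) 0 j).
Proof.
have -> : (fun t => dS_alpha cp M (al t) (be t) 0 j) = (fun t =>
    enorm (al t) `^ (q - 2) * mu_opt cp M (al t) (be t) `^ (1 - q) * al t 0 j).
  apply/funext => t; rewrite /dS_alpha; case: ifPn => [/eqP ->|_]; rewrite !mxE//.
  by rewrite mulr0.
apply: measurable_funM => //; apply: measurable_funM.
  exact: (measurableT_comp (measurable_powR _) measurable_enorm).
exact: (measurableT_comp (measurable_powR _) measurable_mu_opt).
Qed.

Lemma measurable_S_val : measurable_fun setT (fun t => S_val cp M (al t) (be t)).
Proof.
rewrite /S_val; apply: (measurable_fun_ifT meq0).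
  apply: measurable_minr; first exact: measurable_cst.
  by apply: measurable_funM => //; exact: measurable_cst.
apply: measurable_funM; first exact: measurable_mu_opt.
apply: measurable_funD => //; apply: measurable_funM; last exact: measurable_cst.
apply: (measurableT_comp (measurable_powR _)).
apply: measurable_funM; first exact: measurable_enorm.
under eq_fun => t.
  rewrite -powR_inv1; last first.
    by rewrite /mu_opt; case: ifP => _; rewrite ?le_min ?mulr_ge0 ?powR_ge0
      ?enorm_ge0 ?(ltW M0).
  over.
exact: (measurableT_comp (measurable_powR _) measurable_mu_opt).
Qed.

End inner_minimisation_measurable.

(** * The saddle function and its partial subgradients *)

Section product_hilbert.
Context {R : realType} {d : nat} (H : rkhs R d) (m : nat).
Local Notation Hm := {ffun 'I_m -> H}.
Local Notation Z := (Hm * H)%type.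
Local Notation dot := (rk_dot H).

Lemma hm_inner : inner_form (@hm_dot R d H m).
Proof.
split=> [u v|a u v w|u u0].
- by apply: eq_bigr => i _; rewrite (innerC (rk_inner H)).
- rewrite /hm_dot mulr_sumr -big_split/=; apply: eq_bigr => i _.
  by rewrite !ffunE (innerDl (rk_inner H)) (innerZl (rk_inner H)).
have /existsP[i ui] : [exists i, u i != 0].
  apply: contraR u0 => /existsPn h; apply/eqP/ffunP => i.
  by rewrite ffunE; apply/eqP; rewrite -[_ == _]negbK h.
have [_ _ dp] := rk_inner H.
rewrite /hm_dot (bigD1 i)//= ltr_wpDr//; last exact: dp.
by apply: sumr_ge0 => j _; exact: (inner_ge0 (rk_inner H)).
Qed.

Lemma z_inner : inner_form (@z_dot R d H m).
Proof.
split=> [u v|a u v w|[w V] u0].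
- by rewrite /z_dot (innerC hm_inner) (innerC (rk_inner H)).
- rewrite /z_dot/= (innerDl hm_inner) (innerZl hm_inner).
  by rewrite (innerDl (rk_inner H)) (innerZl (rk_inner H)); ring.
have [_ _ dp] := rk_inner H; have [_ _ hp] := hm_inner.
rewrite /z_dot/=; have [w0|/hp w0] := eqVneq w 0.
  rewrite w0 (inner0l hm_inner) add0r dp//.
  by apply: contraNneq u0 => ->; rewrite w0.
by rewrite ltr_pwDl// (inner_ge0 (rk_inner H)).
Qed.

Lemma hm_normE (w : Hm) : hm_norm w = inorm (@hm_dot R d H m) w.
Proof. by []. Qed.

Lemma sum_sqr_le I (s : seq I) (F : I -> R) : (forall i, 0 <= F i) ->
  \sum_(i <- s) F i ^+ 2 <= (\sum_(i <- s) F i) ^+ 2.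
Proof.
move=> F0; elim: s => [|i s IH]; first by rewrite !big_nil expr0n.
rewrite !big_cons sqrrD.
have S0 : 0 <= \sum_(j <- s) F j by exact: sumr_ge0.
by have := mulr_ge0 (F0 i) S0; rewrite -mulr_natr; lra.
Qed.

Lemma hm_norm_le_sum (w : Hm) : hm_norm w <= \sum_i `|w i|.
Proof.
have S0 : 0 <= \sum_i `|w i| by exact: sumr_ge0.
rewrite hm_normE (inorm_le hm_inner)//; apply: le_trans (sum_sqr_le _ _) => //.
by rewrite /hm_dot; under eq_bigr do rewrite rk_norm.
Qed.

Lemma normr_le_hm_norm (w : Hm) i : `|w i| <= hm_norm w.
Proof.
rewrite -(@inner_normE _ _ dot (@rk_norm _ _ H)) hm_normE.
rewrite (inorm_le (rk_inner H)) ?(inorm_ge0)// (inorm_sqr hm_inner).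
rewrite /hm_dot (bigD1 i)//= lerDl; apply: sumr_ge0 => j _.
exact: (inner_ge0 (rk_inner H)).
Qed.

Definition strongly_measurable_pair dT (T : measurableType dT) (z : T -> Z) :=
  (forall j, strongly_measurable (fun t => (z t).1 j)) /\
  strongly_measurable (fun t => (z t).2).

Section measurable_pairs.
Context dT (T : measurableType dT).
Implicit Types z : T -> Z.

Lemma measurable_hm_dot (w w' : T -> Hm) :
  (forall j, strongly_measurable (fun t => w t j)) ->
  (forall j, strongly_measurable (fun t => w' t j)) ->
  measurable_fun setT (fun t => hm_dot (w t) (w' t)).
Proof.
move=> mw mw'; apply: measurable_sum => j.
exact: (measurable_inner (rk_inner H) (@rk_norm _ _ H)).
Qed.

Lemma measurable_z_dot z z' : strongly_measurable_pair z ->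
  strongly_measurable_pair z' -> measurable_fun setT (fun t => z_dot (z t) (z' t)).
Proof.
move=> [mz1 mz2] [mz1' mz2']; apply: measurable_funD.
  exact: measurable_hm_dot.
exact: (measurable_inner (rk_inner H) (@rk_norm _ _ H)).
Qed.

Lemma strongly_measurable_pair_cst (z : Z) :
  strongly_measurable_pair (fun _ : T => z).
Proof. by split=> [j|]; exact: strongly_measurable_cst. Qed.

Lemma strongly_measurable_pairB z z' : strongly_measurable_pair z ->
  strongly_measurable_pair z' -> strongly_measurable_pair (fun t => z t - z' t).
Proof.
move=> [mz1 mz2] [mz1' mz2']; split=> [j|] /=.
  under eq_fun do rewrite !ffunE.
  by apply: strongly_measurableD => //; exact: strongly_measurableN.
by apply: strongly_measurableD => //; exact: strongly_measurableN.
Qed.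

Lemma strongly_measurable_pairZ (c : R) z : strongly_measurable_pair z ->
  strongly_measurable_pair (fun t => c *: z t).
Proof.
move=> [mz1 mz2]; split=> [j|] /=.
  under eq_fun do rewrite !ffunE.
  by apply: strongly_measurableZ => //; exact: measurable_cst.
by apply: strongly_measurableZ => //; exact: measurable_cst.
Qed.

End measurable_pairs.

Lemma strongly_measurable_pair_comp d1 (T1 : measurableType d1) d2
    (T2 : measurableType d2) (z : T2 -> Z) (X : T1 -> T2) :
  measurable_fun setT X -> strongly_measurable_pair z ->
  strongly_measurable_pair (z \o X).
Proof.
move=> mX [mz1 mz2]; split=> [j|].
  exact: (strongly_measurable_comp mX (mz1 j)).
exact: (strongly_measurable_comp mX mz2).
Qed.

End product_hilbert.

Section oracle.
Context {R : realType} {d m : nat} (cp : control_problem R d m) (H : rkhs R d).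
Variable M : R.
Local Notation rho := (cp_rho cp).
Local Notation q := (cp_q cp).
Local Notation f := (cp_f cp).
Local Notation a := (cp_a cp).
Local Notation B := (cp_B cp).
Local Notation mu0 := (cp_mu0 cp).
Local Notation Hm := {ffun 'I_m -> H}.
Local Notation Z := (Hm * H)%type.
Local Notation dot := (rk_dot H).
Local Notation K := (rk_sec H).
Hypotheses (kC2 : kernel_C2 H) (q1 : 1 < q) (M0 : 0 < M).
Implicit Types (V : H) (w : Hm) (x : 'rV[R]_d).

Let dotP := rk_inner H.
Let hmP := @hm_inner R d H m.

(** The element representing the derivative at [x] in the direction [v]. *)
Definition dir_sec x (v : 'rV[R]_d) : H := \sum_i v 0 i *: dsec H i x.

Lemma gradE V x : grad (rk_ev V) x = \row_i dot V (dsec H i x).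
Proof. by apply/rowP => i; rewrite !mxE partial_rk_ev. Qed.

Lemma dir_secE V x v : dot (dir_sec x v) V = dotv (grad (rk_ev V) x) v.
Proof.
rewrite /dir_sec (inner_suml dotP) gradE; apply: eq_bigr => i _.
by rewrite (innerZl dotP) mxE mulrC (innerC dotP).
Qed.

Lemma dotv_mulmx (u : 'rV[R]_d) (A : 'M[R]_(d, m)) (v : 'rV[R]_m) :
  dotv (u *m A) v = dotv u (v *m A^T).
Proof.
have tr n (y z : 'rV[R]_n) : dotv y z = (y *m z^T) 0 0.
  by rewrite mxE; apply: eq_bigr => i _; rewrite mxE.
by rewrite !tr trmx_mul trmxK mulmxA.
Qed.

(** Both parts of the derivative in [w] only see the value [w(x)], so that the
   subgradient is a multiple of the kernel section in each component. *)
Definition Pi_coef V w x : 'rV[R]_m :=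
  rho^-1 *: (grad (rk_ev V) x *m B x) + dS_alpha cp M (hm_ev w x) (beta_of cp V x).

Lemma hm_ev_dot (c : 'rV[R]_m) w x :
  hm_dot ([ffun j => c 0 j *: K x] : Hm) w = dotv c (hm_ev w x).
Proof.
apply: eq_bigr => j _; rewrite !ffunE (innerZl dotP) mxE rk_evE.
by rewrite (innerC dotP).
Qed.

Lemma PiE V w x : Pi cp M V w x = [ffun j => Pi_coef V w x 0 j *: K x].
Proof.
apply: (riesz_eq hmP) => h; rewrite hm_ev_dot /Pi_coef.
by rewrite (innerDl dotv_inner) (innerZl dotv_inner).
Qed.

Definition Delta_sec V w x : H :=
  mu0 x *: K x + rho^-1 *: dir_sec x (hm_ev w x *m (B x)^T)
  + dS_beta cp M (hm_ev w x) (beta_of cp V x) *: (rho^-1 *: dir_sec x (a x) - K x).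

Lemma DeltaE V w x : Delta cp M V w x = - Delta_sec V w x.
Proof.
apply: (riesz_eq dotP) => h.
rewrite (innerNl dotP) !(innerDl dotP) !(innerZl dotP) (innerDl dotP).
rewrite (innerNl dotP) (innerZl dotP) !dir_secE dotv_mulmx rk_evE.
by rewrite (innerC dotP (K x)); congr (- _); ring.
Qed.

(** * Convexity and concavity of the saddle function *)

Definition Psi_val V w x : R :=
  rk_ev V x * mu0 x + rho^-1 * dotv (grad (rk_ev V) x *m B x) (hm_ev w x)
  + S_val cp M (hm_ev w x) (beta_of cp V x).

Lemma PsiE V w x : Psi cp M V w x = (Psi_val V w x)%:E.
Proof. by rewrite /Psi S_ME// -EFinD. Qed.

Lemma hm_evB w w' x : hm_ev (w - w') x = hm_ev w x - hm_ev w' x.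
Proof.
by apply/rowP => j; rewrite !mxE !ffunE !rk_evE (innerBl dotP).
Qed.

Lemma gradB V V' x : grad (rk_ev (V - V')) x = grad (rk_ev V) x - grad (rk_ev V') x.
Proof. by rewrite !gradE; apply/rowP => i; rewrite !mxE (innerBl dotP). Qed.

Lemma Psi_subgradient V w w' x :
  Psi_val V w x + hm_dot (Pi cp M V w x) (w' - w) <= Psi_val V w' x.
Proof.
rewrite PiE hm_ev_dot hm_evB /Pi_coef (innerDl dotv_inner) (innerZl dotv_inner).
have := S_val_convex q1 M0 (hm_ev w x) (beta_of cp V x) (hm_ev w' x).
rewrite !(innerBr dotv_inner) /Psi_val.
move: (S_val _ _ (hm_ev w x) _) (S_val _ _ (hm_ev w' x) _).
move: (dotv (dS_alpha _ _ _ _) (hm_ev w x)) (dotv (dS_alpha _ _ _ _) (hm_ev w' x)).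
move: (dotv (_ *m _) (hm_ev w x)) (dotv (_ *m _) (hm_ev w' x)).
by move=> *; lra.
Qed.

Lemma Psi_supergradient V V' w x :
  Psi_val V' w x <= Psi_val V w x + dot (Delta cp M V w x) (V - V').
Proof.
rewrite DeltaE (innerNl dotP) !(innerDl dotP) !(innerZl dotP) (innerDl dotP).
rewrite (innerNl dotP) (innerZl dotP) !dir_secE -dotv_mulmx gradB.
rewrite !(innerBl dotv_inner) !(innerC dotP (K x)) -!rk_evE.
have := S_val_concave q1 M0 (hm_ev w x) (beta_of cp V x) (beta_of cp V' x).
set s := dS_beta _ _ _ _; rewrite /Psi_val.
set b' := beta_of cp V' x; set b := beta_of cp V x.
have -> : b' - b = rk_ev (V - V') x
    - rho^-1 * (dotv (grad (rk_ev V) x) (a x) - dotv (grad (rk_ev V') x) (a x)).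
  by rewrite /b /b' /beta_of !rk_evE (innerBl dotP); ring.
have -> : rk_ev V' x = rk_ev V x - rk_ev (V - V') x.
  by rewrite !rk_evE (innerBl dotP); ring.
rewrite mulmxBl (innerBl dotv_inner).
move: (S_val _ _ _ b) (S_val _ _ _ b') (rk_ev V x) (rk_ev (V - V') x) (mu0 x) s.
move: (dotv (grad (rk_ev V) x) (a x)) (dotv (grad (rk_ev V') x) (a x)).
move: (dotv (_ *m _) _) (dotv (_ *m _) _).
by move=> *; lra.
Qed.

(** The subgradients at the mean point give Jensen's inequality in both variables,
   and those at each [z k] linearise the gap between [z k] and [u]. *)
Lemma Psi_gap_mean n (z : nat -> Z) (u zm : Z) x : (0 < n)%N ->
  zm = n%:R^-1 *: \sum_(k < n) z k ->
  Psi_val u.2 zm.1 x - Psi_val zm.2 u.1 x <=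
  n%:R^-1 * \sum_(k < n) z_dot (Omega cp M (z k) x) (z k - u).
Proof.
move=> n0 zmE; have nr0 : 0 < n%:R :> R by rewrite ltr0n.
have sumz : \sum_(k < n) (z k - zm) = 0.
  rewrite zmE sumrB sumr_const card_ord -scaler_nat scalerA mulfV ?gt_eqF//.
  by rewrite scale1r subrr.
have sum1 : \sum_(k < n) ((z k).1 - zm.1) = 0.
  by have := congr1 fst sumz; rewrite (big_morph fst (fun _ _ => erefl) erefl).
have sum2 : \sum_(k < n) ((z k).2 - zm.2) = 0.
  by have := congr1 snd sumz; rewrite (big_morph snd (fun _ _ => erefl) erefl).
rewrite ler_pdivlMl//.
have pt k : Psi_val u.2 zm.1 x + hm_dot (Pi cp M u.2 zm.1 x) ((z k).1 - zm.1)
    - (Psi_val zm.2 u.1 x + dot (Delta cp M zm.2 u.1 x) (zm.2 - (z k).2)) <=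
    z_dot (Omega cp M (z k) x) (z k - u).
  have h1 := Psi_subgradient u.2 zm.1 (z k).1 x.
  have h2 := Psi_supergradient zm.2 (z k).2 u.1 x.
  have h3 := Psi_subgradient (z k).2 (z k).1 u.1 x.
  have h4 := Psi_supergradient (z k).2 u.2 (z k).1 x.
  rewrite /z_dot /Omega /=.
  rewrite -(opprB (z k).1 u.1) (innerNr hmP) in h3.
  move: h1 h2 h3 h4.
  move: (Psi_val u.2 zm.1 x) (Psi_val zm.2 u.1 x) (Psi_val _ _ x) (Psi_val _ _ x).
  move: (Psi_val (z k).2 (z k).1 x) (hm_dot _ _) (hm_dot _ _) (dot _ _) (dot _ _).
  by move=> *; lra.
have e1 : \sum_(k < n) hm_dot (Pi cp M u.2 zm.1 x) ((z k).1 - zm.1) = 0.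
  under eq_bigr do rewrite (innerC hmP).
  by rewrite -(inner_suml hmP) sum1 (inner0l hmP).
have e2 : \sum_(k < n) dot (Delta cp M zm.2 u.1 x) (zm.2 - (z k).2) = 0.
  under eq_bigr do rewrite (innerC dotP) -opprB (innerNl dotP).
  by rewrite sumrN -(inner_suml dotP) sum2 (inner0l dotP) oppr0.
have gen (p p' : R) (F G : 'I_n -> R) : \sum_k F k = 0 -> \sum_k G k = 0 ->
    \sum_k (p + F k - (p' + G k)) = n%:R * (p - p').
  move=> F0 G0; rewrite sumrB !big_split/= F0 G0 !sumr_const card_ord !addr0.
  by rewrite -mulrnBl mulr_natl.
rewrite -(gen _ _ _ _ e1 e2).
by apply: ler_sum => k _; exact: pt.
Qed.

End oracle.

(** * Linear growth and measurability of the oracle *)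

Section oracle_bounds.
Context {R : realType} {d m : nat} (cp : control_problem R d m) (H : rkhs R d).
Variable M : R.
Local Notation rho := (cp_rho cp).
Local Notation q := (cp_q cp).
Local Notation f := (cp_f cp).
Local Notation a := (cp_a cp).
Local Notation B := (cp_B cp).
Local Notation mu0 := (cp_mu0 cp).
Local Notation Hm := {ffun 'I_m -> H}.
Local Notation Z := (Hm * H)%type.
Local Notation dot := (rk_dot H).
Local Notation K := (rk_sec H).
Hypotheses (kC2 : kernel_C2 H) (q1 : 1 < q) (q2 : q <= 2) (M0 : 0 < M).
Hypotheses (fc : continuous f) (ft : torus_fun f) (ac : continuous a)
  (a_t : torus_fun a) (Bc : continuous B) (Bt : torus_fun B).
Hypotheses (mu0b : exists C : R, forall x, `|mu0 x| <= C)
  (mmu0 : measurable_fun [set: d.-tuple R] (mu0 \o pt)).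
Implicit Types (V : H) (w : Hm) (x : 'rV[R]_d).

Let dotP := rk_inner H.
Let hmP := @hm_inner R d H m.

Let bdd (E : normedModType R) (g : 'rV[R]_d -> E) :=
  exists2 C, 0 <= C & forall x, `|g x| <= C.

(** The shape of the bound on the oracle.  Its stability under sums and under
   products with bounded functions of [x] replaces an explicit constant. *)
Let grow (E : normedModType R) (F : H -> Hm -> 'rV[R]_d -> E) :=
  exists2 C, 0 <= C & forall V w x, `|F V w x| <= C * (1 + `|V| + hm_norm w).

Let size1 V w : 1 <= 1 + `|V| + hm_norm w.
Proof. by rewrite -addrA lerDl addr_ge0// inorm_ge0. Qed.

Let size0 V w : 0 <= 1 + `|V| + hm_norm w.
Proof. exact: le_trans (size1 V w). Qed.

Let grow_const (E : normedModType R) (F : H -> Hm -> 'rV[R]_d -> E) C : 0 <= C ->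
  (forall V w x, `|F V w x| <= C) -> grow F.
Proof.
move=> C0 FC; exists C => // V w x; apply: (le_trans (FC V w x)).
by rewrite ler_peMr.
Qed.

Let grow_bdd (E : normedModType R) (g : 'rV[R]_d -> E) :
  bdd g -> grow (fun _ _ => g).
Proof. by move=> [C C0 gC]; apply: (grow_const C0). Qed.

Let growD (E : normedModType R) (F G : H -> Hm -> 'rV[R]_d -> E) :
  grow F -> grow G -> grow (fun V w x => F V w x + G V w x).
Proof.
move=> [C C0 FC] [D D0 GD]; exists (C + D); first exact: addr_ge0.
move=> V w x; rewrite mulrDl; apply: (le_trans (ler_normD _ _)).
exact: lerD.
Qed.

Let growN (E : normedModType R) (F : H -> Hm -> 'rV[R]_d -> E) :
  grow F -> grow (fun V w x => - F V w x).
Proof. by move=> [C C0 FC]; exists C => // V w x; rewrite normrN. Qed.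

Let growZ (E : normedModType R) (F : H -> Hm -> 'rV[R]_d -> R) (e : 'rV[R]_d -> E) :
  grow F -> bdd e -> grow (fun V w x => F V w x *: e x).
Proof.
move=> [C C0 FC] [D D0 eD]; exists (C * D); first exact: mulr_ge0.
by move=> V w x; rewrite normrZ mulrAC; apply: ler_pM.
Qed.

Let growM (F : H -> Hm -> 'rV[R]_d -> R) (e : 'rV[R]_d -> R) :
  grow F -> bdd e -> grow (fun V w x => F V w x * e x).
Proof. by move=> gF be; exact: (growZ gF be). Qed.

Let grow_sum (E : normedModType R) n (F : 'I_n -> H -> Hm -> 'rV[R]_d -> E) :
  (forall i, grow (F i)) -> grow (fun V w x => \sum_i F i V w x).
Proof.
move=> gF; elim: (index_enum _) => [|i s IH].
  by apply: (@grow_const _ _ 0) => // V w x; rewrite big_nil normr0.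
have [C C0 h] := growD (gF i) IH.
by exists C => // V w x; rewrite big_cons; exact: h.
Qed.

Let grow_le (E E' : normedModType R) (F : H -> Hm -> 'rV[R]_d -> E)
    (G : H -> Hm -> 'rV[R]_d -> E') :
  (forall V w x, `|F V w x| <= `|G V w x|) -> grow G -> grow F.
Proof.
move=> FG [C C0 GC]; exists C => // V w x; exact: le_trans (FG V w x) (GC V w x).
Qed.

Let grow_norm (E : normedModType R) (F : H -> Hm -> 'rV[R]_d -> E) :
  grow F -> grow (fun V w x => `|F V w x|).
Proof. by apply: grow_le => V w x; rewrite normr_id. Qed.

Let bddK : bdd K.
Proof.
by apply: torus_norm_bounded; [exact: (rk_sec_continuous kC2)|exact: rk_sec_torus].
Qed.

Let bdd_dsec i : bdd (dsec H i).
Proof.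
by apply: torus_norm_bounded; [exact: (dsec_continuous kC2)|exact: dsec_torus].
Qed.

Let coord_bdd n p (A : 'rV[R]_d -> 'M[R]_(n, p)) i j :
  continuous A -> torus_fun A -> bdd (fun x => A x i j).
Proof.
move=> Ac At; apply: torus_norm_bounded; last first.
  exact: (torus_comp (fun u : 'M[R]_(n, p) => u i j) At).
move=> x; exact: (@continuous_comp _ _ _ A (fun u => u i j) x (Ac x)
  (@coord_continuous _ _ _ i j (A x))).
Qed.

Let bdd_mu0 : bdd mu0.
Proof.
have [C hC] := mu0b; exists (Num.max C 0); first by rewrite le_max lexx orbT.
by move=> x; apply: (le_trans (hC x)); rewrite le_max lexx.
Qed.

Let cauchy_schwarz (u v : H) : `|dot u v| <= `|u| * `|v|.
Proof.
by rewrite -!(inner_normE (@rk_norm _ _ H)); exact: (normr_inner_le dotP).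
Qed.

Let grow_dot (e : 'rV[R]_d -> H) : bdd e -> grow (fun V w x => dot V (e x)).
Proof.
move=> [C C0 eC]; exists C => // V w x; apply: (le_trans (cauchy_schwarz _ _)).
rewrite mulrC ler_pM//; have := @inorm_ge0 _ _ (@hm_dot R d H m) w.
rewrite -hm_normE; lra.
Qed.

Let grow_w j : grow (fun V w x => hm_ev w x 0 j).
Proof.
have [C C0 eC] := bddK; exists C => // V w x; rewrite mxE rk_evE.
apply: (le_trans (cauchy_schwarz _ _)); rewrite mulrC ler_pM//.
apply: (le_trans (normr_le_hm_norm w j)); have := normr_ge0 V; lra.
Qed.

Let enorm_le_sum n (u : 'rV[R]_n) : enorm u <= \sum_j `|u 0 j|.
Proof.
have S0 : 0 <= \sum_j `|u 0 j| by exact: sumr_ge0.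
rewrite enormE (inorm_le dotv_inner)//; apply: le_trans (sum_sqr_le _ _) => //.
rewrite /dotv le_eqVlt; apply/orP; left; apply/eqP; apply: eq_bigr => j _.
by rewrite real_normK ?num_real// expr2.
Qed.

Let grow_enorm n (u : H -> Hm -> 'rV[R]_d -> 'rV[R]_n) :
  (forall j, grow (fun V w x => u V w x 0 j)) -> grow (fun V w x => enorm (u V w x)).
Proof.
move=> gu; apply: (@grow_le _ _ _ (fun V w x => \sum_j `|u V w x 0 j|)).
  move=> V w x; rewrite !ger0_norm ?enorm_ge0 ?enorm_le_sum//.
  exact: sumr_ge0.
by apply: grow_sum => j; apply: grow_norm.
Qed.

Let coord_le_enorm n (u : 'rV[R]_n) j : `|u 0 j| <= enorm u.
Proof.
rewrite -(sqrtr_sqr (u 0 j)) /enorm /dotv ler_wsqrtr//.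
rewrite (bigD1 j)//= -expr2 lerDl; apply: sumr_ge0 => i _.
by rewrite -expr2 sqr_ge0.
Qed.

Let grow_grad i : grow (fun V w x => grad (rk_ev V) x 0 i).
Proof.
have [C C0 h] := grow_dot (bdd_dsec i); exists C => // V w x.
by rewrite (gradE kC2) mxE; exact: h.
Qed.

Let grow_beta : grow (fun V w x => beta_of cp V x).
Proof.
apply: growD; first apply: growD.
- by apply: grow_bdd; exact: torus_norm_bounded.
- apply: growN; have [C C0 h] := grow_dot bddK; exists C => // V w x.
  by rewrite rk_evE; exact: h.
have h : grow (fun V w x => dotv (grad (rk_ev V) x) (a x) * rho^-1).
  apply: growM; last by exists `|rho^-1|.
  by apply: grow_sum => i; apply: growM => //; exact: coord_bdd.
by apply: grow_le h => V w x; rewrite mulrC.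
Qed.

Let grow_dS j : grow (fun V w x => dS_alpha cp M (hm_ev w x) (beta_of cp V x) 0 j).
Proof.
pose kap := (q - 1) / q.
have h : grow (fun V w x => 2 + enorm (hm_ev w x) * M^-1
    + `|beta_of cp V x| * kap^-1).
  apply: growD; last by apply: growM; [exact: grow_norm|exists `|kap^-1|].
  apply: growD; first by apply: (@grow_const _ _ 2) => // *; rewrite ger0_norm.
  by apply: growM; [exact: grow_enorm|exists `|M^-1|].
apply: grow_le h => V w x; apply: (le_trans (coord_le_enorm _ _)).
by apply: le_trans (ler_norm _); exact: enorm_dS_alpha_le.
Qed.

Let grow_Pi_coef j : grow (fun V w x => Pi_coef cp M V w x 0 j).
Proof.
have h : grow (fun V w x => (grad (rk_ev V) x *m B x) 0 j * rho^-1
    + dS_alpha cp M (hm_ev w x) (beta_of cp V x) 0 j).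
  apply: growD => //; apply: growM; last by exists `|rho^-1|.
  have g : grow (fun V w x => \sum_i grad (rk_ev V) x 0 i * B x i j).
    by apply: grow_sum => i; apply: growM => //; exact: coord_bdd.
  by apply: grow_le g => V w x; rewrite mxE.
by apply: grow_le h => V w x; rewrite !mxE [rho^-1 * _]mulrC.
Qed.

Let grow_Pi : grow (fun V w x => hm_norm (Pi cp M V w x)).
Proof.
have h : grow (fun V w x => \sum_j `|Pi_coef cp M V w x 0 j *: K x|).
  by apply: grow_sum => j; apply: grow_norm; apply: growZ.
apply: grow_le h => V w x; rewrite !ger0_norm ?inorm_ge0 ?sumr_ge0//.
rewrite PiE//; apply: (le_trans (hm_norm_le_sum _)).
by apply: ler_sum => j _; rewrite ffunE.
Qed.

Let bdd_grow (E : normedModType R) (g : 'rV[R]_d -> E) :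
  grow (fun _ _ => g) -> bdd g.
Proof.
move=> [C C0 gC]; exists (C * (1 + `|0 : H| + hm_norm (0 : Hm))).
  by rewrite mulr_ge0.
by move=> x; exact: gC.
Qed.

Let grow_dir (u : H -> Hm -> 'rV[R]_d -> 'rV[R]_d) :
  (forall i, grow (fun V w x => u V w x 0 i)) ->
  grow (fun V w x => rho^-1 *: dir_sec H x (u V w x)).
Proof.
move=> gu.
have h : grow (fun V w x => \sum_i (u V w x 0 i * rho^-1) *: dsec H i x).
  apply: grow_sum => i; apply: growZ => //; apply: growM => //.
  by exists `|rho^-1|.
apply: grow_le h => V w x; rewrite /dir_sec scaler_sumr.
by under eq_bigr do rewrite scalerA [rho^-1 * _]mulrC.
Qed.

Let grow_Delta : grow (fun V w x => Delta cp M V w x).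
Proof.
have h : grow (fun V w x => Delta_sec cp M V w x).
  apply: growD; first apply: growD.
  - by apply: (growZ (F := fun _ _ => mu0)) => //; exact: grow_bdd.
  - apply: grow_dir => i.
    have g : grow (fun V w x => \sum_j hm_ev w x 0 j * B x i j).
      by apply: grow_sum => j; apply: growM => //; exact: coord_bdd.
    apply: grow_le g => V w x; rewrite mxE.
    by under eq_bigr => j _ do rewrite [X in _ * X]mxE.
  - apply: growZ.
      apply: (@grow_const _ _ M) => [|V w x]; first exact: ltW.
      have /andP[s0 sM] := dS_beta_bound q1 M0 (hm_ev w x) (beta_of cp V x).
      by rewrite ger0_norm.
    apply: bdd_grow; apply: growD; last by apply: growN; exact: grow_bdd.
    apply: (grow_dir (u := fun _ _ => a)) => i.
    by apply: (grow_bdd (g := fun x => a x 0 i)); exact: coord_bdd.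
by apply: grow_le h => V w x; rewrite DeltaE// normrN.
Qed.

Lemma bounds_Omega_exist : exists c : R, 0 < c /\ bounds_Omega cp H M c.
Proof.
have [C C0 hC] := grow_Pi; have [D D0 hD] := grow_Delta.
exists (C + D + 1); split=> [|rV rw V w x rV0 rw0 Vr wr].
  by rewrite ltr_wpDl// addr_ge0.
have s : 1 + `|V| + hm_norm w <= 1 + rV + rw by rewrite !lerD.
have s0 := size0 V w.
split.
  apply: (le_trans (ler_norm _)); apply: (le_trans (hC V w x)).
  by apply: ler_pM => //; lra.
by apply: (le_trans (hD V w x)); apply: ler_pM => //; lra.
Qed.

Lemma Psi_val_bounded V w : exists C : R, forall x, `|Psi_val cp M V w x| <= C.
Proof.
have fixVw (F : H -> Hm -> 'rV[R]_d -> R) : grow F -> bdd (F V w).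
  move=> [C C0 h]; exists (C * (1 + `|V| + hm_norm w)); first exact: mulr_ge0.
  by move=> x; exact: h.
have bddM (g h : 'rV[R]_d -> R) : bdd g -> bdd h -> bdd (fun x => g x * h x).
  move=> bg bh; apply: bdd_grow; apply: growM => //; exact: grow_bdd.
have bddD (g h : 'rV[R]_d -> R) : bdd g -> bdd h -> bdd (fun x => g x + h x).
  by move=> bg bh; apply: bdd_grow; apply: growD; exact: grow_bdd.
suff [C C0 h] : bdd (Psi_val cp M V w) by exists C.
apply: (bddD _ _); first apply: (bddD _ _).
- apply: (bddM _ _) => //; apply: (fixVw (fun V w x => rk_ev V x)).
  have [C C0 h] := grow_dot bddK; exists C => // V' w' x.
  by rewrite rk_evE; exact: h.
- apply: (bddM _ _); first by exists `|rho^-1|.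
  apply: bdd_grow; apply: grow_sum => j; apply: grow_bdd; apply: (bddM _ _).
    have g : grow (fun V w x => \sum_i grad (rk_ev V) x 0 i * B x i j).
      by apply: grow_sum => i; apply: growM => //; exact: coord_bdd.
    by apply: (fixVw (fun V w x => (grad (rk_ev V) x *m B x) 0 j));
      apply: grow_le g => V' w' x; rewrite mxE.
  exact: (fixVw (fun V w x => hm_ev w x 0 j)).
have [b b0 hb] := fixVw _ grow_beta; have [n n0 hn] := fixVw _ (grow_enorm grow_w).
have q0 : 0 <= q by exact: ltW (lt_trans ltr01 q1).
exists (b * M + M * ((n / M) `^ q / q)).
  by apply: addr_ge0; apply: mulr_ge0; rewrite ?(ltW M0)// divr_ge0 ?powR_ge0.
move=> x; apply: (le_trans (S_val_bound q1 M0 _ _)); apply: lerD.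
  by rewrite ler_wpM2r ?(ltW M0).
rewrite ler_wpM2l ?(ltW M0)// ler_wpM2r ?invr_ge0//.
apply: ge0_ler_powR; rewrite ?nnegrE ?divr_ge0 ?enorm_ge0 ?(ltW M0)//.
rewrite ler_wpM2r ?invr_ge0 ?(ltW M0)//.
by apply: le_trans (hn x); exact: ler_norm.
Qed.

Section measurable_oracle.
Context dT (T : measurableType dT) (X : T -> d.-tuple R) (z : T -> Z).
Hypotheses (mX : measurable_fun setT X) (mz : strongly_measurable_pair z).

Let mXi i : measurable_fun setT (fun t => pt (X t) 0 i).
Proof. exact: (measurableT_comp (measurable_pt i) mX). Qed.

Let mcont (g : 'rV[R]_d -> R) : continuous g -> measurable_fun setT (fun t => g (pt (X t))).
Proof. by move=> gc; apply: (measurable_continuous gc). Qed.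

Let mcoord n p (A : 'rV[R]_d -> 'M[R]_(n, p)) i j : continuous A ->
  measurable_fun setT (fun t => A (pt (X t)) i j).
Proof.
move=> Ac; apply: (mcont (g := fun x => A x i j)) => x.
exact: (@continuous_comp _ _ _ A (fun u => u i j) x (Ac x)
  (@coord_continuous _ _ _ i j (A x))).
Qed.

Let mmu : measurable_fun setT (fun t => mu0 (pt (X t))).
Proof. exact: (measurableT_comp mmu0 mX). Qed.

Let mK : strongly_measurable (fun t => K (pt (X t))).
Proof. exact: (strongly_measurable_continuous (X := pt \o X) (rk_sec_continuous kC2) mXi). Qed.

Let mdsec i : strongly_measurable (fun t => dsec H i (pt (X t))).
Proof. exact: (strongly_measurable_continuous (X := pt \o X) (dsec_continuous kC2 (i := i)) mXi). Qed.

Let mdot (u v : T -> H) : strongly_measurable u -> strongly_measurable v ->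
  measurable_fun setT (fun t => dot (u t) (v t)).
Proof. exact: (measurable_inner dotP (@rk_norm _ _ H)). Qed.

Let mw j : measurable_fun setT (fun t => hm_ev (z t).1 (pt (X t)) 0 j).
Proof.
under eq_fun do rewrite mxE rk_evE.
by apply: mdot => //; have [mz1 _] := mz; exact: mz1.
Qed.

Let mev : measurable_fun setT (fun t => rk_ev (z t).2 (pt (X t))).
Proof. under eq_fun do rewrite rk_evE; apply: mdot => //; exact: mz.2. Qed.

Let mgrad i : measurable_fun setT (fun t => grad (rk_ev (z t).2) (pt (X t)) 0 i).
Proof.
under eq_fun do rewrite (gradE kC2) mxE.
by apply: mdot => //; exact: mz.2.
Qed.

Let mbeta : measurable_fun setT (fun t => beta_of cp (z t).2 (pt (X t))).
Proof.
apply: measurable_funD; first by apply: measurable_funB => //; exact: mcont.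
apply: measurable_funM; first exact: measurable_cst.
by apply: measurable_sum => i; apply: measurable_funM => //; exact: mcoord.
Qed.

Let mgradB j : measurable_fun setT
  (fun t => (grad (rk_ev (z t).2) (pt (X t)) *m B (pt (X t))) 0 j).
Proof.
under eq_fun do rewrite mxE.
by apply: measurable_sum => i; apply: measurable_funM => //; exact: mcoord.
Qed.

Let mdir (u : T -> 'rV[R]_d) : (forall i, measurable_fun setT (fun t => u t 0 i)) ->
  strongly_measurable (fun t => rho^-1 *: dir_sec H (pt (X t)) (u t)).
Proof.
move=> mu; apply: strongly_measurableZ; first exact: measurable_cst.
by apply: strongly_measurable_sum => i; exact: strongly_measurableZ.
Qed.

Lemma strongly_measurable_Omega :
  strongly_measurable_pair (fun t => Omega cp M (z t) (pt (X t))).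
Proof.
split=> [j|] /=.
  under eq_fun do rewrite PiE ffunE.
  apply: strongly_measurableZ => //; under eq_fun do rewrite !mxE.
  apply: measurable_funD; last exact: measurable_dS_alpha.
  apply: measurable_funM; first exact: measurable_cst.
  by have := mgradB j; under eq_fun do rewrite mxE.
under eq_fun do rewrite DeltaE//.
apply: strongly_measurableN; apply: strongly_measurableD.
  apply: strongly_measurableD; first exact: strongly_measurableZ.
  apply: mdir => i; under eq_fun do rewrite mxE.
  apply: measurable_sum => j; apply: measurable_funM => //.
  under eq_fun do rewrite mxE.
  exact: mcoord.
apply: strongly_measurableZ; first exact: measurable_dS_beta.
apply: strongly_measurableD; last exact: strongly_measurableN.
by apply: mdir => i; exact: mcoord.
Qed.

Lemma measurable_Psi_val :
  measurable_fun setT (fun t => Psi_val cp M (z t).2 (z t).1 (pt (X t))).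
Proof.
apply: measurable_funD; last exact: measurable_S_val.
apply: measurable_funD; first exact: measurable_funM.
apply: measurable_funM; first exact: measurable_cst.
by apply: measurable_sum => j; exact: measurable_funM.
Qed.

End measurable_oracle.

End oracle_bounds.

(** * Bounded random variables and independence *)

Section bounded_integrals.
Context {R : realType} d (T : measurableType d) (P : probability T R).
Implicit Types f g : T -> R.

Definition bounded_measurable f :=
  measurable_fun setT f /\ exists C : R, forall t, `|f t| <= C.

Lemma bounded_measurable_integrable f :
  bounded_measurable f -> P.-integrable setT (EFin \o f).
Proof.
move=> [mf [C fC]]; apply: measurable_bounded_integrable => //.
  by apply: (le_lt_trans (probability_le1 P measurableT)); rewrite ltry.
exists C; split; first by rewrite num_real.
by move=> x Cx t _ /=; apply: (le_trans (fC t)); exact: ltW.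
Qed.

Lemma bounded_measurable_cst (c : R) : bounded_measurable (fun=> c).
Proof. by split; [exact: measurable_cst|exists `|c|]. Qed.

Lemma bounded_measurableD f g : bounded_measurable f -> bounded_measurable g ->
  bounded_measurable (fun t => f t + g t).
Proof.
move=> [mf [C fC]] [mg [D gD]]; split; first exact: measurable_funD.
by exists (C + D) => t; apply: (le_trans (ler_normD _ _)); exact: lerD.
Qed.

Lemma bounded_measurableZ (c : R) f :
  bounded_measurable f -> bounded_measurable (fun t => c * f t).
Proof.
move=> [mf [C fC]]; split.
  by apply: measurable_funM => //; exact: measurable_cst.
by exists (`|c| * C) => t; rewrite normrM ler_wpM2l.
Qed.

Lemma bounded_measurableB f g : bounded_measurable f -> bounded_measurable g ->
  bounded_measurable (fun t => f t - g t).
Proof.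
move=> bf bg; under eq_fun do rewrite -mulN1r.
by apply: bounded_measurableD => //; exact: bounded_measurableZ.
Qed.

Lemma bounded_measurable_sum I (s : seq I) (F : I -> T -> R) :
  (forall i, bounded_measurable (F i)) ->
  bounded_measurable (fun t => \sum_(i <- s) F i t).
Proof.
move=> bF; elim: s => [|i s IH].
  by under eq_fun do rewrite big_nil; exact: bounded_measurable_cst.
by under eq_fun do rewrite big_cons; exact: bounded_measurableD.
Qed.

Definition mean f : R := \int[P]_t f t.

Lemma meanE f : bounded_measurable f -> (\int[P]_t (f t)%:E)%E = (mean f)%:E.
Proof.
move=> /bounded_measurable_integrable h.
by rewrite /mean /Rintegral fineK//; exact: integrable_fin_num.
Qed.

Lemma mean_cst (c : R) : mean (fun=> c) = c.
Proof.
have PT : fine (P setT) = 1 by rewrite (probability_setT P).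
by rewrite /mean -[fun=> c]/(cst c) Rintegral_cst// PT mulr1.
Qed.

Lemma meanD f g : bounded_measurable f -> bounded_measurable g ->
  mean (fun t => f t + g t) = mean f + mean g.
Proof. by move=> bf bg; apply: RintegralD => //; exact: bounded_measurable_integrable. Qed.

Lemma meanB f g : bounded_measurable f -> bounded_measurable g ->
  mean (fun t => f t - g t) = mean f - mean g.
Proof. by move=> bf bg; apply: RintegralB => //; exact: bounded_measurable_integrable. Qed.

Lemma meanZ (c : R) f : bounded_measurable f -> mean (fun t => c * f t) = c * mean f.
Proof. by move=> bf; apply: RintegralZl => //; exact: bounded_measurable_integrable. Qed.

Lemma mean_sum I (s : seq I) (F : I -> T -> R) :
  (forall i, bounded_measurable (F i)) ->
  mean (fun t => \sum_(i <- s) F i t) = \sum_(i <- s) mean (F i).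
Proof.
move=> bF; elim: s => [|i s IH].
  by under eq_fun do rewrite big_nil; rewrite big_nil mean_cst.
under eq_fun do rewrite big_cons; rewrite big_cons meanD ?IH//.
exact: bounded_measurable_sum.
Qed.

Lemma le_mean f g : bounded_measurable f -> bounded_measurable g ->
  (forall t, f t <= g t) -> mean f <= mean g.
Proof. by move=> bf bg fg; apply: le_Rintegral => //; exact: bounded_measurable_integrable. Qed.

Lemma eq_mean f g : (forall t, f t = g t) -> mean f = mean g.
Proof. by move=> fg; congr mean; apply/funext. Qed.

(** The integral of a nonnegative function is a supremum over the simple functions
   below it, measurable or not.  The duality gap, a supremum over a ball of a
   Hilbert space, is bounded in this way without proving it measurable. *)
Lemma integral_le_mean (F : T -> \bar R) f : (forall t, 0 <= F t)%E ->
  bounded_measurable f -> (forall t, (F t <= (f t)%:E)%E) ->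
  (\int[P]_t F t <= (mean f)%:E)%E.
Proof.
move=> F0 bf Ff; rewrite -meanE//.
have f0 t : (0 <= (f t)%:E)%E by exact: le_trans (F0 t) (Ff t).
rewrite !ge0_integralTE//; apply: le_ereal_sup => _ [h hF <-].
by exists h => // t; apply: (le_trans (hF t)); exact: Ff.
Qed.

End bounded_integrals.

Lemma bounded_measurable_comp {R : realType} d1 (T1 : measurableType d1) d2
    (T2 : measurableType d2) (f : T2 -> R) (X : T1 -> T2) :
  measurable_fun setT X -> bounded_measurable f -> bounded_measurable (f \o X).
Proof.
move=> mX [mf [C fC]]; split; last by exists C => t; exact: fC.
exact: (measurableT_comp mf mX).
Qed.

Section parameter_integral.
Context {R : realType} d1 d2 (T1 : measurableType d1) (T2 : measurableType d2)
  (P : probability T2 R).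

Lemma bounded_measurable_section (f : T1 * T2 -> R) t :
  bounded_measurable f -> bounded_measurable (fun s => f (t, s)).
Proof.
move=> [mf [C fC]]; split; last by exists C.
exact: (measurableT_comp mf (pair1_measurable t)).
Qed.

(** Adding the bound makes the integrand nonnegative, where Tonelli's theorem gives
   the measurability in the parameter. *)
Lemma bounded_measurable_mean (f : T1 * T2 -> R) : bounded_measurable f ->
  bounded_measurable (fun t => mean P (fun s => f (t, s))).
Proof.
move=> bf; have [mf [C fC]] := bf; split.
  have mE : measurable_fun setT (fun t => (\int[P]_s (f (t, s) + C)%:E)%E).
    apply: (measurable_fun_fubini_tonelli_F (m2 := P)
      (fun u => (f u + C)%:E)) => [|u].
      by apply/measurable_EFinP; apply: measurable_funD => //; exact: measurable_cst.
    by rewrite lee_fin; have := fC u; rewrite ler_norml => /andP[]; lra.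
  have e : (fun t => (\int[P]_s (f (t, s) + C)%:E)%E) =
      EFin \o (fun t => mean P (fun s => f (t, s)) + C).
    apply/funext => t; have bt := bounded_measurable_section t bf.
    rewrite (meanE P (bounded_measurableD bt (bounded_measurable_cst _ C))).
    by rewrite meanD ?mean_cst//; exact: bounded_measurable_cst.
  move: mE; rewrite e => /measurable_EFinP mE.
  have -> : (fun t => mean P (fun s => f (t, s))) =
      (fun t => mean P (fun s => f (t, s)) + C - C).
    by apply/funext => t; rewrite addrK.
  by apply: measurable_funB => //; exact: measurable_cst.
exists C => t; have bt := bounded_measurable_section t bf.
rewrite ler_norml -[X in - X](mean_cst P) -[X in _ && (_ <= X)](mean_cst P).
rewrite -mulN1r -meanZ; last exact: bounded_measurable_cst.
apply/andP; split; apply: le_mean => //; try exact: bounded_measurable_cst.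
- by move=> s; have := fC (t, s); rewrite ler_norml mulN1r => /andP[].
- by move=> s; have := fC (t, s); rewrite ler_norml => /andP[].
Qed.

End parameter_integral.

Section decoupling.
Context {R : realType} d d' dT (O : measurableType d) (O' : measurableType d')
  (T : measurableType dT) (P : probability O R) (mu : probability T R).

(** Fubini's theorem for the joint law of an independent pair. *)
Lemma mean_decoupling (Y : O -> O') (X : O -> T) (phi : O' * T -> R) :
  measurable_fun setT Y -> measurable_fun setT X ->
  (forall A B, measurable A -> measurable B ->
    P (Y @^-1` A `&` X @^-1` B) = (P (Y @^-1` A) * mu B)%E) ->
  bounded_measurable phi ->
  mean P (fun o => phi (Y o, X o)) =
  mean P (fun o => mean mu (fun s => phi (Y o, s))).
Proof.
move=> mY mX YX bphi.
pose Y' : {mfun O >-> O'} := mfun_Sub (mem_set mY).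
have mYX : measurable_fun setT (fun o => (Y o, X o)).
  exact/measurable_fun_pair.
pose YX' : {mfun O >-> (O' * T)%type} := mfun_Sub (mem_set mYX).
pose nu := distribution P Y'; pose joint := distribution P YX'.
have prodE A : measurable A -> (nu \x mu)%E A = joint A.
  apply: product_measure_unique => B C mB mC; rewrite -YX//.
have bY : bounded_measurable (fun o => mean mu (fun s => phi (Y o, s))).
  exact: (bounded_measurable_comp mY (bounded_measurable_mean mu bphi)).
have bXY : bounded_measurable (fun o => phi (Y o, X o)).
  exact: (bounded_measurable_comp mYX bphi).
apply: EFin_inj; rewrite -!meanE//.
transitivity (\int[joint]_u (phi u)%:E)%E.
  rewrite /joint integral_distribution//; last first.
    exact: bounded_measurable_integrable.
  by apply/measurable_EFinP; have [] := bphi.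
transitivity (\int[nu \x mu]_u (phi u)%:E)%E.
  by apply: eq_measure_integral => A mA _; exact/esym/prodE.
rewrite -integral12_prod_meas1; last first.
  exact: bounded_measurable_integrable.
rewrite /fubini_F; transitivity (\int[nu]_y (mean mu (fun s => phi (y, s)))%:E)%E.
  apply: eq_integral => y _; rewrite meanE//; exact: bounded_measurable_section.
rewrite /nu integral_distribution//; last first.
  exact: bounded_measurable_integrable.
by apply/measurable_EFinP; have [] := bounded_measurable_mean mu bphi.
Qed.

End decoupling.

Section history.
Context {R : realType} d dT (O : measurableType d) (T : measurableType dT)
  (P : probability O R) (mu : probability T R) (I : eqType)
  (X : I -> {RV P >-> T}).
Hypotheses (Xmu : forall i A, measurable A -> distribution P (X i) A = mu A)
  (indep : mutually_independent X).

(** The sample space itself, with the sigma-algebra generated by the variables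
   indexed by [s], plays the role of the history: the law of the identity with
   values in it is the restriction of [P]. *)
Definition cylinders (s : seq I) : set (set O) :=
  [set C | exists2 A : I -> set T, (forall i, measurable (A i)) &
    C = \bigcap_(i in [set` s]) (X i @^-1` A i)].

Definition history (s : seq I) := g_sigma_algebraType (cylinders s).

Lemma cylinders_measurable s C : cylinders s C -> measurable C.
Proof.
move=> [A mA ->]; apply: fin_bigcap_measurable; first exact: finite_seq.
by move=> i _; rewrite -[X in measurable X]setTI; exact: measurable_funP.
Qed.

Lemma history_id s : measurable_fun [set: O] (id : O -> history s).
Proof.
move=> _ B mB; rewrite setTI preimage_id.
apply: (@smallest_sub _ (sigma_algebra setT) (cylinders s) measurable) mB => //.
  exact: sigma_algebra_measurable.
exact: cylinders_measurable.
Qed.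

Lemma history_measurable s i : i \in s ->
  measurable_fun [set: history s] (X i : history s -> T).
Proof.
move=> si _ B mB; rewrite setTI; apply: sub_sigma_algebra.
exists (fun j => if j == i then B else setT).
  by move=> j; case: ifP.
apply/seteqP; split=> o /=; first by move=> Bo j _ /=; case: eqP => [->|].
by move=> /(_ i si) /=; rewrite eqxx.
Qed.

(** As functions of [A] both sides are finite measures, and they agree on the
   cylinders, which are stable under intersection. *)
Lemma history_independent s i A B : uniq (i :: s) ->
  measurable (A : set (history s)) -> measurable B ->
  P (A `&` X i @^-1` B) = (P A * mu B)%E.
Proof.
move=> /[dup] us /andP[is_ uns] mA mB.
have mXB : measurable (X i @^-1` B).
  by rewrite -[X in measurable X]setTI; exact: measurable_funP.
have muB0 : 0 <= fine (mu B) by rewrite fine_ge0// measure_ge0.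
have muBE : mu B = (fine (mu B))%:E by rewrite fineK// fin_num_measure.
have XB : P (X i @^-1` B) = mu B by rewrite -(Xmu i mB).
pose scaled := mscale (NngNum muB0) P; pose restr := mrestr P mXB.
have sE C : scaled C = (mu B * P C)%E by rewrite muBE.
have rE C : restr C = P (C `&` X i @^-1` B) by [].
rewrite muleC -sE -rE -[RHS]/((scaled : measure _ _) A) -[LHS]/((restr : measure _ _) A).
symmetry; apply: (g_sigma_algebra_measure_unique (cylinders s) _ (fun=> setT)) mA.
- exact: cylinders_measurable.
- move=> _; exists (fun=> setT) => //.
  by apply/seteqP; split=> o.
- by apply/seteqP; split=> o // _; exists 0%N.
- move=> _ _ [A1 mA1 ->] [A2 mA2 ->].
  exists (fun j => A1 j `&` A2 j); first by move=> j; exact: measurableI.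
  apply/seteqP; split=> o /=.
    by move=> [h1 h2] j sj; split; [exact: h1|exact: h2].
  by move=> h; split=> j sj; case: (h j sj).
- move=> _ [A' mA' ->]; set C := \bigcap_(j in _) _.
  rewrite -[LHS]/(scaled C) -[RHS]/(restr C) sE rE /C -XB.
  pose A'' j := if j == i then B else A' j.
  have mA'' j : measurable (A'' j) by rewrite /A''; case: ifP.
  have := indep us mA''; rewrite big_cons {2}/A'' eqxx (indep uns mA') => e.
  transitivity (P (\bigcap_(j in [set` i :: s]) (X j @^-1` A'' j))).
    rewrite e; congr (_ * _)%E; apply: eq_big_seq => j js; rewrite /A''.
    by case: eqP js is_ => // -> ->.
  congr (P _); apply/seteqP; split=> o /=.
    move=> h; split=> [j /= js|]; last first.
      by have := h i (mem_head _ _); rewrite /= /A'' eqxx.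
    have /= := h j; rewrite inE js orbT /A'' => /(_ isT).
    by case: eqP js is_ => // -> ->.
  move=> [h Bo] j /=; rewrite inE /A''; case: eqP => [-> //|_ /= js].
  exact: h.
- by move=> _; rewrite -[X in (X < _)%E]/(scaled setT) sE probability_setT mule1 muBE ltry.
Qed.

(** Averaging over a fresh variable, given the history. *)
Lemma mean_history s i (phi : history s * T -> R) : uniq (i :: s) ->
  bounded_measurable phi ->
  mean P (fun o => phi (o, X i o)) = mean P (fun o => mean mu (fun t => phi (o, t))).
Proof.
move=> us bphi; apply: (mean_decoupling (@history_id s)) => //.
move=> A B mA mB; exact: (history_independent us mA mB).
Qed.

End history.

(** * Pathwise analysis of mirror-prox *)

Section regret.
Context {R : realType} {E : lmodType R} (b : E -> E -> R).
Hypothesis bP : inner_form b.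

(** Telescoping the extragradient steps from the second iteration on.  The first
   one starts from an arbitrary point, so that its contribution is bounded
   separately, by [A]. *)
Lemma extragradient_regret (C : E -> Prop) (zeta z g h : nat -> E)
    (gamma G2 D2 A : R) u n :
  0 < gamma -> C u ->
  (forall k v, C v -> b (zeta k - gamma *: h k - z k) (v - z k) <= 0) ->
  (forall k v, C v ->
    b (zeta k - gamma *: g k - zeta k.+1) (v - zeta k.+1) <= 0) ->
  (forall k, C (zeta k.+1)) ->
  (forall k, b (g k) (g k) <= G2) -> (forall k, b (h k.+1) (h k.+1) <= G2) ->
  b (zeta 1%N - u) (zeta 1%N - u) <= D2 -> b (g 0%N) (z 0%N - u) <= A ->
  \sum_(k < n.+1) b (g k) (z k - u) <=
    A + D2 / (2 * gamma) + n%:R * (3 / 2 * gamma * G2).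
Proof.
move=> gam0 Cu vz vzeta Czeta gG hG D2u first_le.
have step k : 2 * gamma * b (g k.+1) (z k.+1 - u) <=
    b (zeta k.+1 - u) (zeta k.+1 - u) - b (zeta k.+2 - u) (zeta k.+2 - u)
    + 3 * (gamma ^+ 2 * G2).
  have := extragradient_step bP (vz _ _ (Czeta k)) (vzeta _ _ Cu).
  rewrite !(innerZl bP) !(innerZr bP) => e.
  have g2 : 0 <= gamma ^+ 2 by rewrite sqr_ge0.
  have := ler_wpM2l g2 (gG k.+1); have := ler_wpM2l g2 (hG k).
  rewrite !mulrA -expr2 in e; rewrite mulrA; move: e.
  move: (b _ _) (b _ _) (b (h _) (h _)) (b (g _) (g _)) (b (g _) (z _ - u)).
  by move=> *; lra.
have sum_le : 2 * gamma * \sum_(k < n.+1) b (g k) (z k - u) <=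
    2 * gamma * A + (D2 - b (zeta n.+1 - u) (zeta n.+1 - u))
    + n%:R * (3 * (gamma ^+ 2 * G2)).
  elim: n => [|n IH].
    rewrite big_ord_recl big_ord0 addr0 mul0r addr0.
    apply: (@le_trans _ _ (2 * gamma * A)); last by rewrite lerDl subr_ge0.
    by rewrite ler_pM2l// mulr_gt0.
  rewrite big_ord_recr/= -[n.+1%:R]natr1.
  have := step n; move: IH.
  move: (b _ _) (b (zeta n.+1 - u) _) (b (g _) _) (\sum_(i < _) _).
  by move=> *; lra.
have l0 := inner_ge0 bP (zeta n.+1 - u).
rewrite -(ler_pM2l (x := 2 * gamma)) ?mulr_gt0//; apply: (le_trans sum_le).
have -> : 2 * gamma * (A + D2 / (2 * gamma) + n%:R * (3 / 2 * gamma * G2)) =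
    2 * gamma * A + D2 + n%:R * (3 * (gamma ^+ 2 * G2)).
  by field; rewrite gt_eqF.
by rewrite lerD2r lerD2l gerBl.
Qed.

(** The supremum over [u] of the accumulated noise is traded for the energy of
   the noise, whose cross terms are linear in each fresh increment. *)
Lemma noise_le (N : nat -> E) (B2 lam : R) u n : 0 < lam ->
  (forall k, b (N k) (N k) <= B2) ->
  - b (\sum_(k < n) N k) u <= lam / 2 * b u u + (2 * lam)^-1 * (n%:R * B2)
    + \sum_(k < n) b (N k) (lam^-1 *: \sum_(j < k) N j).
Proof.
move=> lam0 NB.
have energy : b (\sum_(k < n) N k) (\sum_(k < n) N k) <=
    n%:R * B2 + 2 * \sum_(k < n) b (N k) (\sum_(j < k) N j).
  elim: n => [|n IH]; first by rewrite !big_ord0 (inner0l bP) mul0r mulr0 addr0.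
  rewrite !big_ord_recr/= (inner_sqrD bP) -[n.+1%:R]natr1.
  have := NB n; move: IH; rewrite (innerC bP (N n)).
  move: (b _ _) (\sum_(i < n) b _ _) (b (\sum_(i < n) N i) (N n)) (b (N n) (N n)).
  by move=> *; lra.
rewrite -(innerNr bP) (innerC bP).
have := inner_young bP (- u) (\sum_(k < n) N k) lam0.
have -> : b (- u) (- u) = b u u by rewrite (innerNl bP) (innerNr bP) opprK.
move=> y.
apply: (le_trans y); rewrite -addrA lerD2l.
under [X in _ <= _ + X]eq_bigr do rewrite (innerZr bP).
rewrite -mulr_sumr.
have l0 : 0 <= (2 * lam)^-1 by rewrite invr_ge0 mulr_ge0 ?(ltW lam0).
apply: (le_trans (ler_wpM2l l0 energy)); rewrite mulrDr lerD2l.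
rewrite le_eqVlt; apply/orP; left; apply/eqP; field.
by rewrite gt_eqF.
Qed.

End regret.

Section prox.
Context {R : realType} {d : nat} (H : rkhs R d) (m : nat).
Local Notation Hm := {ffun 'I_m -> H}.
Local Notation Z := (Hm * H)%type.
Local Notation dot := (rk_dot H).

Let dotP := rk_inner H.
Let hmP := @hm_inner R d H m.
Let zP := @z_inner R d H m.

Lemma Zball_norm r (z : Z) : 0 <= r -> Zball r z -> z_dot z z <= 2 * r ^+ 2.
Proof.
move=> r0 [w v]; rewrite /z_dot; rewrite hm_normE (inorm_le hmP)// in w.
rewrite -(inner_normE (@rk_norm _ _ H)) (inorm_le dotP)// in v.
by move: (hm_dot _ _) (dot _ _) w v => p p' h h'; lra.
Qed.

Lemma Zball_dist r (z z' : Z) : 0 <= r -> Zball r z -> Zball r z' ->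
  z_dot (z - z') (z - z') <= 8 * r ^+ 2.
Proof.
move=> r0 [w v] [w' v']; suff : z_dot (z - z') (z - z') <= 2 * (2 * r) ^+ 2.
  by rewrite exprMn; lra.
apply: Zball_norm; first by rewrite mulr_ge0.
split=> /=.
  rewrite hm_normE; apply: (le_trans (inormD hmP _ _)); rewrite (inormN hmP).
  by rewrite -!hm_normE mulr_natl mulr2n lerD.
by apply: (le_trans (ler_normB _ _)); rewrite mulr_natl mulr2n lerD.
Qed.

Definition pair_proj r (y : Z) : Z :=
  (ball_proj (@hm_dot R d H m) r y.1, ball_proj dot r y.2).

Lemma pair_proj_in r y : 0 <= r -> Zball r (pair_proj r y).
Proof.
move=> r0; split=> /=; first by rewrite hm_normE ball_proj_in.
by rewrite -(inner_normE (@rk_norm _ _ H)) ball_proj_in.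
Qed.

Lemma pair_projP r y u : 0 <= r -> Zball r u ->
  z_dot (y - pair_proj r y) (u - pair_proj r y) <= 0.
Proof.
move=> r0 [u1 u2]; rewrite /z_dot/= -[0]addr0; apply: lerD.
  exact: ball_projP.
by apply: ball_projP => //; rewrite (inner_normE (@rk_norm _ _ H)).
Qed.

Lemma ProxE r (z0 z : Z) : 0 <= r -> Prox r z0 z = pair_proj r (z0 - z).
Proof.
move=> r0; have objE v : prox_obj z0 z v = z_dot v v / 2 - z_dot (z0 - z) v.
  by rewrite /prox_obj -(opprB z0 z) (innerNl zP).
rewrite /Prox; case: xgetP => [p _ [Bp min_p]|/(_ (pair_proj r (z0 - z)))]; last first.
  case; split=> [|v Bv]; first exact: pair_proj_in.
  by rewrite !objE; apply: (prox_minimal zP); exact: pair_projP.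
apply: (prox_unique zP (pair_proj_in (z0 - z) r0)) => [v Bv||].
- exact: pair_projP.
- exact: Bp.
by rewrite -!objE; apply: min_p; exact: pair_proj_in.
Qed.

Section measurable_proj.
Context dT (T : measurableType dT).

Let mscale_norm (r : R) (f : T -> R) : measurable_fun setT f ->
  measurable_fun setT (fun t => if Num.sqrt (f t) <= r then 1 else r / Num.sqrt (f t)).
Proof.
move=> mf; have mn : measurable_fun setT (fun t => Num.sqrt (f t)).
  apply: (@measurableT_comp _ _ _ _ _ _ (@Num.sqrt R)) => //.
  by apply: continuous_measurable_fun; exact: sqrt_continuous.
apply: measurable_fun_ifT; last 2 first.
- exact: measurable_cst.
- under eq_fun do rewrite -powR_inv1 ?sqrtr_ge0//.
  apply: measurable_funM; first exact: measurable_cst.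
  exact: (measurableT_comp (measurable_powR _) mn).
exact: (measurable_fun_ler mn (@measurable_cst _ _ T R setT r)).
Qed.

Lemma strongly_measurable_pair_proj r (y : T -> Z) :
  strongly_measurable_pair y ->
  strongly_measurable_pair (fun t => pair_proj r (y t)).
Proof.
move=> [my1 my2]; split=> [j|] /=.
  under eq_fun do rewrite !ffunE.
  apply: strongly_measurableZ => //; apply: mscale_norm.
  exact: measurable_hm_dot.
apply: strongly_measurableZ => //; apply: mscale_norm.
exact: (measurable_inner dotP (@rk_norm _ _ H)).
Qed.

End measurable_proj.

(** Each component is the Riesz representative of a bounded linear form. *)
Lemma mean_element dT (T : measurableType dT) (P : probability T R) (e : T -> Z) C :
  strongly_measurable_pair e -> (forall t, z_dot (e t) (e t) <= C) ->
  exists F : Z, forall u, z_dot F u = mean P (fun t => z_dot (e t) u).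
Proof.
move=> me eC; have C0 : 0 <= C by exact: le_trans (inner_ge0 zP (e point)) (eC point).
have comp (v : T -> H) : strongly_measurable v ->
    (forall t, dot (v t) (v t) <= C) ->
    (forall h, bounded_measurable (fun t => dot (v t) h)) *
    (exists F, forall h, dot F h = mean P (fun t => dot (v t) h)).
  move=> mv vC.
  have dC h t : `|dot (v t) h| <= Num.sqrt C * `|h|.
    apply: (le_trans (normr_inner_le dotP _ _)).
    rewrite (inner_normE (@rk_norm _ _ H) h) ler_wpM2r//.
    exact: ler_wsqrtr.
  have bv h : bounded_measurable (fun t => dot (v t) h).
    split; last by exists (Num.sqrt C * `|h|).
    apply: (measurable_inner dotP (@rk_norm _ _ H)) => //.
    exact: strongly_measurable_cst.
  split=> //; apply: (riesz_representation dotP (@rk_norm _ _ H) (C := Num.sqrt C)).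
    move=> a u w; rewrite -meanZ// -meanD//; last exact: bounded_measurableZ.
    by apply: eq_mean => t; rewrite (innerDr dotP) (innerZr dotP).
  move=> h; rewrite -[leRHS](mean_cst P); apply: le_mean => //.
    exact: bounded_measurable_cst.
  by move=> t; apply: le_trans (dC h t); exact: ler_norm.
have [me1 me2] := me.
have c1 j := comp _ (me1 j); have c2 := comp _ me2.
have e1C j t : dot ((e t).1 j) ((e t).1 j) <= C.
  apply: le_trans (eC t); rewrite /z_dot /hm_dot (bigD1 j)//= -addrA lerDl.
  apply: addr_ge0; last exact: inner_ge0.
  by apply: sumr_ge0 => i _; exact: inner_ge0.
have e2C t : dot (e t).2 (e t).2 <= C.
  by apply: le_trans (eC t); rewrite /z_dot lerDr; exact: inner_ge0.
have /choice[F1 F1E] j := (c1 j (e1C j)).2; have [F2 F2E] := (c2 e2C).2.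
exists ([ffun j => F1 j] : Hm, F2) => u; rewrite /z_dot meanD; last 2 first.
- by apply: bounded_measurable_sum => j; exact: (c1 j (e1C j)).1.
- exact: (c2 e2C).1.
rewrite /= F2E; congr (_ + _); rewrite mean_sum; last first.
  by move=> j; exact: (c1 j (e1C j)).1.
by apply: eq_bigr => j _; rewrite ffunE F1E.
Qed.

End prox.

(** * The duality gap of the averaged iterate *)

Section mirror_prox.
Context {R : realType} {d m : nat} (cp : control_problem R d m) (H : rkhs R d).
Variable M : R.
Local Notation q := (cp_q cp).
Local Notation f := (cp_f cp).
Local Notation a := (cp_a cp).
Local Notation B := (cp_B cp).
Local Notation mu0 := (cp_mu0 cp).
Local Notation Hm := {ffun 'I_m -> H}.
Local Notation Z := (Hm * H)%type.
Local Notation mu := (@unif_cube R d).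
Hypotheses (kC2 : kernel_C2 H) (q1 : 1 < q) (M0 : 0 < M).
Hypotheses (fc : continuous f) (ft : torus_fun f) (ac : continuous a)
  (a_t : torus_fun a) (Bc : continuous B) (Bt : torus_fun B).
Hypotheses (mu0b : exists C : R, forall x, `|mu0 x| <= C)
  (mmu0 : measurable_fun [set: d.-tuple R] (mu0 \o pt)).
Variable c : R.
Hypotheses (c0 : 0 < c) (cO : bounds_Omega cp H M c).

Local Notation zdot := (@z_dot R d H m).
Local Notation Om := (Omega cp M).

Let zP := @z_inner R d H m.

Lemma Omega_le rV rw (z : Z) x : 0 <= rV -> 0 <= rw -> `|z.2| <= rV ->
  hm_norm z.1 <= rw -> zdot (Om z x) (Om z x) <= 2 * (c * (1 + rV + rw)) ^+ 2.
Proof.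
move=> rV0 rw0 zV zw; have [h1 h2] := cO x rV0 rw0 zV zw.
apply: Zball_norm => //; by rewrite mulr_ge0 ?(ltW c0)// !addr_ge0.
Qed.

Lemma Omega_Zball_le r (z : Z) x : 1 <= r -> Zball r z ->
  zdot (Om z x) (Om z x) <= 18 * c ^+ 2 * r ^+ 2.
Proof.
move=> r1 [zw zV]; have r0 : 0 <= r by exact: le_trans r1.
apply: (le_trans (Omega_le x r0 r0 zV zw)).
have -> : 18 * c ^+ 2 * r ^+ 2 = 2 * (c * (3 * r)) ^+ 2 by ring.
have L0 : 0 <= c * (1 + r + r) by rewrite mulr_ge0 ?(ltW c0)// !addr_ge0.
have L1 : 0 <= c * (3 * r) by rewrite !mulr_ge0 ?(ltW c0).
rewrite ler_pM2l// ler_sqr ?nnegrE// ler_pM2l//; lra.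
Qed.

(** Given by the linear form that it induces, which avoids integrating
   vector-valued functions. *)
Definition mean_oracle (z : Z) : Z :=
  riesz zdot (fun u => mean mu (fun s => zdot (Om z (pt s)) u)).

Let mOm (z : Z) : strongly_measurable_pair (fun s => Om z (pt s)).
Proof.
apply: (strongly_measurable_Omega M kC2 fc ac Bc mmu0 (X := id) (z := fun=> z)).
  exact: measurable_id.
exact: strongly_measurable_pair_cst.
Qed.

Lemma mean_oracleE z u : zdot (mean_oracle z) u = mean mu (fun s => zdot (Om z (pt s)) u).
Proof.
have le s := Omega_le (pt s) (normr_ge0 z.2) (inorm_ge0 _ z.1) (lexx _) (lexx _).
have [F FE] := mean_element mu (mOm z) le.
by rewrite /mean_oracle (riesz_eq zP (u := F)).
Qed.

Lemma zdot_bound C D (u v : Z) : zdot u u <= C -> zdot v v <= D ->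
  `|zdot u v| <= Num.sqrt C * Num.sqrt D.
Proof.
move=> uC vD; apply: (le_trans (normr_inner_le zP _ _)).
by apply: ler_pM; rewrite ?inorm_ge0// ler_wsqrtr.
Qed.

Let bounded_zdot_Om z u : bounded_measurable (fun s => zdot (Om z (pt s)) u).
Proof.
split.
  apply: measurable_z_dot; first exact: mOm.
  exact: strongly_measurable_pair_cst.
eexists => s; apply: zdot_bound; last exact: lexx.
exact: (Omega_le (pt s) (normr_ge0 z.2) (inorm_ge0 _ z.1) (lexx _) (lexx _)).
Qed.

(** Jensen's inequality, in the form of Young's inequality against the mean. *)
Lemma mean_oracle_le r z : 1 <= r -> Zball r z ->
  zdot (mean_oracle z) (mean_oracle z) <= 18 * c ^+ 2 * r ^+ 2.
Proof.
move=> r1 zr; have := mean_oracleE z; move: (mean_oracle z) => F FE.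
have bF := bounded_zdot_Om z F.
suff : zdot F F <= 2^-1 * (18 * c ^+ 2 * r ^+ 2 + zdot F F) by lra.
rewrite [leLHS]FE -[leRHS](mean_cst mu).
apply: le_mean => // [|s]; first exact: bounded_measurable_cst.
have h1 := inner_young zP (Om z (pt s)) F (ltr01 : 0 < 1 :> R).
rewrite mul1r mulr1 in h1.
have h2 := Omega_Zball_le (pt s) r1 zr.
suff h : zdot (Om z (pt s)) F <= 2^-1 * (18 * c ^+ 2 * r ^+ 2 + zdot F F) by exact: h.
apply: (le_trans h1); rewrite -mulrDr ler_pM2l ?invr_gt0//.
by rewrite lerD2r.
Qed.

Let bPsi (z : Z) : bounded_measurable (fun s => Psi_val cp M z.2 z.1 (pt s)).
Proof.
split.
  apply: (measurable_Psi_val kC2 M0 fc ac Bc mmu0 (X := id) (z := fun=> z)).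
    exact: measurable_id.
  exact: strongly_measurable_pair_cst.
have [C hC] := Psi_val_bounded kC2 q1 M0 fc ft ac a_t Bc Bt mu0b z.2 z.1.
by exists C.
Qed.

Lemma mean_PsiE V (w : Hm) :
  mean_Psi cp M V w = (mean mu (fun s => Psi_val cp M V w (pt s)))%:E.
Proof.
rewrite -meanE; last exact: (bPsi (w, V)).
by rewrite /mean_Psi; apply: eq_integral => s _; rewrite PsiE.
Qed.

Section gap.
Local Open Scope ereal_scope.

Lemma duality_gap_ge0 r (z : Z) : Zball r z -> 0 <= duality_gap cp M r z.2 z.1.
Proof.
move=> [zw zV]; rewrite /duality_gap.
have up : mean_Psi cp M z.2 z.1 <= Psi_upper cp M r z.1.
  by apply: ereal_sup_ubound; exists z.2.
have lo : Psi_lower cp M r z.2 <= mean_Psi cp M z.2 z.1.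
  by apply: ereal_inf_lbound; exists z.1.
rewrite mean_PsiE in up lo.
by apply: (@le_trans _ _ ((mean mu (fun s => Psi_val cp M z.2 z.1 (pt s)))%:E
  - (mean mu (fun s => Psi_val cp M z.2 z.1 (pt s)))%:E)); [rewrite subee|exact: leeB].
Qed.

Lemma duality_gap_le r (z : Z) (C : R) :
  (forall u : Z, Zball r u -> (mean mu (fun s => Psi_val cp M u.2 z.1 (pt s))
    - mean mu (fun s => Psi_val cp M z.2 u.1 (pt s)) <= C)%R) ->
  (0 <= r)%R -> duality_gap cp M r z.2 z.1 <= C%:E.
Proof.
move=> hC r0; rewrite /duality_gap.
have lo (V : H) : (`|V| <= r)%R ->
    mean_Psi cp M V z.1 - C%:E <= Psi_lower cp M r z.2.
  move=> Vr; apply: le_ereal_inf_tmp => _ [w wr <-].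
  rewrite !mean_PsiE -EFinB lee_fin.
  by rewrite lerBlDr -lerBlDl; exact: (hC (w, V) (conj wr Vr)).
have lo0 := lo (GRing.zero : H); rewrite normr0 mean_PsiE in lo0.
have up0 : Psi_lower cp M r z.2 <= mean_Psi cp M z.2 (GRing.zero : Hm).
  apply: ereal_inf_lbound; exists (GRing.zero : Hm) => //=.
  by rewrite hm_normE (inorm0 (@hm_inner R d H m)).
have lfin : Psi_lower cp M r z.2 \is a fin_num.
  rewrite mean_PsiE in up0; rewrite fin_numE; apply/andP; split.
    by apply/eqP => l; move: (lo0 r0); rewrite l leeNy_eq.
  by apply/eqP => l; move: up0; rewrite l leye_eq.
rewrite leeBlDr// addeC; apply: ge_ereal_sup => _ [V Vr <-].
by rewrite -leeBlDr//; exact: lo.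
Qed.

End gap.

Section pathwise.
Variables (gamma r : R) (zeta0 : Z) (x x' : nat -> 'rV[R]_d).
Hypotheses (gamma0 : 0 < gamma) (r1 : 1 <= r).
Local Notation zeta := (zeta_iter cp M gamma r zeta0 x x').
Local Notation z := (z_iter cp M gamma r zeta0 x x').

Let r0 : 0 <= r. Proof. exact: le_trans r1. Qed.

Definition noise k : Z := mean_oracle (z k) - Om (z k) (x' k).

(** The point at which the noise of step [k] is tested: it depends on the
   samples drawn before [x' k] only. *)
Definition test_point (lam : R) k : Z := z k + lam^-1 *: \sum_(j < k) noise j.

Lemma z_iter_Zball k : Zball r (z k).
Proof. by rewrite /z_iter /extrapolate ProxE//; exact: pair_proj_in. Qed.

Lemma zeta_iter_Zball k : Zball r (zeta k.+1).
Proof. by rewrite /= ProxE//; exact: pair_proj_in. Qed.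

Lemma mirror_prox_regret n (u : Z) : Zball r u ->
  \sum_(k < n.+1) zdot (Om (z k) (x' k)) (z k - u) <=
    12 * c * r ^+ 2 + 8 * r ^+ 2 / (2 * gamma)
    + n%:R * (3 / 2 * gamma * (18 * c ^+ 2 * r ^+ 2)).
Proof.
move=> ur.
apply: (extragradient_regret zP (C := Zball r) (zeta := zeta) (z := z)
  (g := fun k => Om (z k) (x' k)) (h := fun k => Om (zeta k) (x k))) => //.
- by move=> k v vr; rewrite /z_iter /extrapolate ProxE//; exact: pair_projP.
- by move=> k v vr; rewrite /= ProxE//; exact: pair_projP.
- exact: zeta_iter_Zball.
- by move=> k; apply: Omega_Zball_le => //; exact: z_iter_Zball.
- by move=> k; apply: Omega_Zball_le => //; exact: zeta_iter_Zball.
- by apply: Zball_dist => //; exact: zeta_iter_Zball.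
have c3 : 0 < 2 / (3 * c) by rewrite divr_gt0// mulr_gt0.
(* The weight 2 / (3 c) balances the two bounds 18 c^2 r^2 and 8 r^2. *)
apply: (le_trans (inner_young zP _ _ c3)).
have h1 := Omega_Zball_le (x' 0%N) r1 (z_iter_Zball 0).
have h2 := Zball_dist r0 (z_iter_Zball 0) ur.
have -> : 12 * c * r ^+ 2 = 2 / (3 * c) / 2 * (18 * c ^+ 2 * r ^+ 2)
    + (2 * (2 / (3 * c)))^-1 * (8 * r ^+ 2) by field; rewrite gt_eqF.
apply: lerD; rewrite ler_pM2l//; first by rewrite divr_gt0.
by rewrite invr_gt0 mulr_gt0.
Qed.

Lemma noise_sqr_le k : zdot (noise k) (noise k) <= 72 * c ^+ 2 * r ^+ 2.
Proof.
have h1 := Omega_Zball_le (x' k) r1 (z_iter_Zball k).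
have h2 := mean_oracle_le r1 (z_iter_Zball k).
rewrite /noise (inner_sqrB zP).
have := inner_ge0 zP (mean_oracle (z k) + Om (z k) (x' k)).
rewrite (inner_sqrD zP); move: h1 h2.
move: (zdot _ _) (zdot (mean_oracle _) (mean_oracle _)) (zdot (Om _ _) _).
by move=> *; lra.
Qed.

(** The regret of the stochastic iterates, plus the price of replacing the
   sampled oracle by its expectation uniformly over the ball. *)
Lemma mean_regret n (u : Z) lam : 0 < lam -> Zball r u ->
  \sum_(k < n.+1) zdot (mean_oracle (z k)) (z k - u) <=
    12 * c * r ^+ 2 + 8 * r ^+ 2 / (2 * gamma)
    + n%:R * (3 / 2 * gamma * (18 * c ^+ 2 * r ^+ 2))
    + (lam * r ^+ 2 + (2 * lam)^-1 * (n.+1%:R * (72 * c ^+ 2 * r ^+ 2)))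
    + \sum_(k < n.+1) zdot (noise k) (test_point lam k).
Proof.
move=> lam0 ur; have h1 := mirror_prox_regret n ur.
have h2 := noise_le zP u n.+1 lam0 noise_sqr_le.
have h3 : lam / 2 * zdot u u <= lam * r ^+ 2.
  have -> : lam * r ^+ 2 = lam / 2 * (2 * r ^+ 2) by field.
  by rewrite ler_pM2l ?divr_gt0//; exact: Zball_norm.
have e : \sum_(k < n.+1) zdot (mean_oracle (z k)) (z k - u) =
    \sum_(k < n.+1) zdot (Om (z k) (x' k)) (z k - u)
    + \sum_(k < n.+1) zdot (noise k) (z k) - zdot (\sum_(k < n.+1) noise k) u.
  rewrite (inner_suml zP) -big_split -sumrB /=; apply: eq_bigr => k _.
  rewrite /noise !(innerBl zP) !(innerBr zP).
  by move: (zdot _ _) (zdot _ _) (zdot _ _) (zdot _ _) => *; ring.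
have e' : \sum_(k < n.+1) zdot (noise k) (test_point lam k) =
    \sum_(k < n.+1) zdot (noise k) (z k)
    + \sum_(k < n.+1) zdot (noise k) (lam^-1 *: \sum_(j < k) noise j).
  by rewrite -big_split; apply: eq_bigr => k _; rewrite (innerDr zP).
rewrite e e'; move: h1 h2 h3.
move: (zdot u u) (zdot (\sum_(k < _) _) u).
move: (\sum_(k < n.+1) zdot (noise k) (z k)).
move: (\sum_(k < n.+1) zdot (noise k) (lam^-1 *: \sum_(j < k) noise j)).
move: (\sum_(k < n.+1) zdot (Om (z k) (x' k)) (z k - u)).
move: ((2 * lam)^-1 * _) (8 * r ^+ 2 / _) (12 * c * _) (_ * (3 / 2 * _ * _)).
by move=> *; lra.
Qed.

(** Integrate [Psi_gap_mean]: the mean of the oracle against a fixed direction is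
   [mean_oracle] against it. *)
Lemma mean_gap_le n (u : Z) : (0 < n)%N ->
  let zm := z_mean cp M gamma r zeta0 x x' n in
  mean mu (fun s => Psi_val cp M u.2 zm.1 (pt s))
    - mean mu (fun s => Psi_val cp M zm.2 u.1 (pt s)) <=
  n%:R^-1 * \sum_(k < n) zdot (mean_oracle (z k)) (z k - u).
Proof.
move=> n0; set zm := z_mean _ _ _ _ _ _ _ _; rewrite /=.
rewrite -meanB; [|exact: (bPsi (zm.1, u.2))|exact: (bPsi (u.1, zm.2))].
under [X in _ <= _ * X]eq_bigr do rewrite mean_oracleE.
rewrite -mean_sum -?meanZ; last 2 first.
- by apply: bounded_measurable_sum => k; exact: bounded_zdot_Om.
- by move=> k; exact: bounded_zdot_Om.
apply: le_mean => [||s].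
- by apply: bounded_measurableB; [exact: (bPsi (zm.1, u.2))|exact: (bPsi (u.1, zm.2))].
- by apply: bounded_measurableZ; apply: bounded_measurable_sum => k;
    exact: bounded_zdot_Om.
exact: (Psi_gap_mean kC2 q1 M0 (z := z) u (pt s) n0 (erefl zm)).
Qed.

Lemma z_mean_Zball n : (0 < n)%N -> Zball r (z_mean cp M gamma r zeta0 x x' n).
Proof.
move=> n0; have nr0 : 0 < n%:R :> R by rewrite ltr0n.
have fstE : (z_mean cp M gamma r zeta0 x x' n).1 =
    n%:R^-1 *: \sum_(k < n) (z k).1.
  rewrite -[LHS]/(n%:R^-1 *: (\sum_(k < n) z k).1).
  by rewrite (big_morph fst (fun _ _ => erefl) erefl).
have sndE : (z_mean cp M gamma r zeta0 x x' n).2 =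
    n%:R^-1 *: \sum_(k < n) (z k).2.
  rewrite -[LHS]/(n%:R^-1 *: (\sum_(k < n) z k).2).
  by rewrite (big_morph snd (fun _ _ => erefl) erefl).
have card : \sum_(k < n) r = r * n%:R by rewrite sumr_const card_ord mulr_natr.
split; rewrite ?fstE ?sndE.
  rewrite hm_normE (inormZ (@hm_inner R d H m)) gtr0_norm ?invr_gt0//.
  rewrite ler_pdivrMl// mulrC -card.
  apply: (le_trans (inorm_sum (@hm_inner R d H m) _ _)); apply: ler_sum => k _.
  by have [] := z_iter_Zball k.
rewrite normrZ gtr0_norm ?invr_gt0// ler_pdivrMl// mulrC -card.
apply: (le_trans (ler_norm_sum _ _ _)); apply: ler_sum => k _.
by have [] := z_iter_Zball k.
Qed.

End pathwise.

End mirror_prox.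

(** * Expectation of the duality gap *)

Section expectation.
Context {R : realType} {d m : nat} (cp : control_problem R d m) (H : rkhs R d).
Variable M : R.
Local Notation q := (cp_q cp).
Local Notation f := (cp_f cp).
Local Notation a := (cp_a cp).
Local Notation B := (cp_B cp).
Local Notation mu0 := (cp_mu0 cp).
Local Notation Hm := {ffun 'I_m -> H}.
Local Notation Z := (Hm * H)%type.
Local Notation mu := (@unif_cube R d).
Hypotheses (kC2 : kernel_C2 H) (q1 : 1 < q) (M0 : 0 < M).
Hypotheses (fc : continuous f) (ft : torus_fun f) (ac : continuous a)
  (a_t : torus_fun a) (Bc : continuous B) (Bt : torus_fun B).
Hypotheses (mu0b : exists C : R, forall x, `|mu0 x| <= C)
  (mmu0 : measurable_fun [set: d.-tuple R] (mu0 \o pt)).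
Variable c : R.
Hypotheses (c0 : 0 < c) (cO : bounds_Omega cp H M c).
Variables (n : nat) (r : R) (zeta0 : Z).
Hypotheses (n0 : (0 < n)%N) (r1 : 1 <= r).

Local Notation zdot := (@z_dot R d H m).
Local Notation Om := (Omega cp M).

Let s : R := Num.sqrt n%:R.
Let gam : R := r / (14 * c * s).
(** This weight makes the size of the ball and the energy of the noise contribute
   equally. *)
Let lam : R := 6 * c * s.

Let s_sqr : s ^+ 2 = n%:R. Proof. by rewrite sqr_sqrtr. Qed.

Let s1 : 1 <= s.
Proof. by rewrite -(sqrtr1 R) ler_wsqrtr// ler1n. Qed.

Let s0 : 0 < s. Proof. exact: lt_le_trans s1. Qed.
Let r0 : 0 < r. Proof. exact: lt_le_trans r1. Qed.
Let gam0 : 0 < gam. Proof. by rewrite divr_gt0// !mulr_gt0. Qed.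
Let lam0 : 0 < lam. Proof. by rewrite !mulr_gt0. Qed.

(** The constant 82 is the sum of 12 for the first iteration, 56 for the initial
   distance, at most 2 for the size of the increments and 12 for the noise. *)
Lemma mirror_prox_constants (N : R) : 0 <= N <= s ^+ 2 ->
  12 * c * r ^+ 2 + 8 * r ^+ 2 / (2 * gam)
    + N * (3 / 2 * gam * (18 * c ^+ 2 * r ^+ 2))
    + (lam * r ^+ 2 + (2 * lam)^-1 * (s ^+ 2 * (72 * c ^+ 2 * r ^+ 2))) <=
  82 * (c * r ^+ 3 * s).
Proof.
move=> /andP[N0 Ns].
have e1 : 8 * r ^+ 2 / (2 * gam) = 56 * (c * r * s).
  by rewrite /gam; field; rewrite !gt_eqF.
have e2 : (2 * lam)^-1 * (s ^+ 2 * (72 * c ^+ 2 * r ^+ 2)) = 6 * (c * r ^+ 2 * s).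
  by rewrite /lam; field; rewrite !gt_eqF.
have e3 : N * (3 / 2 * gam * (18 * c ^+ 2 * r ^+ 2)) <= 27 / 14 * (c * r ^+ 3 * s).
  have -> : N * (3 / 2 * gam * (18 * c ^+ 2 * r ^+ 2)) =
      N * (27 / 14 * (c * r ^+ 3 / s)) by rewrite /gam; field; rewrite !gt_eqF.
  have -> : 27 / 14 * (c * r ^+ 3 * s) = s ^+ 2 * (27 / 14 * (c * r ^+ 3 / s)).
    by field; rewrite gt_eqF.
  by rewrite ler_wpM2r// !mulr_ge0 ?invr_ge0 ?exprn_ge0 ?(ltW c0) ?(ltW r0) ?(ltW s0).
have cr2 : 0 <= c * r ^+ 2 by rewrite mulr_ge0 ?(ltW c0)// exprn_ge0// ltW.
have i2 : c * r ^+ 2 * s <= c * r ^+ 3 * s.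
  have -> : c * r ^+ 3 * s = c * r ^+ 2 * s * r by ring.
  by rewrite ler_peMr// mulr_ge0 ?(ltW s0).
have i1 : c * r ^+ 2 <= c * r ^+ 3 * s.
  by apply: le_trans i2; rewrite ler_peMr.
have i0 : c * r * s <= c * r ^+ 3 * s.
  apply: le_trans i2; rewrite ler_pM2r// ler_pM2l// expr2 ler_peMr//.
  exact: ltW.
rewrite e1 e2 /lam.
have -> : 12 * c * r ^+ 2 = 12 * (c * r ^+ 2) by ring.
have -> : 6 * c * s * r ^+ 2 = 6 * (c * r ^+ 2 * s) by ring.
have p0 : 0 <= c * r ^+ 3 * s by exact: le_trans cr2 i1.
move: i0 i1 i2 e3 p0; move: (N * _) (c * r * s) (c * r ^+ 2 * s) (c * r ^+ 3 * s).
move: (c * r ^+ 2) => *; lra.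
Qed.

Section fixed_samples.
Variables (x x' : nat -> 'rV[R]_d).

Lemma mirror_prox_gap_ge0 : (0 <= mirror_prox_gap cp M c zeta0 x x' n r)%E.
Proof.
apply: duality_gap_ge0 => //; exact: z_mean_Zball.
Qed.

Lemma mirror_prox_gap_le : (mirror_prox_gap cp M c zeta0 x x' n r <=
  (82 * (c * r ^+ 3 / s) + n%:R^-1 * \sum_(k < n)
    zdot (noise cp M gam r zeta0 x x' k)
      (test_point cp M gam r zeta0 x x' lam k))%:E)%E.
Proof.
apply: duality_gap_le => //; last exact: ltW.
move=> u ur; have nr0 : 0 < n%:R :> R by rewrite ltr0n.
have := mean_gap_le kC2 q1 M0 fc ft ac a_t Bc Bt mu0b mmu0 c0 cO
  gam r zeta0 x x' u n0.
rewrite /= -/s -/gam => h; apply: (le_trans h).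
have -> : 82 * (c * r ^+ 3 / s) = n%:R^-1 * (82 * (c * r ^+ 3 * s)).
  by rewrite -s_sqr; field; rewrite gt_eqF.
rewrite -mulrDr ler_pM2l ?invr_gt0//.
move: (n0) => /prednK nE; rewrite -nE.
have := mean_regret kC2 fc ac Bc mmu0 c0 cO zeta0 x x' gam0 r1 n.-1 lam0 ur.
move=> /le_trans; apply; rewrite lerD2r nE -s_sqr.
apply: mirror_prox_constants; rewrite ler0n s_sqr ler_nat/=.
exact: leq_pred.
Qed.

End fixed_samples.

Section measurable_iterates.
Context dT (T : measurableType dT) (X X' : nat -> T -> d.-tuple R).

Local Notation zeta_ k := (fun t => zeta_iter cp M gam r zeta0
  (fun j => pt (X j t)) (fun j => pt (X' j t)) k).
Local Notation z_ k := (fun t => z_iter cp M gam r zeta0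
  (fun j => pt (X j t)) (fun j => pt (X' j t)) k).

Let prox_measurable (y g : T -> Z) (Y : T -> d.-tuple R) :
  measurable_fun setT Y -> strongly_measurable_pair y ->
  strongly_measurable_pair g ->
  strongly_measurable_pair
    (fun t => Prox r (y t) (gam *: Om (g t) (pt (Y t)))).
Proof.
move=> mY my mg; under eq_fun do rewrite (ProxE _ _ (ltW r0)).
apply: strongly_measurable_pair_proj; apply: strongly_measurable_pairB => //.
apply: strongly_measurable_pairZ.
exact: (strongly_measurable_Omega M kC2 fc ac Bc mmu0).
Qed.

Lemma zeta_iter_measurable k :
  (forall j, (j < k)%N -> measurable_fun setT (X j) /\ measurable_fun setT (X' j)) ->
  strongly_measurable_pair (zeta_ k).
Proof.
elim: k => [|k IH] mX; first exact: strongly_measurable_pair_cst.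
have {}IH := IH (fun j jk => mX j (leqW jk)).
have [mXk mXk'] := mX k (ltnSn k).
by apply: prox_measurable => //; exact: prox_measurable.
Qed.

Lemma z_iter_measurable k : measurable_fun setT (X k) ->
  (forall j, (j < k)%N -> measurable_fun setT (X j) /\ measurable_fun setT (X' j)) ->
  strongly_measurable_pair (z_ k).
Proof.
by move=> mXk mX; apply: prox_measurable => //; exact: zeta_iter_measurable.
Qed.

Local Notation test_ k := (fun t => test_point cp M gam r zeta0
  (fun j => pt (X j t)) (fun j => pt (X' j t)) lam k).

(** The tested noise of step [k] is the difference between the mean of this
   function over a fresh sample and its value at the sample drawn. *)
Definition fresh_test k (p : T * d.-tuple R) : R :=
  zdot (Om (z_ k p.1) (pt p.2)) (test_ k p.1).

Lemma noiseE k t :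
  zdot (noise cp M gam r zeta0 (fun j => pt (X j t)) (fun j => pt (X' j t)) k)
    (test_ k t) =
  mean mu (fun y => fresh_test k (t, y)) - fresh_test k (t, X' k t).
Proof.
rewrite /noise (innerBl (@z_inner R d H m)); congr (_ - _).
exact: (mean_oracleE kC2 fc ac Bc mmu0 c0 cO).
Qed.

(** The expectations inside the test point are parametric integrals over one more
   sample, so that expanding the inner product leaves only functions of three
   variables covered by Tonelli's theorem. *)
Lemma fresh_test_bounded k : measurable_fun setT (X k) ->
  (forall j, (j < k)%N -> measurable_fun setT (X j) /\ measurable_fun setT (X' j)) ->
  bounded_measurable (fresh_test k).
Proof.
move=> mXk mX.
have mz j : (j <= k)%N -> strongly_measurable_pair (z_ j).
  rewrite leq_eqVlt => /predU1P[->|jk]; first exact: z_iter_measurable.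
  apply: z_iter_measurable; first by have [] := mX j jk.
  by move=> i ij; apply: mX; exact: ltn_trans ij jk.
have zr j t : Zball r (z_ j t) by exact: z_iter_Zball.
pose G := 18 * c ^+ 2 * r ^+ 2.
have OmG j t y : zdot (Om (z_ j t) y) (Om (z_ j t) y) <= G.
  by apply: Omega_Zball_le => //; exact: zr.
have mA : strongly_measurable_pair
    (fun p : T * d.-tuple R => Om (z_ k p.1) (pt p.2)).
  apply: (strongly_measurable_Omega M kC2 fc ac Bc mmu0 (X := snd)
    (z := fun p : T * d.-tuple R => z_ k p.1)); first exact: measurable_snd.
  exact: (strongly_measurable_pair_comp measurable_fst (mz k (leqnn k))).
have bz : bounded_measurable
    (fun p : T * d.-tuple R => zdot (Om (z_ k p.1) (pt p.2)) (z_ k p.1)).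
  split.
    apply: measurable_z_dot => //.
    exact: (strongly_measurable_pair_comp measurable_fst (mz k (leqnn k))).
  eexists => p; apply: zdot_bound; first exact: OmG.
  exact: (Zball_norm (ltW r0) (zr k p.1)).
have bO j : (j < k)%N -> bounded_measurable (fun p : T * d.-tuple R =>
    zdot (Om (z_ j p.1) (pt (X' j p.1))) (Om (z_ k p.1) (pt p.2))).
  move=> jk; split; last by eexists => p; apply: zdot_bound; exact: OmG.
  apply: measurable_z_dot => //.
  have [mXj mXj'] := mX j jk.
  apply: (strongly_measurable_pair_comp (T2 := T) (X := fst)
    (z := fun t => Om (z_ j t) (pt (X' j t))) measurable_fst).
  by apply: (strongly_measurable_Omega M kC2 fc ac Bc mmu0) => //;
    exact: mz (ltnW jk).
have bF j : (j < k)%N -> bounded_measurable (fun p : T * d.-tuple R =>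
    zdot (mean_oracle cp M (z_ j p.1)) (Om (z_ k p.1) (pt p.2))).
  move=> jk; under eq_fun do rewrite (mean_oracleE kC2 fc ac Bc mmu0 c0 cO).
  apply: (bounded_measurable_mean mu
    (f := fun u : (T * d.-tuple R) * d.-tuple R =>
      zdot (Om (z_ j u.1.1) (pt u.2)) (Om (z_ k u.1.1) (pt u.1.2)))).
  split; last by eexists => u; apply: zdot_bound; exact: OmG.
  apply: measurable_z_dot; last first.
    exact: (strongly_measurable_pair_comp (X := fst)
      (z := fun p : T * d.-tuple R => Om (z_ k p.1) (pt p.2)) measurable_fst mA).
  apply: (strongly_measurable_Omega M kC2 fc ac Bc mmu0 (X := snd)
    (z := fun u : (T * d.-tuple R) * d.-tuple R => z_ j u.1.1)).
    exact: measurable_snd.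
  apply: (strongly_measurable_pair_comp (X := fst)
    (z := fun p : T * d.-tuple R => z_ j p.1) measurable_fst).
  exact: (strongly_measurable_pair_comp measurable_fst (mz j (ltnW jk))).
have e : fresh_test k = fun p => zdot (Om (z_ k p.1) (pt p.2)) (z_ k p.1)
    + lam^-1 * \sum_(j < k) (zdot (mean_oracle cp M (z_ j p.1))
        (Om (z_ k p.1) (pt p.2)) -
      zdot (Om (z_ j p.1) (pt (X' j p.1))) (Om (z_ k p.1) (pt p.2))).
  apply/funext => p; rewrite /fresh_test /test_point.
  rewrite (innerDr (@z_inner R d H m)) (innerZr (@z_inner R d H m)).
  rewrite (innerC (@z_inner R d H m) _ (\sum_(j < k) _)).
  rewrite (inner_suml (@z_inner R d H m)); congr (_ + _ * _).
  by apply: eq_bigr => j _; rewrite /noise (innerBl (@z_inner R d H m)).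
rewrite e; apply: bounded_measurableD => //; apply: bounded_measurableZ.
apply: bounded_measurable_sum => j; apply: bounded_measurableB.
  exact: bF (ltn_ord j).
exact: bO (ltn_ord j).
Qed.

End measurable_iterates.

End expectation.

Section expected_gap.
Context {R : realType} {d m : nat} (cp : control_problem R d m) (H : rkhs R d).
Variable M : R.
Local Notation f := (cp_f cp).
Local Notation a := (cp_a cp).
Local Notation B := (cp_B cp).
Local Notation mu0 := (cp_mu0 cp).
Local Notation Z := ({ffun 'I_m -> H} * H)%type.
Local Notation mu := (@unif_cube R d).
Hypotheses (kC2 : kernel_C2 H) (q1 : 1 < cp_q cp) (M0 : 0 < M).
Hypotheses (fc : continuous f) (ft : torus_fun f) (ac : continuous a)
  (a_t : torus_fun a) (Bc : continuous B) (Bt : torus_fun B).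
Hypotheses (mu0b : exists C : R, forall x, `|mu0 x| <= C)
  (mmu0 : measurable_fun [set: d.-tuple R] (mu0 \o pt)).
Variable c : R.
Hypotheses (c0 : 0 < c) (cO : bounds_Omega cp H M c).
Context dO (O : measurableType dO) (P : probability O R).
Variables (x x' : nat -> {RV P >-> d.-tuple R}) (zeta0 : Z).
Hypotheses
  (xmu : forall k A, measurable A -> distribution P (x k) A = mu A)
  (xmu' : forall k A, measurable A -> distribution P (x' k) A = mu A).
Let sample (p : nat * bool) : {RV P >-> d.-tuple R} := if p.2 then x' p.1 else x p.1.
Hypothesis indep : mutually_independent sample.

(** The indices of the samples on which [z_iter] at rank [k] depends. *)
Let past (k : nat) : seq (nat * bool) :=
  (k, false) :: [seq (j, b) | j <- iota 0 k, b <- [:: true; false]].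

Let mem_past k j b : (j < k)%N -> (j, b) \in past k.
Proof.
move=> jk; rewrite inE; apply/orP; right; apply/allpairsP; exists (j, b).
by rewrite mem_iota /= jk !inE; case: b.
Qed.

Let notin_past k b : (k, b) \notin [seq (j, b) | j <- iota 0 k, b <- [:: true; false]].
Proof.
by apply/negP => /allpairsP[[j b'] [/=]]; rewrite mem_iota => jk _ [kj]; lia.
Qed.

Let uniq_past k : uniq ((k, true) :: past k).
Proof.
have uniq_pairs : uniq [seq (j, b) | j <- iota 0 k, b <- [:: true; false]].
  by apply: allpairs_uniq => //; [exact: iota_uniq|move=> [? ?] [? ?] _ _].
rewrite /past cons_uniq inE negb_or notin_past cons_uniq notin_past uniq_pairs.
by rewrite !andbT; apply/eqP.
Qed.

Let sample_mu i A : measurable A -> distribution P (sample i) A = mu A.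
Proof. by rewrite /sample; case: i.2 => mA; [exact: xmu'|exact: xmu]. Qed.

Section fixed_horizon.
Variables (n : nat) (r : R).
Hypotheses (n0 : (0 < n)%N) (r1 : 1 <= r).

Let phi k : history sample (past k) * d.-tuple R -> R :=
  fresh_test cp M c n r zeta0 (fun j => x j) (fun j => x' j) k.
Arguments phi : clear implicits.

Let phi_bounded k : bounded_measurable (phi k).
Proof.
have := fresh_test_bounded kC2 fc ac Bc mmu0 c0 cO n zeta0 r1
  (T := history sample (past k)) (X := fun j => x j) (X' := fun j => x' j) (k := k).
apply.
  by apply: (history_measurable (X := sample) (i := (k, false))); exact: mem_head.
move=> j jk; split.
  by apply: (history_measurable (X := sample) (i := (j, false))); exact: mem_past.
by apply: (history_measurable (X := sample) (i := (j, true))); exact: mem_past.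
Qed.

Let phi_mean_bounded k :
  bounded_measurable (fun o : O => mean mu (fun y => phi k (o, y))).
Proof.
exact: (bounded_measurable_comp (@history_id _ _ _ _ _ P _ sample (past k))
  (bounded_measurable_mean mu (phi_bounded k))).
Qed.

Let phi_sample_bounded k : bounded_measurable (fun o : O => phi k (o, x' k o)).
Proof.
apply: (bounded_measurable_comp (X := fun o : O =>
  ((o, x' k o) : history sample (past k) * d.-tuple R)) _ (phi_bounded k)).
apply/measurable_fun_pair; first exact: history_id.
exact: measurable_funP.
Qed.

(** Given the past, the sampled oracle and its expectation have the same mean
   against the test point, so that only the constant term survives. *)
Lemma expected_gap_le :
  (\int[P]_om mirror_prox_gap cp M c zeta0
       (fun k => pt (x k om)) (fun k => pt (x' k om)) n r <=
   (82 * (c * r ^+ 3 / Num.sqrt n%:R))%:E)%E.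
Proof.
pose g (o : O) := 82 * (c * r ^+ 3 / Num.sqrt n%:R) + n%:R^-1 *
  \sum_(k < n) (mean mu (fun y => phi k (o, y)) - phi k (o, x' k o)).
have bnoise (k : 'I_n) : bounded_measurable (fun o : O =>
    mean mu (fun y => phi k (o, y)) - phi k (o, x' k o)).
  by apply: bounded_measurableB; [exact: phi_mean_bounded|exact: phi_sample_bounded].
have bg : bounded_measurable g.
  apply: bounded_measurableD; first exact: bounded_measurable_cst.
  by apply: bounded_measurableZ; apply: bounded_measurable_sum => k; exact: bnoise.
have gE : mean P g = 82 * (c * r ^+ 3 / Num.sqrt n%:R).
  rewrite /g meanD; last 2 first.
  - exact: bounded_measurable_cst.
  - by apply: bounded_measurableZ; apply: bounded_measurable_sum => k; exact: bnoise.
  rewrite mean_cst meanZ; last by apply: bounded_measurable_sum => k; exact: bnoise.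
  rewrite mean_sum; last exact: bnoise.
  rewrite big1 ?mulr0 ?addr0// => k _.
  rewrite meanB//.
  apply/eqP; rewrite subr_eq0; apply/eqP/esym.
  exact: (mean_history sample_mu indep (uniq_past k) (phi_bounded k)).
rewrite -gE; apply: integral_le_mean => // o.
  exact: mirror_prox_gap_ge0.
apply: (le_trans (mirror_prox_gap_le kC2 q1 M0 fc ft ac a_t Bc Bt mu0b mmu0 c0 cO
  zeta0 n0 r1 _ _)).
rewrite lee_fin lerD2l ler_pM2l ?invr_gt0 ?ltr0n//.
apply: ler_sum => k _.
by rewrite (noiseE kC2 fc ac Bc mmu0 c0 cO n r zeta0 (fun j => x j) (fun j => x' j) k o).
Qed.

Lemma expected_gap_ge0 :
  (0 <= \int[P]_om mirror_prox_gap cp M c zeta0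
       (fun k => pt (x k om)) (fun k => pt (x' k om)) n r)%E.
Proof. by apply: integral_ge0 => o _; exact: mirror_prox_gap_ge0. Qed.

End fixed_horizon.

End expected_gap.

Section power_sequences.
Context {R : realType}.

Lemma near_le_powR (p A : R) : 0 < p -> \forall n \near \oo, A <= n%:R `^ p.
Proof.
move=> p0; near=> n; apply: (le_trans (ler_norm A)).
have -> : `|A| = (`|A| `^ p^-1) `^ p.
  by rewrite -powRrM mulVf ?gt_eqF// powRr1.
apply: ge0_ler_powR; rewrite ?nnegrE ?powR_ge0 ?(ltW p0)//.
by near: n; exact: nbhs_infty_ger.
Unshelve. all: by end_near. Qed.

(** The ratio is a multiple of [n^(3 al - 1/2)]. *)
Lemma cvg_powR_ratio (al C : R) : 0 < al < 6^-1 ->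
  (C * n%:R `^ al) ^+ 3 / Num.sqrt n%:R @[n --> \oo] --> (0 : R).
Proof.
move=> /andP[al0 al6]; have del0 : 0 < 2^-1 - al * 3 by lra.
apply/cvgrPdist_lt => e e0; near=> n; rewrite sub0r normrN.
have n0 : (0 < n%:R :> R) by rewrite ltr0n; near: n; exact: nbhs_infty_gt.
have e3 : (n%:R `^ al) ^+ 3 = n%:R `^ (al * 3) :> R.
  by rewrite -powR_mulrn ?powR_ge0// -powRrM.
rewrite exprMn e3 -powR12_sqrt ?(ltW n0)//.
have -> : C ^+ 3 * n%:R `^ (al * 3) / n%:R `^ 2^-1 =
    C ^+ 3 / n%:R `^ (2^-1 - al * 3).
  rewrite powRB ?(gt_eqF n0) ?implybT//; field.
  by rewrite !gt_eqF ?powR_gt0.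
have p0 : 0 < n%:R `^ (2^-1 - al * 3) by exact: powR_gt0.
rewrite normrM normrV ?unitfE ?gt_eqF// (gtr0_norm p0) ltr_pdivrMr//.
rewrite mulrC -ltr_pdivrMr//.
have h : `|C ^+ 3| / e + 1 <= n%:R `^ (2^-1 - al * 3).
  by near: n; exact: near_le_powR.
lra.
Unshelve. all: by end_near. Qed.

End power_sequences.

Unset Implicit Arguments.
Set Strict Implicit.
Set Printing Implicit Defensive.

Theorem theorem4 (R : realType) (d m : nat) (cp : control_problem R d m)
    (H : rkhs R d) (M : R)
    (* standing assumptions *)
    (d_ge1 : (1 <= d)%N) (m_ge1 : (1 <= m)%N)
    (rho_gt0 : 0 < cp_rho cp)
    (q_range : 1 < cp_q cp <= 2)
    (q'_conj : (cp_q cp)^-1 + (cp_q' cp)^-1 = 1)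
    (f_torus : torus_fun (cp_f cp)) (f_ge0 : forall x, 0 <= cp_f cp x)
    (a_torus : torus_fun (cp_a cp)) (B_torus : torus_fun (cp_B cp))
    (mu0_density : full_support_bounded_density (cp_mu0 cp))
    (H_sub_L2 : sub_L2 H) (H_dense_L2 : dense_L2 H) (K_C2 : kernel_C2 H)
    (* assumptions of the theorem *)
    (f_lip : lipschitz (cp_f cp)) (a_lip : lipschitz (cp_a cp))
    (B_lip : lipschitz (cp_B cp))
    (a_range : in_range_Linfty (cp_a cp) (cp_B cp))
    (M_gt0 : 0 < M) (mu_opt_le_M : optimal_occupation_bounded cp M) :
  (exists c : R, 0 < c /\ bounds_Omega cp H M c) /\
  forall (c : R), 0 < c -> bounds_Omega cp H M c ->
  forall (zeta0 : {ffun 'I_m -> H} * H)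
    (dO : measure_display) (O : measurableType dO) (P : probability O R)
    (x x' : nat -> {RV P >-> d.-tuple R}),
  (forall k A, measurable A -> distribution P (x k) A = unif_cube d A) ->
  (forall k A, measurable A -> distribution P (x' k) A = unif_cube d A) ->
  mutually_independent
    (fun p : nat * bool => if p.2 then x' p.1 else x p.1) ->
  let expected_gap (n : nat) (r : R) : \bar R :=
    (\int[P]_om mirror_prox_gap cp M c zeta0
       (fun k => pt (x k om)) (fun k => pt (x' k om)) n r)%E in
  (forall (n : nat) (r : R), (1 <= n)%N -> 1 <= r ->
     (expected_gap n r <= (110 * c * (r ^+ 3 / Num.sqrt n%:R))%:E)%E) /\
  (forall (alpha C : R), 0 < alpha < 6^-1 -> 0 < C ->
     (fun n : nat => expected_gap n (C * n%:R `^ alpha)) @ \oo --> 0%E).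
Proof.
have /andP[q1 q2] := q_range.
have [_ mmu0 [mu00 [Cmu hmu]] _ _] := mu0_density.
have mu0b : exists C : R, forall x, `|cp_mu0 cp x| <= C.
  by exists Cmu => x; rewrite ger0_norm.
have fc := lipschitz_continuous f_lip; have ac := lipschitz_continuous a_lip.
have Bc := lipschitz_continuous B_lip.
split; first exact: (bounds_Omega_exist K_C2 q1 q2 M_gt0 fc f_torus ac a_torus
  Bc B_torus mu0b).
move=> c c0 cO zeta0 dO O P x x' xmu xmu' indep expected_gap.
have gap_le n r : (1 <= n)%N -> 1 <= r ->
    (expected_gap n r <= (110 * c * (r ^+ 3 / Num.sqrt n%:R))%:E)%E.
  move=> n1 r1.
  apply: (le_trans (expected_gap_le K_C2 q1 M_gt0 fc f_torus ac a_torus Bc B_torus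
    mu0b mmu0 c0 cO zeta0 xmu xmu' indep n1 r1)).
  have r0 : 0 < r by exact: lt_le_trans r1.
  have p0 : 0 < r ^+ 3 / Num.sqrt n%:R.
    by rewrite divr_gt0 ?exprn_gt0// sqrtr_gt0 ltr0n.
  rewrite lee_fin -[110 * c * _]mulrA -[c * _ / _]mulrA ler_wpM2r//.
    by rewrite ltW// mulr_gt0.
  by rewrite ler_nat.
split=> // alpha C alpha6 C0.
have [alpha0 _] := andP alpha6.
apply: (@squeeze_cvge _ _ _ _ (fun=> 0%E) _
  (fun n : nat => (110 * c * ((C * n%:R `^ alpha) ^+ 3 / Num.sqrt n%:R))%:E)).
- near=> n; have n1 : (1 <= n)%N by near: n; exact: nbhs_infty_ge.
  have r1 : 1 <= C * n%:R `^ alpha.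
    rewrite mulrC -ler_pdivrMr// mul1r; near: n.
    exact: near_le_powR.
  apply/andP; split; last exact: gap_le.
  exact: (expected_gap_ge0 K_C2 q1 M_gt0 fc f_torus ac a_torus Bc B_torus
    mu0b mmu0 c x x' zeta0 n1 r1).
- exact: cvg_cst.
apply: cvg_EFin; first by near=> n.
rewrite -[0 : R](mulr0 (110 * c)); apply: cvgMr.
exact: cvg_powR_ratio.
Unshelve. all: by end_near. Qed.
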